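(* Let $0<a<1$ and let $(\Omega,c_l)$ satisfy the fixed-profile hypotheses (H$_{\mathrm{prof}}$), (K4$^+$), (D$_\infty$) listed in the context. Put $q_-=\inf_{y>0}q(y)$, $q_+=\sup_{y>0}q(y)$, $$E_-=-1+\frac{c_l}{2}+\left(1+\frac a2\right)q_--aJ_1,\qquad E_+=-1+\frac{c_l}{2}+\left(1+\frac a2\right)q_++aJ_1 .$$ Then every $\varphi\in D_a$ and every $\lambda\in\mathbb C$ with $\operatorname{Re}\lambda\notin[E_-,E_+]$ satisfy $$\|(L_a-\lambda)\varphi\|_2\ge\operatorname{dist}\bigl(\operatorname{Re}\lambda,[E_-,E_+]\bigr)\,\|\varphi\|_2 .$$ In particular $L_a-\lambda$ is injective there, and every eigenvalue of $L_a:D_a\subset X\to X$ lies in the closed vertical slab $E_-\le\operatorname{Re}\lambda\le E_+$.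
   Context: Hilbert transforms. $H$ is the Hilbert transform on $\mathbb R$, $Hf(x)=\frac1\pi\,\mathrm{p.v.}\int_{\mathbb R}\frac{f(t)}{x-t}\,dt$. On $(0,\infty)$ put $H_{\mathrm{odd}}\varphi(y)=\frac1\pi\,\mathrm{p.v.}\int_0^\infty\varphi(t)\left[\frac1{y-t}-\frac1{y+t}\right]dt$ and $V(\varphi)(y)=\int_0^y(H_{\mathrm{odd}}\varphi)(s)\,ds$. $\|\cdot\|_2$ is the norm of $L^2(0,\infty)$ (complex-valued functions). Fixed-profile hypotheses. $0<a<1$; $\Omega:\mathbb R\to\mathbb R$ is smooth and odd; $q=H\Omega$, $U(y)=\int_0^y q(s)\,ds$, $b(y)=c_ly+aU(y)$, $\tilde c=c_l+aq(0)$; and the following hold. (H$_{\mathrm{prof}}$) $\Omega+b\Omega'=\Omega q$; $0<c_l<2$; $\Omega\in L^2$; $\Omega'(0)=-4$; there are constants with $0<\beta_-\le b(y)/y\le\beta_+<\infty$ for all $y>0$; for some $r_{\mathrm{org}}>0$ the numbers $M_1=\sup_{(0,r_{\mathrm{org}})}|q'|$, $M_2=\sup_{(0,r_{\mathrm{org}})}|\Omega''|$, $M_3=\sup_{(0,r_{\mathrm{org}})}|\Omega(y)-\Omega'(0)y|/y^3$, $M_4=\sup_{(0,r_{\mathrm{org}})}|q''|$ are finite; and $q(0)-\tilde c=1$. (K4$^+$) The numbers $Q_0=\|q\|_\infty$, $Q_1=\|q'\|_\infty$, $W_j=\|\Omega^{(j)}\|_\infty$ ($j=0,1,2$), $I_q=\int_0^\infty|q|\,dy$,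 $J_k=\left(\int_0^\infty y|\Omega^{(k)}(y)|^2dy\right)^{1/2}$ ($k=1,2,3$) are finite. (D$_\infty$) For some $C_q,C_\Omega>0$ and $\alpha_{\rm dec}>1$: $|q(y)|\le C_q(1+y)^{-\min(\alpha_{\rm dec},2)}$ and $|\Omega(y)|\le C_\Omega(1+y)^{-\alpha_{\rm dec}}$ for $y>0$; $U(y)\to U_\infty\in\mathbb R$ as $y\to\infty$; and $b(y)=c_ly+O(1)$. Operator. $X=\{\varphi\in L^2(0,\infty):\varphi(0)=0,\ \varphi''\in L^2(0,\infty)\}$ with $\|\varphi\|_X=(\|\varphi\|_2^2+\|\varphi''\|_2^2)^{1/2}$. $L_a\varphi=-\varphi-b\varphi'+q\varphi+\Omega H_{\mathrm{odd}}\varphi-aV(\varphi)\Omega'$ with maximal domain $D_a=\{\varphi\in X:L_a\varphi\in X\}$. *)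

(* Defs.v *)
From HB Require Import structures.
From mathcomp Require Import all_boot all_order all_algebra.
From mathcomp Require Import all_classical all_reals all_analysis.
From mathcomp Require Import complex.

Set Implicit Arguments.
Unset Strict Implicit.
Unset Printing Implicit Defensive.

Import Order.TTheory GRing.Theory Num.Theory.
Import numFieldNormedType.Exports.

Local Open Scope complex_scope.
Local Open Scope classical_set_scope.
Local Open Scope ring_scope.

(* In ring_scope these notations denote derivatives of polynomials. *)
Local Notation "f ^` ()" := (derive1 f) : ring_scope.
Local Notation "f ^` ( n )" := (derive1n n f) : ring_scope.

(* Functions on (0,oo) are represented by functions on R whose values outside
   (0,oo) are never used. *)
Notation halfline R := (`]0, +oo[%classic : set R).

Definition smooth (R : realType) (f : R -> R) : Prop :=
  forall (n : nat) (x : R), derivable (f^`(n)) x 1.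

Definition finite_sup (R : realType) (A : set R) (f : R -> R) : Prop :=
  has_ubound [set `|f y| | y in A].

(* p.v. integral over D of an integrand F whose singularity is at x. *)
Definition pv_integral (R : realType) (D : set R) (F : R -> R) (x : R) : R :=
  lim ((\int[lebesgue_measure]_(t in D `&` [set t | e < `|x - t|]) F t)
         @[e --> 0^'+]).

Definition hilbert (R : realType) (f : R -> R) (x : R) : R :=
  pi^-1 * pv_integral setT (fun t => f t / (x - t)) x.

Definition hilbert_odd (R : realType) (f : R -> R) (y : R) : R :=
  pi^-1 * pv_integral (halfline R)
            (fun t => f t * ((y - t)^-1 - (y + t)^-1)) y.

(* Oriented integral of f from 0 to y. *)
Definition primitive0 (R : realType) (f : R -> R) (y : R) : R :=
  if 0 <= y then \int[lebesgue_measure]_(s in `[0, y]) f s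
  else - \int[lebesgue_measure]_(s in `[y, 0]) f s.

Definition Vop (R : realType) (f : R -> R) : R -> R :=
  primitive0 (hilbert_odd f).

(* Complex-linear extension of a real operator, acting on the real and
   imaginary parts. *)
Definition cext (R : realType) (T : (R -> R) -> R -> R) (f : R -> R[i])
    (y : R) : R[i] :=
  T (fun t => complex.Re (f t)) y +i* T (fun t => complex.Im (f t)) y.

Section Profile.
Context (R : realType) (a c_l : R) (Omega : R -> R).

Definition prof_q : R -> R := hilbert Omega.

Definition prof_U : R -> R := primitive0 prof_q.

Definition prof_b (y : R) : R := c_l * y + a * prof_U y.

Definition prof_ctilde : R := c_l + a * prof_q 0.

(* J_k as an extended real. *)
Definition prof_J (k : nat) : \bar R :=
  ((\int[lebesgue_measure]_(y in halfline R) (y * `|Omega^`(k) y| ^+ 2)%:E)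
     `^ (2^-1))%E.

(* Finiteness of a supremum of q' or q'' includes the existence of that
   derivative on the set in question. *)
Record H_prof : Prop := HProf {
  prof_eq : forall y, Omega y + prof_b y * Omega^`() y = Omega y * prof_q y ;
  prof_cl : 0 < c_l < 2 ;
  prof_L2 : finite_norm lebesgue_measure 2%:E Omega ;
  prof_slope : Omega^`() 0 = - 4 ;
  prof_beta : exists beta_m beta_p : R, 0 < beta_m /\
    forall y, 0 < y -> beta_m <= prof_b y / y <= beta_p ;
  prof_org : exists2 r : R, 0 < r &
    [/\ (forall y, 0 < y < r ->
           derivable prof_q y 1 /\ derivable (prof_q^`()) y 1),
        finite_sup `]0, r[ (prof_q^`()),
        finite_sup `]0, r[ (Omega^`(2)),
        finite_sup `]0, r[ (fun y => (Omega y - Omega^`() 0 * y) / y ^+ 3) &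
        finite_sup `]0, r[ (prof_q^`(2))] ;
  prof_norm : prof_q 0 - prof_ctilde = 1 }.

Record K4_plus : Prop := K4Plus {
  K4_Q0 : finite_sup setT prof_q ;
  K4_dq : forall y, derivable prof_q y 1 ;
  K4_Q1 : finite_sup setT (prof_q^`()) ;
  K4_W : forall j : nat, (j <= 2)%N -> finite_sup setT (Omega^`(j)) ;
  K4_Iq : (\int[lebesgue_measure]_(y in halfline R) `|prof_q y|%:E < +oo)%E ;
  K4_J : forall k : nat, (1 <= k <= 3)%N -> (prof_J k < +oo)%E }.

Definition D_infty : Prop :=
  exists C_q C_Omega alpha U_infty C : R,
    [/\ 0 < C_q, 0 < C_Omega & 1 < alpha] /\
    [/\ (forall y, 0 < y ->
           `|prof_q y| <= C_q * (1 + y) `^ (- Num.min alpha 2)),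
        (forall y, 0 < y -> `|Omega y| <= C_Omega * (1 + y) `^ (- alpha)),
        prof_U y @[y --> +oo] --> U_infty &
        \forall y \near +oo, `|prof_b y - c_l * y| <= C].

Definition prof_qm : R := inf [set prof_q y | y in halfline R].

Definition prof_qp : R := sup [set prof_q y | y in halfline R].

Definition Eminus : R :=
  - 1 + c_l / 2 + (1 + a / 2) * prof_qm - a * fine (prof_J 1).

Definition Eplus : R :=
  - 1 + c_l / 2 + (1 + a / 2) * prof_qp + a * fine (prof_J 1).

Definition La (phi : R -> R[i]) (y : R) : R[i] :=
  - phi y - (prof_b y)%:C * cext (@derive1 R R) phi y + (prof_q y)%:C * phi y
  + (Omega y)%:C * cext (@hilbert_odd R) phi y
  - a%:C * cext (@Vop R) phi y * (Omega^`() y)%:C.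

End Profile.

Section Spaces.
Context (R : realType).

(* Norm of L^2(0,oo), as an extended real. *)
Definition L2norm (f : R -> R[i]) : \bar R :=
  ((\int[lebesgue_measure]_(y in halfline R)
      ((ComplexField.Normc.normc (f y)) ^+ 2)%:E) `^ (2^-1))%E.

Definition in_L2 (f : R -> R[i]) : Prop :=
  [/\ measurable_fun (halfline R) (fun y => complex.Re (f y)),
      measurable_fun (halfline R) (fun y => complex.Im (f y)) &
      (L2norm f < +oo)%E].

(* g is the weak second derivative of f on (0,oo): f is differentiable and
   f' is a primitive of g, i.e. f' is locally absolutely continuous with
   almost everywhere derivative g. *)
Definition second_derivative (f g : R -> R) : Prop :=
  (forall y, 0 < y -> derivable f y 1) /\
  (forall x y, 0 < x -> x <= y ->
     f^`() y - f^`() x = \int[lebesgue_measure]_(t in `[x, y]) g t).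

(* Every class in X has exactly one continuously differentiable
   representative on (0,oo), and in_X phi says that phi is this
   representative; equality in X is therefore pointwise equality on (0,oo),
   and the condition phi(0) = 0 is a limit at 0+. *)
Definition in_X (phi : R -> R[i]) : Prop :=
  [/\ in_L2 phi,
      ComplexField.Normc.normc (phi y) @[y --> 0^'+] --> (0 : R) &
      exists2 g : R -> R[i], in_L2 g &
        second_derivative (fun y => complex.Re (phi y))
                          (fun y => complex.Re (g y)) /\
        second_derivative (fun y => complex.Im (phi y))
                          (fun y => complex.Im (g y))].

Definition eqX (phi psi : R -> R[i]) : Prop :=
  forall y, 0 < y -> phi y = psi y.

Definition in_Da (a c_l : R) (Omega : R -> R) (phi : R -> R[i]) : Prop :=
  in_X phi /\ in_X (La a c_l Omega phi).

Definition eigenvalue_La (a c_l : R) (Omega : R -> R) (lambda : R[i]) : Prop :=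
  exists phi : R -> R[i],
    [/\ in_Da a c_l Omega phi, ~ eqX phi (fun=> 0) &
        eqX (La a c_l Omega phi) (fun y => lambda * phi y)].

Definition dist_itv (x u v : R) : R := inf [set `|x - z| | z in `[u, v]].

End Spaces.

(* Main.v *)
(* The operator acts on real and imaginary parts separately, so it suffices to
   bound the form (L u, u) of a real function u between E_- |u|^2 and
   E_+ |u|^2; the resolvent estimate is then Cauchy-Schwarz.  Integrating the
   transport term by parts gives (1/2) int b' u^2 with b' = c_l + a q.  Since
   H_odd is a contraction, |V(u)(y)| <= |u| sqrt y, so the nonlocal term
   a V(u) Omega' contributes at most a J_1 |u|^2.  For the term
   int Omega u H_odd u, let f be the odd extension of u, and F_f, F_Omega the
   Cauchy integrals in the upper half-plane.  The integral of F_f^2 F_Omega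
   over every horizontal line vanishes; its imaginary part, as the line tends
   to the real axis, reads
     int f (H f) Omega = (1/2) int ((H f)^2 - f^2) q,
   so that int f (H f) Omega + int q f^2 = (1/2) int ((H f)^2 + f^2) q, which
   lies between q_- |f|^2 and q_+ |f|^2 because q_- <= 0 <= q_+.  The limit
   only uses the uniform convergence of the regularized Hilbert transforms of
   Lipschitz functions and the contractivity of H, which follows from the
   vanishing of the integrals of F_f^2. *)
Require Import Defs.
From mathcomp Require Import all_boot all_order all_algebra.
From mathcomp Require Import all_classical all_reals all_analysis.
From mathcomp Require Import complex.
From mathcomp Require Import measurable_realfun.
From mathcomp Require Import ring lra.

Import Order.TTheory GRing.Theory Num.Theory.
Import numFieldNormedType.Exports.

Set Implicit Arguments.
Unset Strict Implicit.
Unset Printing Implicit Defensive.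

Local Open Scope ring_scope.
Local Open Scope classical_set_scope.

Local Notation integ D f :=
  ((@lebesgue_measure _).-integrable D (EFin \o (f : _ -> _))).
Local Notation mu := (@lebesgue_measure _).

(** * Square-integrable real functions *)

(** The identity for f (H f) Omega is never proved as an equality of limits. Contour integration is
    replaced by explicit antiderivatives of products of two or three kernels 1/(x - t + ie), and
    Fubini exchanges kernels for Cauchy transforms one factor at a time. The resulting identity is
    exact at height e > 0; only its one-sided consequence is carried to the limit, and the lower
    bound is the upper bound for [- Omega]. Lipschitz functions on the line are obtained from X as
    follows: u and u'' in L^2 bound u', and u(0) = 0 makes the odd extension Lipschitz across the
    origin. In the transport term b grows linearly, while u is only known to be square-integrable
    and b u' u is not known to be integrable. Integrability is read off from L u in L^2, by solving
    for the transport term, and the boundary value of b u^2 at infinity is shown to vanish by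
    averaging over [N, 2N]. Integrals and limits have default values where they do not exist, so
    even the additivity of the operators has to be proved on X. *)

Lemma RintE {R : realType} (D : set R) (f : R -> R) :
  \int[mu]_(x in D) f x = fine (\int[mu]_(x in D) (f x)%:E).
Proof. by []. Qed.

(* Keeps closing tactics from unfolding integrals. *)
Local Opaque Rintegral.

Section SquareIntegrable.
Context {R : realType}.
Implicit Types (D : set R) (f g h : R -> R).

Lemma integ_meas D f : integ D f -> measurable_fun D f.
Proof. by move=> /integrableP[/measurable_EFinP]. Qed.

Lemma eq_integ D f g : measurable D -> (forall x, D x -> f x = g x) ->
  integ D f -> integ D g.
Proof.
by move=> mD e; apply: eq_integrable => // x /set_mem Dx; rewrite /= e.
Qed.

Lemma integ_le D f g : measurable D -> measurable_fun D f -> integ D g ->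
  (forall x, D x -> `|f x| <= g x) -> integ D f.
Proof.
move=> mD mf ig fg; apply: le_integrable ig => //; first exact/measurable_EFinP.
by move=> x Dx /=; rewrite lee_fin (le_trans (fg _ Dx))// ler_norm.
Qed.

Lemma integD D f g : measurable D -> integ D f -> integ D g ->
  integ D (fun x => f x + g x).
Proof. by move=> mD fi gi; exact: (integrableD _ fi gi). Qed.

Lemma integB D f g : measurable D -> integ D f -> integ D g ->
  integ D (fun x => f x - g x).
Proof. by move=> mD fi gi; exact: (integrableB _ fi gi). Qed.

Lemma integZ D k f : measurable D -> integ D f -> integ D (fun x => k * f x).
Proof. by move=> mD fi; exact: (integrableZl _ k fi). Qed.

Lemma integ_norm D f : measurable D -> integ D f -> integ D (fun x => `|f x|).
Proof. by move=> mD fi; have := integrable_norm fi. Qed.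

Lemma integ_bdM D h f M : measurable D -> measurable_fun D h ->
  (forall x, D x -> `|h x| <= M) -> integ D f -> integ D (fun x => h x * f x).
Proof.
move=> mD mh hM fi; apply: (@integ_le _ _ (fun x => M * `|f x|)) => //.
- by apply: measurable_funM => //; exact: integ_meas fi.
- exact/integZ/integ_norm.
- by move=> x Dx; rewrite normrM ler_wpM2r// hM.
Qed.

Lemma le_intr D f g : measurable D -> integ D f -> integ D g ->
  (forall x, D x -> f x <= g x) ->
  \int[mu]_(x in D) f x <= \int[mu]_(x in D) g x.
Proof. by move=> *; apply: le_Rintegral. Qed.

Lemma le_norm_intr D f : measurable D -> integ D f ->
  `|\int[mu]_(x in D) f x| <= \int[mu]_(x in D) `|f x|.
Proof. by move=> mD fi; exact: le_normr_Rintegral. Qed.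

Lemma integ_restrict D f : measurable D -> integ D f <-> integ setT (f \_ D).
Proof. by move=> mD; rewrite -restrict_EFin; exact: integrable_mkcond. Qed.

Lemma EFin_intr D f : measurable D -> integ D f ->
  (\int[mu]_(x in D) (f x)%:E = (\int[mu]_(x in D) f x)%:E)%E.
Proof. by move=> mD fi; rewrite RintE fineK//; exact: integrable_fin_num. Qed.

Lemma RintD D f g : measurable D -> integ D f -> integ D g ->
  \int[mu]_(x in D) (f x + g x) = \int[mu]_(x in D) f x + \int[mu]_(x in D) g x.
Proof. by move=> mD fi gi; exact: RintegralD. Qed.

Lemma RintB D f g : measurable D -> integ D f -> integ D g ->
  \int[mu]_(x in D) (f x - g x) = \int[mu]_(x in D) f x - \int[mu]_(x in D) g x.
Proof. by move=> mD fi gi; exact: RintegralB. Qed.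

Lemma RintZ D k f : measurable D -> integ D f ->
  \int[mu]_(x in D) (k * f x) = k * \int[mu]_(x in D) f x.
Proof. by move=> mD fi; exact: RintegralZl. Qed.

Lemma eq_intr D f g : (forall x, D x -> f x = g x) ->
  \int[mu]_(x in D) f x = \int[mu]_(x in D) g x.
Proof. by move=> fg; apply: eq_Rintegral => x /set_mem; exact: fg. Qed.

Lemma Rint_eq0 D f : (forall x, D x -> f x = 0) -> \int[mu]_(x in D) f x = 0.
Proof. by move=> f0; rewrite (eq_intr (g := fun=> 0))// RintE integral0. Qed.

Definition sqint D f :=
  measurable_fun D f /\ integ D (fun x => f x ^+ 2).

Definition nrm D f := Num.sqrt (\int[mu]_(x in D) f x ^+ 2).

Lemma nrm_ge0 D f : 0 <= nrm D f. Proof. exact: sqrtr_ge0. Qed.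

Lemma nrm_sqr D f : nrm D f ^+ 2 = \int[mu]_(x in D) f x ^+ 2.
Proof. by rewrite sqr_sqrtr// Rintegral_ge0// => x _; exact: sqr_ge0. Qed.

Lemma sqint_le D f g : measurable D -> measurable_fun D f -> sqint D g ->
  (forall x, D x -> `|f x| <= `|g x|) -> sqint D f.
Proof.
move=> mD mf [mg gi] fg; split=> //; apply: (integ_le mD _ gi).
  exact: measurable_funX.
by move=> x Dx; rewrite normrX -(real_normK (num_real (g x))) lerXn2r ?nnegrE// fg.
Qed.

Lemma eq_sqint D f g : measurable D -> (forall x, D x -> f x = g x) ->
  sqint D f -> sqint D g.
Proof.
move=> mD e [mf fi]; split.
  by apply: eq_measurable_fun mf => x /set_mem Dx; rewrite e.
by apply: eq_integ fi => // x Dx; rewrite e.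
Qed.

Lemma sqintZ D k f : measurable D -> sqint D f -> sqint D (fun x => k * f x).
Proof.
move=> mD [mf fi]; split; first exact: measurable_funM.
by apply: eq_integ (integZ (k ^+ 2) mD fi) => // x _; rewrite exprMn.
Qed.

Lemma sqintD D f g : measurable D -> sqint D f -> sqint D g ->
  sqint D (fun x => f x + g x).
Proof.
move=> mD [mf fi] [mg gi]; split; first exact: measurable_funD.
apply: (integ_le mD _ (integD mD (integZ 2 mD fi) (integZ 2 mD gi))).
  by apply: measurable_funX; exact: measurable_funD.
move=> x _; rewrite ger0_norm ?sqr_ge0//.
by have := sqr_ge0 (f x - g x); nra.
Qed.

Lemma sqintB D f g : measurable D -> sqint D f -> sqint D g ->
  sqint D (fun x => f x - g x).
Proof.
move=> mD fi gi; apply: eq_sqint (sqintD mD fi (sqintZ (-1) mD gi)) => //.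
by move=> x _; rewrite mulN1r.
Qed.

Lemma sqint_bdM D h f M : measurable D -> measurable_fun D h ->
  (forall x, D x -> `|h x| <= M) -> sqint D f -> sqint D (fun x => h x * f x).
Proof.
move=> mD mh hM fi; apply: (sqint_le mD _ (sqintZ M mD fi)).
  by apply: measurable_funM => //; case: fi.
move=> x Dx; rewrite !normrM ler_wpM2r// (le_trans (hM _ Dx))// ler_norm//.
Qed.

Lemma sqintM D f g : measurable D -> sqint D f -> sqint D g ->
  integ D (fun x => f x * g x).
Proof.
move=> mD [mf fi] [mg gi]; apply: (integ_le mD _ (integD mD fi gi)).
  exact: measurable_funM.
move=> x _; rewrite normrM.
have := sqr_ge0 (`|f x| - `|g x|).
rewrite -[f x ^+ 2]real_normK ?num_real// -[g x ^+ 2]real_normK ?num_real//.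
by have := normr_ge0 (f x); have := normr_ge0 (g x); nra.
Qed.

Lemma sqint_integ_bd D f M : measurable D -> integ D f ->
  (forall x, D x -> `|f x| <= M) -> sqint D f.
Proof.
move=> mD fi fM; have mf := integ_meas fi; split=> //.
by apply: eq_integ (integ_bdM mD mf fM fi) => // x _; rewrite expr2.
Qed.

Lemma sqintS D E f : measurable D -> measurable E -> E `<=` D ->
  sqint D f -> sqint E f.
Proof.
move=> mD mE ED [mf fi]; split; first exact: measurable_funS mf.
exact: integrableS fi.
Qed.

(** The form s^2 A + 2 s t C + t^2 B is the integral of (s f + t g)^2, hence nonnegative; at (s, t)
    = (-C, A) it equals A (A B - C^2). *)
Lemma cauchy_schwarz D f g : measurable D -> sqint D f -> sqint D g ->
  `|\int[mu]_(x in D) (f x * g x)| <= nrm D f * nrm D g.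
Proof.
move=> mD fi gi.
set A := \int[mu]_(x in D) f x ^+ 2; set B := \int[mu]_(x in D) g x ^+ 2.
set C := \int[mu]_(x in D) _.
have A0 : 0 <= A by apply: Rintegral_ge0 => x _; exact: sqr_ge0.
have B0 : 0 <= B by apply: Rintegral_ge0 => x _; exact: sqr_ge0.
have H s t : 0 <= s ^+ 2 * A + 2 * s * t * C + t ^+ 2 * B.
  have : 0 <= \int[mu]_(x in D) (s * f x + t * g x) ^+ 2.
    by apply: Rintegral_ge0 => x _; exact: sqr_ge0.
  have -> : \int[mu]_(x in D) (s * f x + t * g x) ^+ 2 =
    \int[mu]_(x in D) (s ^+ 2 * f x ^+ 2 + (2 * s * t) * (f x * g x) +
       t ^+ 2 * g x ^+ 2).
    by apply: eq_intr => x _; ring.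
  have i1 := integZ (s ^+ 2) mD fi.2.
  have i2 := integZ (2 * s * t) mD (sqintM mD fi gi).
  have i3 := integZ (t ^+ 2) mD gi.2.
  rewrite RintegralD//; last exact: (integD mD i1 i2).
  rewrite RintegralD// !RintegralZl//; [exact: gi.2|exact: sqintM|exact: fi.2].
suff : C ^+ 2 <= A * B.
  move=> h; rewrite /nrm -sqrtrM// -sqrtr_sqr.
  by rewrite ler_sqrt// mulr_ge0.
have [A00|An0] := eqVneq A 0.
  have [->|C0] := eqVneq C 0; first by rewrite expr0n mulr_ge0.
  (* With A = 0 the form at t = 1 is affine in s; this s gives it the value -B - 2, which is
     absurd. *)
  have := H (- (B + 1) / C) 1; rewrite A00 mulr0 add0r.
  have -> : 2 * (- (B + 1) / C) * 1 * C = - 2 * (B + 1) by field.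
  by lra.
have Ap : 0 < A by rewrite lt_def An0.
have := H (- C) A.
have -> : (- C) ^+ 2 * A + 2 * (- C) * A * C + A ^+ 2 * B = A * (A * B - C ^+ 2).
  by ring.
by rewrite pmulr_rge0// subr_ge0.
Qed.

Lemma sqint_norm D f : measurable D -> sqint D f -> sqint D (fun x => `|f x|).
Proof.
move=> mD fi; apply: (sqint_le mD _ fi); last by move=> x _; rewrite normr_id.
by apply: measurableT_comp => //; case: fi.
Qed.

Lemma nrm_norm D f : nrm D (fun x => `|f x|) = nrm D f.
Proof.
by rewrite /nrm; congr Num.sqrt; apply: eq_intr => x _; rewrite real_normK ?num_real.
Qed.

Lemma cauchy_schwarz_abs D f g : measurable D -> sqint D f -> sqint D g ->
  \int[mu]_(x in D) `|f x * g x| <= nrm D f * nrm D g.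
Proof.
move=> mD fi gi.
under eq_Rintegral do rewrite normrM.
apply: le_trans (ler_norm _) _.
rewrite -(nrm_norm D f) -(nrm_norm D g).
by apply: cauchy_schwarz => //; exact: sqint_norm.
Qed.

End SquareIntegrable.

(** * Convolutions *)

Section ChangeOfVariables.
Context {R : realType}.
Implicit Types (f g h : R -> R) (c x : R).

(** Lebesgue measure is determined by its values on half-open intervals, so only lengths of
    intervals are compared. *)
Lemma lebesgue_measure_shift c (A : set R) : measurable A ->
  pushforward mu ((fun x => x + c) : _ -> measurableTypeR R) A = mu A.
Proof.
have mphi : measurable_fun [set: R] (fun x : R => x + c) by exact: measurable_funD.
move=> mA; apply/esym/lebesgue_measure_unique => //= _ [[a b]] _ <-.
rewrite /pushforward.
have -> : (fun x => x + c) @^-1` `]a, b]%classic = `](a - c), (b - c)]%classic.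
  by apply/seteqP; split=> x /=; rewrite !in_itv/= ltrBlDr lerBrDr.
rewrite !lebesgue_measure_itv/= !lte_fin ltrD2r.
by case: ifP => // _; rewrite -!EFinD; congr EFin; lra.
Qed.

Definition measure_preserving (phi : R -> R) :=
  measurable_fun [set: R] phi /\ forall A : set R, measurable A ->
    pushforward mu (phi : measurableTypeR R -> measurableTypeR R) A = mu A.

Lemma preserving_shift c : measure_preserving (fun x => x + c).
Proof.
by split=> [|A mA]; [exact: measurable_funD|exact: lebesgue_measure_shift].
Qed.

Lemma preserving_opp : measure_preserving (fun x => - x).
Proof. by split=> [|A mA]; [exact: measurableT_comp|exact (lebesgue_measureN mA)]. Qed.

Lemma preserving_reflect c : measure_preserving (fun x => c - x).
Proof.
have mphi : measurable_fun [set: R] (fun x : R => c - x) by exact: measurable_funB.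
split=> // A mA.
have := lebesgue_measureN mA; rewrite /pushforward => <-.
have mB : measurable ((fun x : R => - x) @^-1` A).
  have := @oppr_measurable R setT measurableT _ mA; by rewrite setTI.
rewrite -(lebesgue_measure_shift (- c) mB) /pushforward.
congr (lebesgue_measure _); apply/seteqP; split=> x /=;
  by rewrite opprD opprK addrC.
Qed.

Lemma ge0_integral_preserving phi (f : R -> \bar R) : measure_preserving phi ->
  measurable_fun [set: R] f -> (forall x, 0 <= f x)%E ->
  (\int[mu]_x f (phi x) = \int[mu]_x f x)%E.
Proof.
move=> [mphi pphi] mf f0.
transitivity (\int[pushforward mu (phi : measurableTypeR R -> measurableTypeR R)]_x f x)%E.
  by rewrite ge0_integral_pushforward.
by apply: eq_measure_integral => /= A mA _; exact: pphi.
Qed.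

Lemma integ_preserving phi f : measure_preserving phi ->
  integ setT f -> integ setT (fun x => f (phi x)).
Proof.
move=> pphi fi; have mf := integ_meas fi.
apply/integrableP; split.
  by apply/measurable_EFinP; apply: measurableT_comp => //; exact: pphi.1.
rewrite (@ge0_integral_preserving phi (fun x => `|(EFin \o f) x|%E)) //.
  by case/integrableP : fi.
by apply: measurableT_comp => //; exact/measurable_EFinP.
Qed.

Lemma intr_preserving phi f : measure_preserving phi ->
  integ setT f -> \int[mu]_x f (phi x) = \int[mu]_x f x.
Proof.
move=> pphi fi; have mf := integ_meas fi.
have H := integ_preserving pphi fi.
rewrite !RintE; congr fine.
transitivity (\int[pushforward mu (phi : measurableTypeR R -> measurableTypeR R)]_x (f x)%:E)%E.
  rewrite integral_pushforward//=; [exact: pphi.1|exact/measurable_EFinP].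
apply: eq_measure_integral => /=; first exact: pphi.1.
by move=> _ A mA _; exact: pphi.2.
Qed.

Lemma sqint_preserving phi f : measure_preserving phi ->
  sqint setT f -> sqint setT (fun x => f (phi x)).
Proof.
move=> pphi [mf fi]; split; first exact: measurableT_comp pphi.1.
exact: (integ_preserving pphi fi).
Qed.

Lemma nrm_preserving phi f : measure_preserving phi ->
  sqint setT f -> nrm setT (fun x => f (phi x)) = nrm setT f.
Proof. by move=> pphi [mf fi]; rewrite /nrm (intr_preserving pphi fi). Qed.

End ChangeOfVariables.

(** * Fubini's theorem and Young's inequality for convolutions *)

Section Fubini.
Context {R : realType}.
Implicit Types (f g h K : R -> R) (c x t : R).

(** Sections are integrable at every point, not just almost everywhere, so that the real-valued
    inner integrals agree with the extended ones throughout; the dominating function M gives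
    integrability on the product through Tonelli. *)
Lemma fubiniR (F : R -> R -> R) :
  measurable_fun [set: R * R] (fun z => F z.1 z.2) ->
  (forall x, integ setT (F x)) -> (forall t, integ setT (F ^~ t)) ->
  (exists2 M, integ setT M & forall x, \int[mu]_t `|F x t| <= M x) ->
  [/\ integ setT (fun x => \int[mu]_t F x t),
      integ setT (fun t => \int[mu]_x F x t) &
      \int[mu]_x (\int[mu]_t F x t) = \int[mu]_t (\int[mu]_x F x t)].
Proof.
move=> mF F1 F2 [M iM FM].
pose G (z : R * R) := (F z.1 z.2)%:E.
have mG : measurable_fun setT G by exact/measurable_EFinP.
have E1 x : (\int[mu]_t G (x, t) = (\int[mu]_t F x t)%:E)%E.
  exact: (EFin_intr _ (F1 x)).
have E2 t : (\int[mu]_x G (x, t) = (\int[mu]_x F x t)%:E)%E.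
  exact: (EFin_intr _ (F2 t)).
have iG : (mu \x mu)%E.-integrable setT G.
  apply/integrable12ltyP => //.
  have -> : (fun x => \int[mu]_t `|G (x, t)|)%E = (EFin \o (fun x => \int[mu]_t `|F x t|)).
    apply/funext => x /=; rewrite -EFin_intr//.
    exact: integ_norm.
  have m1 : measurable_fun [set: R] (fun x => \int[mu]_t `|F x t|).
    apply/measurable_EFinP.
    have -> : EFin \o (fun x => \int[mu]_t `|F x t|) =
      (fun x => \int[mu]_t `|G (x, t)|)%E.
      apply/funext => x /=; rewrite -EFin_intr//.
      exact: integ_norm.
    have mG' : measurable_fun setT (fun z => `|G z|%E) by exact: measurableT_comp.
    exact: (@measurable_fun_fubini_tonelli_F _ _ _ _ _ mu _ mG').
  suff : integ setT (fun x => \int[mu]_t `|F x t|) by move/integrable_lty; exact.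
  apply: (integ_le _ _ iM) => // x _.
  by rewrite ger0_norm ?FM// Rintegral_ge0.
have I1 := integrable_fubini_F iG.
have I2 : integ setT (fun t => \int[mu]_x F x t).
  have mG' : measurable_fun setT (fun z => `|G z|%E) by exact: measurableT_comp.
  have E3 t : (\int[mu]_x `|G (x, t)| = (\int[mu]_x `|F x t|)%:E)%E.
    by rewrite -EFin_intr//; exact: (integ_norm _ (F2 t)).
  have m2 : measurable_fun [set: R] (fun t => \int[mu]_x `|F x t|).
    apply/measurable_EFinP.
    have -> : EFin \o (fun t => \int[mu]_x `|F x t|) =
      (fun t => \int[mu]_x `|G (x, t)|)%E by apply/funext => t; rewrite E3.
    exact: (@measurable_fun_fubini_tonelli_G _ _ _ _ _ mu _ mG').
  apply: (@integ_le _ _ _ (fun t => \int[mu]_x `|F x t|)) => //.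
  - apply/measurable_EFinP.
    have -> : EFin \o (fun t => \int[mu]_x F x t) =
      (fun t => \int[mu]_x G (x, t))%E by apply/funext => t; rewrite E2.
    exact: (measurable_fubini_G iG).
  - apply/integrableP; split; first exact/measurable_EFinP.
    have /integrable21ltyP := iG; move=> /(_ mG); apply: le_lt_trans.
    rewrite le_eqVlt; apply/orP; left; apply/eqP; apply: eq_integral => t _.
    by rewrite E3 /= ger0_norm// Rintegral_ge0.
  - by move=> t _; exact: (le_norm_intr _ (F2 t)).
have E := Fubini iG.
rewrite /fubini_F (_ : (fun _ => _) = EFin \o (fun x => \int[mu]_t F x t)) in I1; last first.
  by apply/funext => x; exact: E1.
split; [exact: I1|exact: I2|rewrite !RintE; congr fine].
under eq_integral do rewrite -E1.
rewrite E.
by apply: eq_integral => t _; rewrite E2.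
Qed.

Definition convol f g x := \int[mu]_t (f t * g (x - t)).

Lemma meas_subr g : measurable_fun [set: R] g ->
  measurable_fun [set: R * R] (fun z => g (z.1 - z.2)).
Proof.
move=> mg; apply: (measurableT_comp mg).
exact: measurable_funB.
Qed.

Lemma sqint_reflect g x : sqint setT g -> sqint setT (fun t => g (x - t)).
Proof. by move=> gi; exact: (sqint_preserving (preserving_reflect x) gi). Qed.

Lemma sqint_shift g t : sqint setT g -> sqint setT (fun x => g (x - t)).
Proof. by move=> gi; exact: (sqint_preserving (preserving_shift (- t)) gi). Qed.

Lemma convolC f g x : sqint setT f -> sqint setT g -> convol f g x = convol g f x.
Proof.
move=> fi gi; rewrite /convol.
rewrite -(intr_preserving (preserving_reflect x) (sqintM _ fi (sqint_reflect x gi)))//.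
by apply: eq_intr => t _; rewrite mulrC; congr (g _ * _); ring.
Qed.

Lemma convol_bd f g x : sqint setT f -> sqint setT g ->
  `|convol f g x| <= nrm setT f * nrm setT g.
Proof.
move=> fi gi; rewrite -(nrm_preserving (preserving_reflect x) gi).
exact: (cauchy_schwarz _ fi (sqint_reflect x gi)).
Qed.

(** Moves the convolution from f to K. By Cauchy-Schwarz the inner absolute integral is at most |K
    x| times the norms of f and g, which is the domination for Fubini; the bound on g makes the
    other sections integrable. *)
Lemma int_convol K f g M : integ setT K -> sqint setT f -> sqint setT g ->
  (forall x, `|g x| <= M) ->
  [/\ integ setT (fun x => K x * convol f g x),
      integ setT (fun t => f t * \int[mu]_x (K x * g (x - t))) &
    \int[mu]_x (K x * convol f g x) =
    \int[mu]_t (f t * \int[mu]_x (K x * g (x - t)))].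
Proof.
move=> Ki fi gi gM; have mg := gi.1; have mf := fi.1.
have mK := integ_meas Ki.
have fgi x : integ setT (fun t => f t * g (x - t)).
  exact: (sqintM _ fi (sqint_reflect x gi)).
have Kgi t : integ setT (fun x => K x * g (x - t)).
  apply: (@eq_integ _ _ (fun x => g (x - t) * K x)) => //.
    by move=> x _; rewrite mulrC.
  apply: (@integ_bdM _ _ _ _ M) => //.
  by apply: measurableT_comp => //; exact: measurable_funB.
have [] := @fubiniR (fun x t => K x * (f t * g (x - t))).
- apply: measurable_funM.
    by apply: measurableT_comp => //; exact: measurable_fst.
  apply: measurable_funM; last exact: meas_subr.
  by apply: measurableT_comp => //; exact: measurable_snd.
- by move=> x; exact: integZ.
- move=> t; apply: (@eq_integ _ _ (fun x => f t * (K x * g (x - t)))) => //.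
    by move=> x _; ring.
  exact: integZ.
- exists (fun x => (nrm setT f * nrm setT g) * `|K x|).
    by apply: integZ => //; exact: integ_norm.
  move=> x; under eq_Rintegral do rewrite normrM.
  rewrite RintZ//; last exact: integ_norm.
  rewrite mulrC ler_wpM2r//.
  rewrite -(nrm_preserving (preserving_reflect x) gi).
  exact: (cauchy_schwarz_abs _ fi (sqint_reflect x gi)).
have -> : (fun x => \int[mu]_t (K x * (f t * g (x - t)))) =
          (fun x => K x * convol f g x).
  by apply/funext => x; rewrite RintZ.
have -> : (fun t => \int[mu]_x (K x * (f t * g (x - t)))) =
          (fun t => f t * \int[mu]_x (K x * g (x - t))).
  apply/funext => t; rewrite -RintZ//.
  by apply: eq_intr => x _; ring.
move=> i1 i2 E; split; [exact: i1|exact: i2|exact: E].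
Qed.

(** Cauchy-Schwarz for |h|^(1/2) and |h|^(1/2) |g(x - t)| bounds the square of the convolution by A
    times the convolution of |h| and g^2; integrating the latter in x yields a second factor A. *)
Lemma young12 h g : integ setT h -> measurable_fun setT (convol h g) ->
  (forall x, integ setT (fun t => h t * g (x - t))) ->
  sqint setT g ->
  (forall x, integ setT (fun t => `|h t| * g (x - t) ^+ 2)) ->
  sqint setT (convol h g) /\
  nrm setT (convol h g) <= (\int[mu]_t `|h t|) * nrm setT g.
Proof.
move=> hi mc hgi gi hg2; have mg := gi.1; have mh := integ_meas hi.
set A := \int[mu]_t `|h t|.
have A0 : 0 <= A by exact: Rintegral_ge0.
have [] := @fubiniR (fun t x => `|h t| * g (x - t) ^+ 2).
- apply: measurable_funM.
    apply: measurableT_comp => //; apply: measurableT_comp => //.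
  apply: measurable_funX; apply: (measurableT_comp mg).
  by apply: measurable_funB; [exact: measurable_snd|exact: measurable_fst].
- by move=> t; apply: integZ => //; exact: (sqint_shift t gi).2.
- by [].
- exists (fun t => nrm setT g ^+ 2 * `|h t|).
    by apply: integZ => //; exact: integ_norm.
  move=> t; rewrite nrm_sqr mulrC.
  under eq_Rintegral do rewrite normrM normr_id [`|_ ^+ 2|]ger0_norm ?sqr_ge0//.
  rewrite RintZ//; last exact: (sqint_shift t gi).2.
  by rewrite (intr_preserving (preserving_shift (- t)) gi.2).
move=> i1 i2 /eqP E.
have Ex x : convol h g x ^+ 2 <= A * \int[mu]_t (`|h t| * g (x - t) ^+ 2).
  have ms : measurable_fun [set: R] (fun t => Num.sqrt `|h t|).
    apply: measurableT_comp; last exact: measurableT_comp.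
    exact: continuous_measurable_fun (@sqrt_continuous R).
  have msg : measurable_fun [set: R] (fun t => g (x - t)).
    by apply: measurableT_comp => //; exact: measurable_funB.
  have s1 : sqint setT (fun t => Num.sqrt `|h t|).
    split=> //; apply: eq_integ (integ_norm _ hi) => // t _.
    by rewrite sqr_sqrtr.
  have s2 : sqint setT (fun t => Num.sqrt `|h t| * `|g (x - t)|).
    split.
      by apply: measurable_funM => //; exact: measurableT_comp.
    apply: eq_integ (hg2 x) => // t _.
    by rewrite exprMn sqr_sqrtr// real_normK ?num_real.
  have := cauchy_schwarz _ s1 s2; rewrite /convol => /(_ measurableT) cs.
  have c1 : `|convol h g x| <= nrm setT (fun t => Num.sqrt `|h t|) *
       nrm setT (fun t => Num.sqrt `|h t| * `|g (x - t)|).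
    apply: le_trans (le_norm_intr _ (hgi x)) _ => //.
    apply: le_trans cs; apply: le_trans (ler_norm _).
    rewrite le_eqVlt; apply/orP; left; apply/eqP; apply: eq_intr => t _.
    by rewrite normrM mulrA -expr2 sqr_sqrtr.
  have c0 := normr_ge0 (convol h g x).
  rewrite -real_normK ?num_real//.
  apply: (@le_trans _ _ ((nrm setT (fun t => Num.sqrt `|h t|) *
       nrm setT (fun t => Num.sqrt `|h t| * `|g (x - t)|)) ^+ 2)).
    by rewrite lerXn2r// nnegrE mulr_ge0 ?nrm_ge0.
  rewrite exprMn !nrm_sqr le_eqVlt; apply/orP; left; apply/eqP; congr (_ * _).
    by apply: eq_intr => t _; rewrite sqr_sqrtr.
  by apply: eq_intr => t _; rewrite exprMn sqr_sqrtr// real_normK ?num_real.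
have sc : sqint setT (convol h g).
  split=> //; apply: (integ_le _ _ (integZ A _ i2)) => //.
    exact: measurable_funX.
  by move=> x _; rewrite ger0_norm ?sqr_ge0.
split=> //.
rewrite -[leRHS]ger0_norm ?mulr_ge0 ?nrm_ge0// -sqrtr_sqr ler_sqrt ?sqr_ge0//.
apply: (@le_trans _ _ (\int[mu]_x (A * \int[mu]_t (`|h t| * g (x - t) ^+ 2)))).
  by apply: le_intr => //; [exact: sc.2|exact: integZ].
rewrite RintZ// -(eqP E).
have -> : (fun t => \int[mu]_x (`|h t| * g (x - t) ^+ 2)) =
   (fun t => nrm setT g ^+ 2 * `|h t|).
  apply/funext => t; rewrite RintZ//; last exact: (sqint_shift t gi).2.
  rewrite (intr_preserving (preserving_shift (- t)) gi.2)//.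
  by rewrite nrm_sqr mulrC.
rewrite RintZ//; last exact: integ_norm.
rewrite exprMn -/A le_eqVlt; apply/orP; left; apply/eqP; ring.
Qed.

End Fubini.

(** * Integrals over the line *)

Section LineIntegrals.
Context {R : realType}.
Implicit Types (f g h F : R -> R) (c x : R).

Lemma is_derive_cont F x d : is_derive x 1 F d -> {for x, continuous F}.
Proof.
by move=> [dF _]; apply: differentiable_continuous; exact/derivable1_diffP.
Qed.

Lemma dominated_cvgR (D : set R) (f_ : nat -> R -> R) f g : measurable D ->
  (forall n, measurable_fun D (f_ n)) ->
  (forall x, D x -> f_ ^~ x @ \oo --> f x) ->
  integ D g -> (forall n x, D x -> `|f_ n x| <= g x) ->
  integ D f /\
  (fun n => \int[mu]_(x in D) f_ n x) @ \oo --> \int[mu]_(x in D) f x.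
Proof.
move=> mD mf_ ff gi fg.
have mf : measurable_fun D f by exact: measurable_fun_cvg ff.
have fle x : D x -> `|f x| <= g x.
  move=> Dx; have cn : `|f_ n x| @[n --> \oo] --> `|f x| by apply: cvg_norm; exact: ff.
  rewrite -(cvg_lim (@Rhausdorff R) cn); apply: limr_le; first exact: cvgP cn.
  by apply: nearW => n; exact: fg.
have fi : integ D f by exact: (integ_le mD mf gi).
split=> //.
have [] := @dominated_convergence _ (measurableTypeR R) R mu D mD
  (fun n => EFin \o f_ n) (EFin \o f) (EFin \o g).
- by move=> n; apply/measurable_EFinP; exact: mf_.
- by apply/measurable_EFinP; exact: mf.
- by apply: aeW => x Dx; apply: cvg_EFin; [exact: nearW|exact: ff].
- exact: gi.
- by apply: aeW => x n Dx; rewrite /= lee_fin; exact: fg.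
move=> _ _; rewrite [X in _ --> X](_ : _ = (\int[mu]_(x in D) f x)%:E); last first.
  exact: EFin_intr.
by move=> h; exact: (fine_cvg h).
Qed.

(** The shifted index keeps the endpoints away from 0, so that limits along them can be computed in
    powers of [n.+1%:R^-1]. *)
Definition sym_itv (n : nat) : set R := `[- n.+1%:R, n.+1%:R].

Lemma sym_itv_near x : \forall n \near \oo, x \in sym_itv n.
Proof.
near=> n; rewrite inE /sym_itv/= in_itv/= -ler_norml.
rewrite (@le_trans _ _ n%:R)//; last by rewrite ler_nat.
by near: n; exact: nbhs_infty_ger.
Unshelve. all: by end_near. Qed.

Lemma cvg_restrict_sym f x :
  (f \_ (sym_itv n)) x @[n --> \oo] --> f x.
Proof.
apply: cvg_near_cst; near=> n; rewrite patchE ifT//.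
by near: n; exact: sym_itv_near.
Unshelve. all: by end_near. Qed.

Lemma measurable_sym_itv n : measurable (sym_itv n).
Proof. exact: measurable_itv. Qed.

Lemma measurable_restrict_sym f n : measurable_fun setT f ->
  measurable_fun setT (f \_ (sym_itv n)).
Proof.
move=> mf; apply/(measurable_restrictT _ _).1; first exact: measurable_sym_itv.
exact: measurable_funTS.
Qed.

Lemma norm_restrict_le (D : set R) f x : `|(f \_ D) x| <= `|f x|.
Proof. by rewrite patchE; case: ifP => // _; rewrite normr0. Qed.

Lemma intr_trunc f : integ setT f ->
  \int[mu]_(x in sym_itv n) f x @[n --> \oo] --> \int[mu]_x f x.
Proof.
move=> fi; have mf := integ_meas fi.
under eq_fun do rewrite Rintegral_mkcond.
have [] // := @dominated_cvgR setT (fun n => f \_ (sym_itv n)) f (fun x => `|f x|).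
- by move=> n; exact: measurable_restrict_sym.
- by move=> x _; exact: cvg_restrict_sym.
- exact: integ_norm.
- by move=> n x _; exact: norm_restrict_le.
Qed.

Lemma FTC2R F f a b : a <= b ->
  (forall x, a <= x <= b -> is_derive x 1 F (f x)) ->
  (forall x, a <= x <= b -> {for x, continuous f}) ->
  integ `[a, b] f /\ \int[mu]_(x in `[a, b]) f x = F b - F a.
Proof.
move=> ab dF cf.
have cw : {within `[a, b], continuous f}.
  by apply: continuous_in_subspaceT => x /set_mem /=; rewrite in_itv/=; exact: cf.
have cF x : a <= x <= b -> {for x, continuous F}.
  by move=> /dF; exact: is_derive_cont.
have fi : integ `[a, b] f.
  by apply: continuous_compact_integrable => //; exact: segment_compact.
split=> //.
move: ab; rewrite le_eqVlt => /predU1P[eab|ab].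
  by rewrite -eab set_itv1 Rintegral_set1 subrr.
rewrite !RintE (@continuous_FTC2 _ f F)//.
- split.
  + by move=> x; rewrite in_itv/= => /andP[/ltW ax /ltW xb]; have [|//] := dF x; rewrite ?ax.
  + by apply: cvg_at_right_filter; apply: cF; rewrite lexx ltW.
  + by apply: cvg_at_left_filter; apply: cF; rewrite lexx ltW.
- move=> x; rewrite in_itv/= => /andP[/ltW ax /ltW xb].
  by rewrite derive1E; apply: derive_val; apply: dF; rewrite ax.
Qed.

Lemma continuous_integ f a b : (forall x, a <= x <= b -> {for x, continuous f}) ->
  integ `[a, b] f.
Proof.
move=> cf; apply: continuous_compact_integrable; first exact: segment_compact.
by apply: continuous_in_subspaceT => x /set_mem /=; rewrite in_itv/=; exact: cf.
Qed.

Lemma integ_cst_itv a b (k : R) : integ `[a, b] (fun=> k).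
Proof. by apply: continuous_integ => x _; exact: cvg_cst. Qed.

Lemma sqint_cst_itv a b (k : R) : sqint `[a, b] (fun=> k).
Proof. by split; [exact: measurable_cst|exact: integ_cst_itv]. Qed.

Lemma sqint_itv_integ f a b : sqint `[a, b] f -> integ `[a, b] f.
Proof.
move=> fi; have m1 : measurable (`[a, b]%classic : set R) by exact: measurable_itv.
have := sqintM m1 fi (sqint_cst_itv a b 1).
by apply: eq_integ => // x _; rewrite mulr1.
Qed.

(** The integral is the limit of its symmetric truncations, so a limit is needed only for the
    difference of F at opposite endpoints. *)
Lemma FTC_line F f l : (forall x, is_derive x 1 F (f x)) -> continuous f ->
  integ setT f -> F n.+1%:R - F (- n.+1%:R) @[n --> \oo] --> l ->
  \int[mu]_x f x = l.
Proof.
move=> dF cf fi Fl; have := intr_trunc fi.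
have nn n : - n.+1%:R <= n.+1%:R :> R by rewrite (le_trans (_ : _ <= 0))// oppr_le0.
have -> : (fun n => \int[mu]_(x in sym_itv n) f x) =
    (fun n => F n.+1%:R - F (- n.+1%:R)).
  apply/funext => n.
  by have [_ <-] := @FTC2R F f (- n.+1%:R) n.+1%:R (nn n) (fun x _ => dF x) (fun x _ => cf x).
by move=> h; exact: (cvg_unique (@Rhausdorff R) h Fl).
Qed.

(** For a nonnegative derivative, monotone convergence supplies integrability as well. *)
Lemma ge0_FTC_line F f l : (forall x, is_derive x 1 F (f x)) -> continuous f ->
  (forall x, 0 <= f x) -> F n.+1%:R - F (- n.+1%:R) @[n --> \oo] --> l ->
  integ setT f /\ \int[mu]_x f x = l.
Proof.
move=> dF cf f0 Fl.
have mf : measurable_fun [set: R] f by exact: continuous_measurable_fun.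
suff fi : integ setT f by split=> //; exact: FTC_line dF cf fi Fl.
have Un : \bigcup_n sym_itv n = [set: R].
  apply/seteqP; split=> // x _.
  have [n _ /(_ n (leqnn n)) xn] := sym_itv_near x.
  by exists n => //; exact: set_mem.
have := @ge0_nondecreasing_set_cvg_integral _ (measurableTypeR R) R sym_itv (EFin \o f) mu.
rewrite Un => h.
have {h} : (\int[mu]_(x in sym_itv n) (f x)%:E @[n --> \oo] --> \int[mu]_x (f x)%:E)%E.
  apply: h.
  - move=> m n mn; apply/subsetPset; apply: subset_itv; rewrite bnd_simp.
      by rewrite lerN2 ler_nat.
    by rewrite ler_nat.
  - exact: measurable_sym_itv.
  - by move=> n; apply/measurable_EFinP; exact: measurable_funTS.
  - by move=> n x _; rewrite lee_fin.
have nn n : - n.+1%:R <= n.+1%:R :> R by rewrite (le_trans (_ : _ <= 0))// oppr_le0.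
have e n : (\int[mu]_(x in sym_itv n) (f x)%:E = (F n.+1%:R - F (- n.+1%:R))%:E)%E.
  have [fi <-] := @FTC2R F f (- n.+1%:R) n.+1%:R (nn n) (fun x _ => dF x) (fun x _ => cf x).
  by rewrite EFin_intr//; exact: measurable_sym_itv.
under eq_fun do rewrite e.
move=> h.
have h2 : ((F n.+1%:R - F (- n.+1%:R))%:E @[n --> \oo] --> l%:E)%E.
  by apply: cvg_EFin => //; exact: nearW.
have E := cvg_unique (@ereal_hausdorff R) h h2.
apply/integrableP; split; first exact/measurable_EFinP.
under eq_integral => x _ do rewrite /= ger0_norm//.
by rewrite E ltry.
Qed.

End LineIntegrals.

(** * The kernels 1/(x + ie) *)

Section PoissonKernels.
Context {R : realType} (e : R) (e0 : 0 < e).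
Implicit Types (f g h F : R -> R) (c x s t r : R).

Definition den x := x ^+ 2 + e ^+ 2.

Lemma den_gt0 x : 0 < den x.
Proof. by rewrite /den ltr_wpDl ?sqr_ge0// exprn_gt0. Qed.

(* (x + i e)^-1 = kQ x - i kP x *)
Definition kP x := e / den x.
Definition kQ x := x / den x.

Lemma kP_ge0 x : 0 <= kP x.
Proof. by rewrite /kP divr_ge0 ?ltW// den_gt0. Qed.

Lemma kQN x : kQ (- x) = - kQ x.
Proof. by rewrite /kQ /den sqrrN mulNr. Qed.

Lemma den_neq0 x : den x != 0. Proof. by rewrite gt_eqF// den_gt0. Qed.

Hint Resolve den_neq0 : core.

Lemma is_derive_den x : is_derive x 1 den (2 * x).
Proof. by rewrite /den; apply: is_derive_eq; rewrite /GRing.scale/=; ring. Qed.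

(** Together with [is_derive_kQ], the real and imaginary parts of (1/z)' = -1/z^2 along the line of
    height e. *)
Lemma is_derive_kP x : is_derive x 1 kP (- 2 * kP x * kQ x).
Proof.
have dd := is_derive_den x.
have : is_derive x 1 (fun x => e * (den x)^-1) (- 2 * kP x * kQ x).
  have dv := is_deriveV (den_neq0 x) dd.
  apply: is_derive_eq; rewrite /kP /kQ /GRing.scale/=.
  by field.
by [].
Qed.

Lemma is_derive_kQ x : is_derive x 1 kQ (kP x ^+ 2 - kQ x ^+ 2).
Proof.
have dd := is_derive_den x.
have : is_derive x 1 (fun x => x * (den x)^-1) (kP x ^+ 2 - kQ x ^+ 2).
  have dv := is_deriveV (den_neq0 x) dd.
  apply: is_derive_eq; rewrite /kP /kQ /GRing.scale/=.
  rewrite mulr1.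
  have := den_neq0 x; rewrite /den => h.
  by field.
by [].
Qed.

Lemma continuous_kP : continuous kP.
Proof. by move=> x; exact: (is_derive_cont (is_derive_kP x)). Qed.

Lemma continuous_kQ : continuous kQ.
Proof. by move=> x; exact: (is_derive_cont (is_derive_kQ x)). Qed.

Lemma measurable_kP : measurable_fun [set: R] kP.
Proof. exact: continuous_measurable_fun continuous_kP. Qed.

Lemma measurable_kQ : measurable_fun [set: R] kQ.
Proof. exact: continuous_measurable_fun continuous_kQ. Qed.

Lemma kP_le x : `|kP x| <= e^-1.
Proof.
rewrite ger0_norm ?kP_ge0// /kP ler_pdivrMr ?den_gt0//.
rewrite mulrC ler_pdivlMr// /den -expr2 lerDr; exact: sqr_ge0.
Qed.

Lemma kQ_le x : `|kQ x| <= e^-1.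
Proof.
rewrite /kQ normrM normfV (gtr0_norm (den_gt0 x)) ler_pdivrMr ?den_gt0//.
rewrite mulrC ler_pdivlMr// /den -(real_normK (num_real x)).
have := sqr_ge0 (`|x| - e); have := normr_ge0 x; nra.
Qed.

(** Both sides are 1/|z|^2 with z = x + ie. This makes [kQ] square-integrable although it decays
    only like 1/x. *)
Lemma kPQ_sqr x : kP x ^+ 2 + kQ x ^+ 2 = e^-1 * kP x.
Proof.
rewrite /kP /kQ; have := den_neq0 x; rewrite /den => h.
by field; rewrite h/= gt_eqF.
Qed.

Lemma integ_int_kP : integ setT kP /\ \int[mu]_x kP x = pi.
Proof.
apply: (@ge0_FTC_line _ (fun x => atan (e^-1 * x))) => //.
- move=> x.
  have h1 : is_derive x 1 (fun x => e^-1 * x) e^-1.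
    by apply: is_derive_eq; rewrite /GRing.scale/= mulr1.
  have := is_derive1_comp (is_derive1_atan (e^-1 * x)) h1.
  move=> h; apply: (is_derive_eq h).
  rewrite /kP; have := den_neq0 x; rewrite /den => h2.
  by field; rewrite h2 gt_eqF.
- exact: continuous_kP.
- exact: kP_ge0.
- under eq_fun do rewrite mulrN atanN opprK.
  rewrite (_ : pi = pi / 2 + pi / 2 :> R); last by field.
  have h : atan (e^-1 * n.+1%:R) @[n --> \oo] --> (pi / 2 : R).
    have h0 : (e^-1 * n.+1%:R : R) @[n --> \oo] --> +oo.
      have ei0 : 0 < e^-1 by rewrite invr_gt0.
      have h1 : (n.+1%:R : R) @[n --> \oo] --> +oo.
        by have := @cvgr_idn R; rewrite -cvg_shiftS.
      have h2 : e^-1 * x @[x --> +oo] --> +oo by apply: gt0_cvgMry => //; exact: cvg_id.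
      exact: (cvg_comp _ _ h1 h2).
    exact: (cvg_comp _ _ h0 (@cvgy_atan R)).
  by apply: cvgD.
Qed.

Lemma integ_kP : integ setT kP. Proof. exact: integ_int_kP.1. Qed.

Lemma int_kP : \int[mu]_x kP x = pi. Proof. exact: integ_int_kP.2. Qed.

Lemma sqint_kP : sqint setT kP.
Proof. by apply: sqint_integ_bd integ_kP (fun x _ => kP_le x). Qed.

Lemma sqint_kQ : sqint setT kQ.
Proof.
split; first exact: measurable_kQ.
apply: (integ_le _ _ (integZ e^-1 _ integ_kP)) => //.
  by apply: measurable_funX; exact: measurable_kQ.
by move=> x _; rewrite ger0_norm ?sqr_ge0// -kPQ_sqr lerDr sqr_ge0.
Qed.

(** The sign [sg] selects an end of the line; after the division the expression is the polynomial
    [psi] in [n.+1%:R^-1], with value sg^2 = 1 at 0. *)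
Lemma cvg_den (sg t : R) : sg ^+ 2 = 1 ->
  den (sg * n.+1%:R - t) / n.+1%:R ^+ 2 @[n --> \oo] --> (1 : R).
Proof.
move=> sg1.
pose psi (y : R) := (sg - t * y) * (sg - t * y) + e ^+ 2 * (y * y).
have E n : den (sg * n.+1%:R - t) / n.+1%:R ^+ 2 = psi n.+1%:R^-1.
  by rewrite /den /psi; field.
under eq_fun do rewrite E.
have cpsi : {for 0, continuous psi}.
  have c2 : y @[y --> (0 : R)] --> (0 : R) by exact: cvg_id.
  have c1 : (sg - t * y) @[y --> (0 : R)] --> sg - t * 0.
    by apply: cvgB; [exact: cvg_cst|apply: cvgM => //; exact: cvg_cst].
  exact: (cvgD (cvgM c1 c1) (cvgM (cvg_cst _) (cvgM c2 c2))).
have p0 : psi 0 = 1 by rewrite /psi !mulr0 subr0 addr0 -expr2.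
by have := cvg_comp _ _ (@cvg_harmonic R) cpsi; rewrite p0.
Qed.

(** The subtracted term is the divergent part, common to all poles t, which cancels in
    differences. *)
Lemma cvg_ln_den (sg t : R) : sg ^+ 2 = 1 ->
  ln (den (sg * n.+1%:R - t)) - 2 * ln n.+1%:R @[n --> \oo] --> (0 : R).
Proof.
move=> sg1.
have E n : ln (den (sg * n.+1%:R - t)) - 2 * ln n.+1%:R =
    ln (den (sg * n.+1%:R - t) / n.+1%:R ^+ 2).
  have n0 : (0 : R) < n.+1%:R by rewrite ltr0n.
  rewrite ln_div ?posrE ?exprn_gt0 ?den_gt0// lnXn//.
  by rewrite mulr_natl.
under eq_fun do rewrite E.
by rewrite -ln1; exact: (cvg_comp _ _ (cvg_den t sg1) (continuous_ln ltr01)).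
Qed.

Lemma cvg_kernel0 (sg t : R) : sg ^+ 2 = 1 ->
  kQ (sg * n.+1%:R - t) @[n --> \oo] --> (0 : R) /\
  kP (sg * n.+1%:R - t) @[n --> \oo] --> (0 : R).
Proof.
move=> sg1.
have cd : (den (sg * n.+1%:R - t) / n.+1%:R ^+ 2)^-1 @[n --> \oo] --> (1^-1 : R).
  by apply: cvgV; [exact: oner_neq0|exact: cvg_den].
have ch : n.+1%:R^-1 @[n --> \oo] --> (0 : R) := @cvg_harmonic R.
split.
  have E n : kQ (sg * n.+1%:R - t) = (n.+1%:R^-1 * (sg - t * n.+1%:R^-1)) *
      (den (sg * n.+1%:R - t) / n.+1%:R ^+ 2)^-1.
    rewrite /kQ; have := den_neq0 (sg * n.+1%:R - t); set d := den _ => h.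
    by field; rewrite h andbT nat1r pnatr_eq0.
  under eq_fun do rewrite E.
  rewrite -(mul0r (1^-1 : R)) -{1}(mul0r (sg - t * 0)).
  exact: (cvgM (cvgM ch (cvgB (cvg_cst sg) (cvgM (cvg_cst t) ch))) cd).
have E n : kP (sg * n.+1%:R - t) = (e * (n.+1%:R^-1 * n.+1%:R^-1)) *
    (den (sg * n.+1%:R - t) / n.+1%:R ^+ 2)^-1.
  rewrite /kP; have := den_neq0 (sg * n.+1%:R - t); set d := den _ => h.
  by field; rewrite h andbT nat1r pnatr_eq0.
under eq_fun do rewrite E.
rewrite -(mul0r (1^-1 : R)) -(mulr0 e) -{1}(mulr0 0).
exact: (cvgM (cvgM (cvg_cst e) (cvgM ch ch)) cd).
Qed.

(** Boundary terms for the antiderivatives below other than the logarithm: they are polynomials in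
    [kP] and [kQ] without constant term, and both kernels vanish at infinity. *)
Lemma cvg_kernel_pm (phi : R -> R -> R) t : phi 0 0 = 0 ->
  {for (0, 0), continuous (fun z : R * R => phi z.1 z.2)} ->
  phi (kP (n.+1%:R - t)) (kQ (n.+1%:R - t)) -
  phi (kP (- n.+1%:R - t)) (kQ (- n.+1%:R - t)) @[n --> \oo] --> (0 : R).
Proof.
move=> p0 cphi.
have h sg : sg ^+ 2 = 1 -> phi (kP (sg * n.+1%:R - t)) (kQ (sg * n.+1%:R - t))
    @[n --> \oo] --> (0 : R).
  move=> sg1; have [cQ cP] := cvg_kernel0 t sg1.
  by rewrite -p0; exact: (cvg_comp _ _ (cvg_pair cP cQ) cphi).
have h1 := h 1 (expr1n _ _); have h2 := h (-1) (sqrr_sign _ 1).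
have E n : phi (kP (n.+1%:R - t)) (kQ (n.+1%:R - t)) -
  phi (kP (- n.+1%:R - t)) (kQ (- n.+1%:R - t)) =
  phi (kP (1 * n.+1%:R - t)) (kQ (1 * n.+1%:R - t)) -
  phi (kP (-1 * n.+1%:R - t)) (kQ (-1 * n.+1%:R - t)).
  by rewrite mul1r mulN1r.
under eq_fun do rewrite E.
by rewrite -(subr0 0); exact: cvgB.
Qed.

Lemma is_derive_shift F d t x : is_derive (x - t) 1 F d ->
  is_derive x 1 (fun x => F (x - t)) d.
Proof.
move=> dF; have h1 : is_derive x 1 (fun x => x - t) 1.
  by apply: is_derive_eq; rewrite subr0.
by have := @is_derive1_comp _ F (fun x => x - t) x _ _ dF h1; rewrite mulr1.
Qed.

Lemma continuous_shift F t : continuous F -> continuous (fun x => F (x - t)).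
Proof.
move=> cF x; have h : x0 - t @[x0 --> x] --> x - t.
  by apply: cvgB; [exact: cvg_id|exact: cvg_cst].
exact: (cvg_comp _ _ h (cF (x - t))).
Qed.

Let Qs t x := kQ (x - t).
Let Ps t x := kP (x - t).

Let sQ t : sqint setT (Qs t).
Proof. exact: sqint_shift sqint_kQ. Qed.

Let sP t : sqint setT (Ps t).
Proof. exact: sqint_shift sqint_kP. Qed.

(** A single [kQ] is not integrable. The difference is, since 1/z - 1/w = (w - z)/(z w) turns it
    into products of square-integrable kernels; its antiderivative is half the logarithm of the
    quotient of the two denominators. *)
Lemma int_kQ_diff t s : t != s ->
  \int[mu]_x (kQ (x - t) - kQ (x - s)) = 0.
Proof.
move=> ts; have ts0 : t - s != 0 by rewrite subr_eq0.
apply: (@FTC_line _ (fun x => 2^-1 * (ln (den (x - t)) - ln (den (x - s))))).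
- move=> x.
  have h c : is_derive x 1 (fun x => ln (den (x - c))) (2 * kQ (x - c)).
    have := is_derive_shift (is_derive1_comp (is_derive1_ln (den_gt0 (x - c))) (is_derive_den (x - c))).
    by move=> h; apply: (is_derive_eq h); rewrite /kQ mulrC mulrA.
  have ht := h t; have hs := h s.
  by apply: is_derive_eq; rewrite /GRing.scale/=; field.
- have cQt := @continuous_shift _ t continuous_kQ.
  have cQs := @continuous_shift _ s continuous_kQ.
  by move=> x; apply: cvgB; [exact: cQt|exact: cQs].
- have : integ setT (fun x => (t - s) * (Qs t x * Qs s x - Ps t x * Ps s x)).
    by apply: integZ => //; apply: integB => //; exact: sqintM.
  apply: eq_integ => // x _; rewrite /Qs /Ps /kP /kQ.
  by have := den_neq0 (x - t); have := den_neq0 (x - s); rewrite /den => h1 h2; field; rewrite h1 h2.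
- have h sg : sg ^+ 2 = 1 -> (ln (den (sg * n.+1%:R - t)) - 2 * ln n.+1%:R) -
    (ln (den (sg * n.+1%:R - s)) - 2 * ln n.+1%:R) @[n --> \oo] --> (0 : R).
    by move=> sg1; rewrite -(subr0 0); apply: cvgB; exact: cvg_ln_den.
  have h1 := h 1 (expr1n _ _); have h2 := h (-1) (sqrr_sign _ 1).
  pose L n c sg := ln (den (sg * n.+1%:R - c)) - 2 * ln n.+1%:R.
  have E n : 2^-1 * (ln (den (n.+1%:R - t)) - ln (den (n.+1%:R - s))) -
    2^-1 * (ln (den (- n.+1%:R - t)) - ln (den (- n.+1%:R - s))) =
    2^-1 * ((L n t 1 - L n s 1) - (L n t (-1) - L n s (-1))).
    by rewrite /L !mul1r !mulN1r; ring.
  under eq_fun do rewrite E.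
  rewrite -(mulr0 (2^-1 : R)) -(subr0 0).
  exact: (cvgM (cvg_cst (2^-1 : R)) (cvgB h1 h2)).
Qed.

Lemma int_kP_diff t s : \int[mu]_x (kP (x - t) - kP (x - s)) = 0.
Proof.
have h c := integ_preserving (preserving_shift (- c)) integ_kP.
by rewrite RintB// !(intr_preserving (preserving_shift _) integ_kP) subrr.
Qed.

(* Real part and opposite of the imaginary part of
   (x - t + i e)^-1 (x - s + i e)^-1. *)
Lemma int_kernel2 t s :
  \int[mu]_x (kQ (x - t) * kQ (x - s) - kP (x - t) * kP (x - s)) = 0 /\
  \int[mu]_x (kP (x - t) * kQ (x - s) + kQ (x - t) * kP (x - s)) = 0.
Proof.
have i1 : integ setT (fun x => Qs t x * Qs s x - Ps t x * Ps s x).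
  by apply: integB => //; exact: sqintM.
have i2 : integ setT (fun x => Ps t x * Qs s x + Qs t x * Ps s x).
  by apply: integD => //; exact: sqintM.
have [ts|ts] := eqVneq t s; last first.
  have ts0 : t - s != 0 by rewrite subr_eq0.
  (* Partial fractions: multiplied by t - s, a product of two kernels is a difference of simple
     ones. *)
  split; apply: (mulfI ts0); rewrite mulr0 -RintZ//.
    rewrite -(int_kQ_diff ts); apply: eq_intr => x _; rewrite /kP /kQ.
    by have := den_neq0 (x - t); have := den_neq0 (x - s); rewrite /den => h1 h2; field; rewrite h1 h2.
  rewrite -(int_kP_diff t s); apply: eq_intr => x _; rewrite /kP /kQ.
  by have := den_neq0 (x - t); have := den_neq0 (x - s); rewrite /den => h1 h2; field; rewrite h1 h2.
have cP := @continuous_shift _ t continuous_kP.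
have cQ := @continuous_shift _ t continuous_kQ.
have dP x := is_derive_shift (is_derive_kP (x - t)).
have dQ x := is_derive_shift (is_derive_kQ (x - t)).
have c1 : continuous (fun z : R * R => z.1) by move=> z; exact: cvg_fst.
have c2 : continuous (fun z : R * R => z.2) by move=> z; exact: cvg_snd.
(* Double pole: 1/z^2 has the antiderivative -1/z. *)
subst s; split.
  apply: (@FTC_line _ (fun x => - kQ (x - t))) => //.
  - by move=> x; have h := dQ x; apply: is_derive_eq; ring.
  - by move=> x; apply: cvgB; apply: cvgM; (exact: cP || exact: cQ).
  - apply: (cvg_kernel_pm (phi := fun p q => - q)); first by rewrite oppr0.
    by apply: cvgN; exact: c2.
apply: (@FTC_line _ (fun x => - kP (x - t))) => //.
- by move=> x; have h := dP x; apply: is_derive_eq; ring.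
- by move=> x; apply: cvgD; apply: cvgM; (exact: cP || exact: cQ).
- apply: (cvg_kernel_pm (phi := fun p q => - p)); first by rewrite oppr0.
  by apply: cvgN; exact: c1.
Qed.

(* Real part and opposite of the imaginary part of
   (x - t + i e)^-1 (x - s + i e)^-1 (x - r + i e)^-1. *)
Definition re_kernel3 t s r x := kQ (x - t) * kQ (x - s) * kQ (x - r)
  - kQ (x - t) * kP (x - s) * kP (x - r)
  - kP (x - t) * kQ (x - s) * kP (x - r)
  - kP (x - t) * kP (x - s) * kQ (x - r).

Definition im_kernel3 t s r x := kQ (x - t) * kQ (x - s) * kP (x - r)
  + kQ (x - t) * kP (x - s) * kQ (x - r)
  + kP (x - t) * kQ (x - s) * kQ (x - r)
  - kP (x - t) * kP (x - s) * kP (x - r).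

Let bd_shift (k : R -> R) : measurable_fun [set: R] k -> (forall x, `|k x| <= e^-1) ->
  forall t f, integ setT f -> integ setT (fun x => f x * k (x - t)).
Proof.
move=> mk kb t f fi.
apply: (@eq_integ _ _ (fun x => k (x - t) * f x)) => //.
  by move=> x _; rewrite mulrC.
apply: (@integ_bdM _ _ _ _ e^-1) => //.
by apply: measurableT_comp => //; exact: measurable_funB.
Qed.

Let bQ t f := bd_shift measurable_kQ kQ_le t (f := f).
Let bP t f := bd_shift measurable_kP kP_le t (f := f).

Let integ_re3 t s r : integ setT (re_kernel3 t s r).
Proof.
have i1 := bQ r (sqintM measurableT (sQ t) (sQ s)).
have i2 := bP r (sqintM measurableT (sQ t) (sP s)).
have i3 := bP r (sqintM measurableT (sP t) (sQ s)).
have i4 := bQ r (sqintM measurableT (sP t) (sP s)).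
exact: (integB measurableT (integB measurableT (integB measurableT i1 i2) i3) i4).
Qed.

Let integ_im3 t s r : integ setT (im_kernel3 t s r).
Proof.
have i1 := bP r (sqintM measurableT (sQ t) (sQ s)).
have i2 := bQ r (sqintM measurableT (sQ t) (sP s)).
have i3 := bQ r (sqintM measurableT (sP t) (sQ s)).
have i4 := bP r (sqintM measurableT (sP t) (sP s)).
exact: (integB measurableT (integD measurableT (integD measurableT i1 i2) i3) i4).
Qed.

Let int_kernel3_neq t s r : t != s ->
  \int[mu]_x re_kernel3 t s r x = 0 /\ \int[mu]_x im_kernel3 t s r x = 0.
Proof.
move=> ts; have ts0 : t - s != 0 by rewrite subr_eq0.
have [a1 a2] := int_kernel2 t r.
have [b1 b2] := int_kernel2 s r.
split; apply: (mulfI ts0); rewrite mulr0 -RintZ//.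
  transitivity (\int[mu]_x ((kQ (x - t) * kQ (x - r) - kP (x - t) * kP (x - r)) -
    (kQ (x - s) * kQ (x - r) - kP (x - s) * kP (x - r)))).
    apply: eq_intr => x _; rewrite /re_kernel3 /kP /kQ.
    have := den_neq0 (x - t); have := den_neq0 (x - s); have := den_neq0 (x - r).
    by rewrite /den => h1 h2 h3; field; rewrite h1 h2 h3.
  have j c := integB measurableT (sqintM measurableT (sQ c) (sQ r))
    (sqintM measurableT (sP c) (sP r)).
  by rewrite (RintB measurableT (j t) (j s)) a1 b1 subrr.
transitivity (\int[mu]_x ((kP (x - t) * kQ (x - r) + kQ (x - t) * kP (x - r)) -
    (kP (x - s) * kQ (x - r) + kQ (x - s) * kP (x - r)))).
  apply: eq_intr => x _; rewrite /im_kernel3 /kP /kQ.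
  have := den_neq0 (x - t); have := den_neq0 (x - s); have := den_neq0 (x - r).
  by rewrite /den => h1 h2 h3; field; rewrite h1 h2 h3.
have j c := integD measurableT (sqintM measurableT (sP c) (sQ r))
  (sqintM measurableT (sQ c) (sP r)).
by rewrite (RintB measurableT (j t) (j s)) a2 b2 subrr.
Qed.

(** Two distinct poles reduce to [int_kernel2] by partial fractions, and the kernels are symmetric
    in the three poles; for a triple pole, 1/z^3 has the antiderivative -1/(2 z^2). *)
Lemma int_kernel3 t s r :
  (integ setT (re_kernel3 t s r) /\ \int[mu]_x re_kernel3 t s r x = 0) /\
  (integ setT (im_kernel3 t s r) /\ \int[mu]_x im_kernel3 t s r x = 0).
Proof.
suff [] : \int[mu]_x re_kernel3 t s r x = 0 /\ \int[mu]_x im_kernel3 t s r x = 0 by [].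
have [ts|] := eqVneq t s; last exact: int_kernel3_neq.
have [sr|sr] := eqVneq s r; last first.
  have [h1 h2] := int_kernel3_neq t sr.
  by split; [rewrite -h1|rewrite -h2]; apply: eq_intr => x _; rewrite /re_kernel3 /im_kernel3; ring.
subst s r.
have cP := @continuous_shift _ t continuous_kP.
have cQ := @continuous_shift _ t continuous_kQ.
have dP x := is_derive_shift (is_derive_kP (x - t)).
have dQ x := is_derive_shift (is_derive_kQ (x - t)).
have c1 : continuous (fun z : R * R => z.1) by move=> z; exact: cvg_fst.
have c2 : continuous (fun z : R * R => z.2) by move=> z; exact: cvg_snd.
split.
  apply: (@FTC_line _ (fun x => 2^-1 * (kP (x - t) * kP (x - t) - kQ (x - t) * kQ (x - t)))) => //.
  - move=> x; have h1 := dP x; have h2 := dQ x; apply: is_derive_eq.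
    by rewrite /re_kernel3 /GRing.scale/=; field.
  - move=> x; exact: (cvgB (cvgB (cvgB (cvgM (cvgM (cQ x) (cQ x)) (cQ x))
      (cvgM (cvgM (cQ x) (cP x)) (cP x)))
      (cvgM (cvgM (cP x) (cQ x)) (cP x)))
      (cvgM (cvgM (cP x) (cP x)) (cQ x))).
  - apply: (cvg_kernel_pm (phi := fun p q => 2^-1 * (p * p - q * q))).
      by rewrite mulr0 subrr mulr0.
    exact: (cvgM (cvg_cst _) (cvgB (cvgM (c1 (0, 0)) (c1 (0, 0)))
      (cvgM (c2 (0, 0)) (c2 (0, 0))))).
apply: (@FTC_line _ (fun x => - (kP (x - t) * kQ (x - t)))) => //.
- move=> x; have h1 := dP x; have h2 := dQ x; apply: is_derive_eq.
  by rewrite /im_kernel3 /GRing.scale/=; ring.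
- move=> x; exact: (cvgB (cvgD (cvgD (cvgM (cvgM (cQ x) (cQ x)) (cP x))
    (cvgM (cvgM (cQ x) (cP x)) (cQ x)))
    (cvgM (cvgM (cP x) (cQ x)) (cQ x)))
    (cvgM (cvgM (cP x) (cP x)) (cP x))).
- apply: (cvg_kernel_pm (phi := fun p q => - (p * q))); first by rewrite mulr0 oppr0.
  exact: (cvgN (cvgM (c1 (0, 0)) (c2 (0, 0)))).
Qed.

End PoissonKernels.

(** * Cauchy transforms of square-integrable functions *)

Section Fatou.
Context {R : realType}.

(** Lower semicontinuity of the L^2 norm under pointwise convergence. It carries norm bounds through
    the truncation of f and through the limit of vanishing height. *)
Lemma sqint_fatou (D : set R) (h_ : nat -> R -> R) (h : R -> R) C :
  measurable D -> (forall n, sqint D (h_ n)) -> (forall n, nrm D (h_ n) <= C) ->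
  (forall x, D x -> h_ n x @[n --> \oo] --> h x) ->
  sqint D h /\ nrm D h <= C.
Proof.
move=> mD hi hC hh.
have C0 : 0 <= C by rewrite (le_trans _ (hC 0%N))// nrm_ge0.
have mh : measurable_fun D h by apply: measurable_fun_cvg hh => n; case: (hi n).
have mh2 : measurable_fun D (fun x => h x ^+ 2) by exact: measurable_funX.
have key : (\int[mu]_(x in D) (h x ^+ 2)%:E <= (C ^+ 2)%:E)%E.
  have F := @fatou _ (measurableTypeR R) R mu D mD (fun n x => (h_ n x ^+ 2)%:E).
  have -> : (\int[mu]_(x in D) (h x ^+ 2)%:E =
    \int[mu]_(x in D) limn_einf (fun n => (h_ n x ^+ 2)%:E))%E.
    apply: eq_integral => x /set_mem Dx; apply/esym.
    have cx : ((h_ n x ^+ 2)%:E @[n --> \oo] --> (h x ^+ 2)%:E)%E.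
      apply: cvg_EFin; first exact: nearW.
      by rewrite expr2; under eq_fun do rewrite expr2; apply: cvgM; exact: hh.
    exact: (cvg_limn_einf_sup cx).1.
  apply: (le_trans (F _ _)).
  - move=> n; apply/measurable_EFinP; apply: measurable_funX; exact: (hi n).1.
  - by move=> n x Dx; rewrite lee_fin sqr_ge0.
  rewrite limn_einf_lim; apply: lime_le; first exact: is_cvg_einfs.
  apply: nearW => n; apply: (@le_trans _ _ (\int[mu]_(x in D) (h_ n x ^+ 2)%:E)%E).
    by apply: ereal_inf_lbound; exists n => /=.
  rewrite EFin_intr//; last exact: (hi n).2.
  rewrite lee_fin -nrm_sqr lerXn2r ?nnegrE ?nrm_ge0//.
have hi2 : sqint D h.
  split=> //; apply/integrableP; split; first exact/measurable_EFinP.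
  under eq_integral => x _ do rewrite /= ger0_norm ?sqr_ge0//.
  by rewrite (le_lt_trans key)// ltry.
split=> //.
rewrite EFin_intr ?lee_fin in key; [|by []|exact: hi2.2].
by rewrite -(ger0_norm C0) -sqrtr_sqr ler_sqrt ?sqr_ge0.
Qed.

End Fatou.

(** * Norm bounds and orthogonality relations at a fixed height *)

Section CauchyTransform.
Context {R : realType} (e : R) (e0 : 0 < e).
Implicit Types (f g h K : R -> R) (s t x M : R).

Let P := @kP R e.
Let Q := @kQ R e.
Let sP : sqint setT P := sqint_kP e0.
Let sQ : sqint setT Q := sqint_kQ e0.

(** Fubini makes the product of [kP e] and the convolution integrable, hence measurable; dividing by
    the positive continuous [kP e] keeps measurability. *)
Lemma measurable_convol f g M : sqint setT f -> sqint setT g ->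
  (forall x, `|g x| <= M) -> measurable_fun [set: R] (convol f g).
Proof.
move=> fi gi gM.
have [/integ_meas m _ _] := int_convol (integ_kP e0) fi gi gM.
have -> : convol f g = (fun x => (kP e x)^-1 * (kP e x * convol f g x)).
  by apply/funext => x; rewrite mulKf// gt_eqF// divr_gt0// den_gt0.
apply: measurable_funM => //.
apply: (@eq_measurable_fun _ _ _ _ _ (fun x => e^-1 * den e x)).
  by move=> x _; rewrite /kP invf_div mulrC.
apply: continuous_measurable_fun => x.
apply: cvgM; first exact: cvg_cst.
exact: is_derive_cont (is_derive_den e x).
Qed.

(** [int_convol] with the roles of K and f exchanged and g reflected: here f is integrable and K
    square-integrable. *)
Lemma int_convol_L1 K f g M : sqint setT K -> integ setT f -> sqint setT g ->
  (forall x, `|g x| <= M) ->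
  [/\ integ setT (fun x => K x * convol f g x),
      integ setT (fun t => f t * \int[mu]_x (K x * g (x - t))) &
    \int[mu]_x (K x * convol f g x) =
    \int[mu]_t (f t * \int[mu]_x (K x * g (x - t)))].
Proof.
move=> Ki fi gi gM.
have gi' : sqint setT (fun x => g (- x)) := sqint_preserving preserving_opp gi.
have [] := int_convol fi Ki gi' (fun x => gM (- x)).
have -> : (fun x => f x * convol K (fun x0 => g (- x0)) x) =
   (fun t => f t * \int[mu]_x (K x * g (x - t))).
  by apply/funext => x; congr (_ * _); apply: eq_intr => t _; rewrite opprB.
have -> : (fun t => K t * \int[mu]_x (f x * g (- (x - t)))) =
  (fun x => K x * convol f g x).
  by apply/funext => x; congr (_ * _); apply: eq_intr => t _; rewrite opprB.
by move=> i1 i2 E; split; [exact: i2|exact: i1|rewrite E].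
Qed.

(** Young's inequality, [kP] being positive with integral pi. *)
Lemma convol_kP_bound f : sqint setT f ->
  sqint setT (convol f P) /\ nrm setT (convol f P) <= pi * nrm setT f.
Proof.
move=> fi.
have E : convol f P = convol P f by apply/funext => x; rewrite convolC.
have := @young12 _ P f (integ_kP e0).
rewrite -E => h.
have [] // := h.
- exact: (measurable_convol fi sP (kP_le e0)).
- by move=> x; apply: sqintM => //; exact: sqint_reflect.
- move=> x; apply: (@integ_bdM _ _ _ _ e^-1) => //.
  + by apply: measurableT_comp => //; exact: sP.1.
  + by move=> y _; rewrite normr_id; exact: kP_le.
  + exact: (sqint_reflect x fi).2.
move=> s1 s2; split=> //.
rewrite -(int_kP e0); apply: (le_trans s2).
rewrite ler_wpM2r ?nrm_ge0// le_eqVlt; apply/orP; left; apply/eqP.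
by apply: eq_intr => x _; rewrite ger0_norm// kP_ge0.
Qed.

(** Real part of the vanishing integral of F_f^2: two exchanges by Fubini reduce it to
    [int_kernel2]. As [kQ] is not integrable, Young's inequality takes f as the integrable
    factor. *)
Lemma nrm_convol_kQ f : sqint setT f -> integ setT f ->
  sqint setT (convol f Q) /\ nrm setT (convol f Q) = nrm setT (convol f P).
Proof.
move=> fi f1.
have [su _] := convol_kP_bound fi.
have mv : measurable_fun [set: R] (convol f Q) := measurable_convol fi sQ (kQ_le e0).
have sv : sqint setT (convol f Q).
  apply: (@young12 _ f Q f1 mv _ sQ _).1.
  - by move=> x; apply: sqintM => //; exact: sqint_reflect.
  - move=> x.
    apply: (@eq_integ _ _ (fun t => Q (x - t) ^+ 2 * `|f t|)) => //.
      by move=> y _; rewrite mulrC.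
    apply: (@integ_bdM R setT (fun t => Q (x - t) ^+ 2) (fun t => `|f t|) (e^-1 ^+ 2)).
    + exact: measurableT.
    + by apply: measurable_funX; exact: (sqint_reflect x sQ).1.
    + move=> y _; rewrite normrX; apply: lerXn2r; last exact: kQ_le.
        by rewrite nnegrE.
      by rewrite nnegrE invr_ge0 ltW.
    + exact: integ_norm.
split; first exact: sv.
suff : \int[mu]_x (convol f Q x * convol f Q x) = \int[mu]_x (convol f P x * convol f P x).
  have e2 (g : R -> R) : \int[mu]_x g x ^+ 2 = \int[mu]_x (g x * g x).
    by apply: eq_intr => x _; rewrite expr2.
  by rewrite /nrm e2 => ->; rewrite -e2.
have S s : \int[mu]_x (convol f Q x * Q (x - s)) = \int[mu]_x (convol f P x * P (x - s)).
  have c (g : R -> R) : \int[mu]_x (convol f g x * g (x - s)) = \int[mu]_x (g (x - s) * convol f g x).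
    by apply: eq_intr => x _; rewrite mulrC.
  rewrite !c.
  have [_ i1 ->] := int_convol_L1 (sqint_shift s sQ) f1 sQ (kQ_le e0).
  have [_ i2 ->] := int_convol_L1 (sqint_shift s sP) f1 sP (kP_le e0).
  apply: eq_intr => t _; congr (_ * _); apply/eqP; rewrite -subr_eq0.
  rewrite -RintB//.
  - by rewrite (int_kernel2 e0 s t).1.
  - by apply: sqintM => //; exact: sqint_shift.
  - by apply: sqintM => //; exact: sqint_shift.
have [_ i1 ->] := int_convol_L1 sv f1 sQ (kQ_le e0).
have [_ i2 ->] := int_convol_L1 su f1 sP (kP_le e0).
by apply: eq_intr => t _; rewrite S.
Qed.

(** Truncations of f are integrable, and the bound inherited from [kP] is uniform in the truncation,
    so Fatou's lemma extends it to all square-integrable f. *)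
Lemma convol_kQ_bound f : sqint setT f ->
  sqint setT (convol f Q) /\ nrm setT (convol f Q) <= pi * nrm setT f.
Proof.
move=> fi.
pose fn n := f \_ (sym_itv n).
have mfn n : measurable_fun [set: R] (fn n) by apply: measurable_restrict_sym fi.1.
have fnle n x : `|fn n x| <= `|f x| by exact: norm_restrict_le.
have sfn n : sqint setT (fn n) by exact: (sqint_le measurableT (mfn n) fi (fun x _ => fnle n x)).
have ifn n : integ setT (fn n).
  have m1 := @measurable_sym_itv R n.
  exact: ((integ_restrict f m1).1 (sqint_itv_integ (sqintS measurableT m1 (@subsetT _ _) fi))).
apply: (@sqint_fatou _ _ (fun n => convol (fn n) Q)) => //.
- by move=> n; exact: (nrm_convol_kQ _ _).1.
- move=> n; rewrite (nrm_convol_kQ _ _).2//.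
  apply: (le_trans (convol_kP_bound (sfn n)).2); rewrite ler_wpM2l ?pi_ge0//.
  rewrite ler_sqrt; last by apply: Rintegral_ge0 => x _; exact: sqr_ge0.
  apply: le_intr => //; [exact: (sfn n).2|exact: fi.2|].
  move=> x _; rewrite -[leLHS]real_normK ?num_real// -[leRHS]real_normK ?num_real//.
  by rewrite lerXn2r ?nnegrE.
- move=> x _.
  have [] // := @dominated_cvgR R setT (fun n t => fn n t * Q (x - t))
    (fun t => f t * Q (x - t)) (fun t => `|f t * Q (x - t)|).
  + by move=> n; apply: measurable_funM => //; exact: (sqint_reflect x sQ).1.
  + by move=> t _; apply: cvgM; [exact: cvg_restrict_sym|exact: cvg_cst].
  + by apply: integ_norm => //; apply: sqintM => //; exact: sqint_reflect.
  + by move=> n t _; rewrite !normrM ler_wpM2r.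
Qed.

(* (K1 + i K2) is orthogonal to all (x - t + i e)^-1, hence to the Cauchy
   transforms of L^2 functions. *)
Definition null (K1 K2 : R -> R) := [/\ integ setT K1, integ setT K2 &
  forall t, \int[mu]_x (K1 x * Q (x - t)) + \int[mu]_x (K2 x * P (x - t)) = 0 /\
            \int[mu]_x (K2 x * Q (x - t)) - \int[mu]_x (K1 x * P (x - t)) = 0].

Lemma null_convol K1 K2 f : null K1 K2 -> sqint setT f ->
  \int[mu]_x (K1 x * convol f Q x) + \int[mu]_x (K2 x * convol f P x) = 0 /\
  \int[mu]_x (K2 x * convol f Q x) - \int[mu]_x (K1 x * convol f P x) = 0.
Proof.
move=> [i1 i2 N] fi.
have [_ j1 ->] := int_convol i1 fi sQ (kQ_le e0).
have [_ j2 ->] := int_convol i1 fi sP (kP_le e0).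
have [_ j3 ->] := int_convol i2 fi sQ (kQ_le e0).
have [_ j4 ->] := int_convol i2 fi sP (kP_le e0).
split.
  rewrite -RintD//; apply: Rint_eq0 => t _.
  by rewrite -mulrDr (N t).1 mulr0.
rewrite -RintB//; apply: Rint_eq0 => t _.
by rewrite -mulrBr (N t).2 mulr0.
Qed.

Let bd_shift (k : R -> R) f t : sqint setT k -> (forall x, `|k x| <= e^-1) ->
  integ setT f -> integ setT (fun x => f x * k (x - t)).
Proof.
move=> ki kb fi; apply: (@eq_integ _ _ (fun x => k (x - t) * f x)) => //.
  by move=> x _; rewrite mulrC.
by apply: (@integ_bdM _ _ _ _ e^-1) => //; exact: (sqint_shift t ki).1.
Qed.

Let bQ f t := @bd_shift Q f t sQ (kQ_le e0).
Let bP f t := @bd_shift P f t sP (kP_le e0).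

(** Start of a chain, with F_f = [convol f Q] - i [convol f P]: a product of two kernels is null,
    then F_f times a kernel, then F_f^2. Each further link applies [null_convol] to the preceding
    one and rereads the result, by symmetry in the factors, as a pairing with the remaining
    kernel. *)
Lemma null_kernel s r :
  null (fun x => Q (x - s) * Q (x - r) - P (x - s) * P (x - r))
       (fun x => - (P (x - s) * Q (x - r) + Q (x - s) * P (x - r))).
Proof.
have SQ c := sqint_shift c sQ; have SP c := sqint_shift c sP.
have i1 := integB measurableT (sqintM measurableT (SQ s) (SQ r))
  (sqintM measurableT (SP s) (SP r)).
have i2 := integZ (-1) measurableT
  (integD measurableT (sqintM measurableT (SP s) (SQ r)) (sqintM measurableT (SQ s) (SP r))).
have i2' : integ setT (fun x => - (P (x - s) * Q (x - r) + Q (x - s) * P (x - r))).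
  by apply: eq_integ i2 => // x _; rewrite mulN1r.
split=> // t; have [[j1 z1] [j2 z2]] := int_kernel3 e0 s r t; split.
  rewrite -RintD//; [|exact: bQ|exact: bP].
  rewrite -{}z1; apply: eq_intr => x _.
  by rewrite /re_kernel3 /Q /P; ring.
rewrite -RintB//; [|exact: bQ|exact: bP].
rewrite -[RHS](mulr0 (-1)) -{}z2 -RintZ//; apply: eq_intr => x _.
by rewrite /im_kernel3 /Q /P; ring.
Qed.

Section Transforms.
Context (f : R -> R).
Context (fi : sqint setT f).
Let u := convol f P.
Let v := convol f Q.
Let su : sqint setT u := (convol_kP_bound fi).1.
Let sv : sqint setT v := (convol_kQ_bound fi).1.

Lemma null_transform_kernel s :
  null (fun x => v x * Q (x - s) - u x * P (x - s))
       (fun x => - (v x * P (x - s) + u x * Q (x - s))).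
Proof.
have SQ c := sqint_shift c sQ; have SP c := sqint_shift c sP.
have i1 := integB measurableT (sqintM measurableT sv (SQ s)) (sqintM measurableT su (SP s)).
have i2 : integ setT (fun x => - (v x * P (x - s) + u x * Q (x - s))).
  have := integZ (-1) measurableT
    (integD measurableT (sqintM measurableT sv (SP s)) (sqintM measurableT su (SQ s))).
  by apply: eq_integ => // x _; rewrite mulN1r.
split=> // t.
have N := null_kernel s t; have [n1 n2 _] := N.
have [z1 z2] := null_convol N fi.
have [a1 _ _] := int_convol n1 fi sQ (kQ_le e0).
have [a2 _ _] := int_convol n2 fi sP (kP_le e0).
have [a3 _ _] := int_convol n2 fi sQ (kQ_le e0).
have [a4 _ _] := int_convol n1 fi sP (kP_le e0).
split.
  rewrite -[RHS]z1 -!RintD//; [|exact: bQ|exact: bP].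
  by apply: eq_intr => x _; rewrite /u /v; ring.
rewrite -[RHS]z2 -!RintB//; [|exact: bQ|exact: bP].
by apply: eq_intr => x _; rewrite /u /v; ring.
Qed.

Lemma null_transform_sqr :
  null (fun x => v x * v x - u x * u x) (fun x => - (2 * (u x * v x))).
Proof.
have i1 := integB measurableT (sqintM measurableT sv sv) (sqintM measurableT su su).
have i2 : integ setT (fun x => - (2 * (u x * v x))).
  have := integZ (-2) measurableT (sqintM measurableT su sv).
  by apply: eq_integ => // x _; rewrite mulNr.
split=> // t.
have N := null_transform_kernel t; have [n1 n2 _] := N.
have [z1 z2] := null_convol N fi.
have [a1 _ _] := int_convol n1 fi sQ (kQ_le e0).
have [a2 _ _] := int_convol n2 fi sP (kP_le e0).
have [a3 _ _] := int_convol n2 fi sQ (kQ_le e0).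
have [a4 _ _] := int_convol n1 fi sP (kP_le e0).
split.
  rewrite -[RHS]z1 -!RintD//; [|exact: bQ|exact: bP].
  by apply: eq_intr => x _; rewrite /u /v; ring.
rewrite -[RHS]z2 -!RintB//; [|exact: bQ|exact: bP].
by apply: eq_intr => x _; rewrite /u /v; ring.
Qed.

(* Imaginary part of the vanishing integral of F_f^2 F_g over the line at
   height e, where F_h is the Cauchy integral of h. *)
Lemma triple_transform g : sqint setT g ->
  [/\ integ setT (fun x => (v x ^+ 2 - u x ^+ 2) * convol g Q x),
      integ setT (fun x => u x * v x * convol g P x) &
  \int[mu]_x ((v x ^+ 2 - u x ^+ 2) * convol g Q x) =
  2 * \int[mu]_x (u x * v x * convol g P x)].
Proof.
move=> gi; have N := null_transform_sqr; have [n1 n2 _] := N.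
have [z1 _] := null_convol N gi.
have [a1 _ _] := int_convol n1 gi sQ (kQ_le e0).
have [a2 _ _] := int_convol n2 gi sP (kP_le e0).
have i1 : integ setT (fun x => (v x ^+ 2 - u x ^+ 2) * convol g Q x).
  by apply: eq_integ a1 => // x _; rewrite !expr2.
have i2 : integ setT (fun x => u x * v x * convol g P x).
  by apply: eq_integ (integZ (- 2^-1) measurableT a2) => // x _; field.
split=> //; rewrite -RintZ//; apply/eqP; rewrite -subr_eq0 -RintB//; last exact: integZ.
rewrite -[X in _ == X]z1 -RintD//; apply/eqP; apply: eq_intr => x _; ring.
Qed.

End Transforms.

End CauchyTransform.

(** * The Hilbert transform of Lipschitz square-integrable functions *)

Section LipschitzL2.
Context {R : realType}.
Implicit Types (f g h : R -> R) (s t x C B e : R).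

Definition lip C f := forall x y, `|f x - f y| <= C * `|x - y|.

Lemma lip_ge0 C f : lip C f -> 0 <= C.
Proof. by move=> /(_ 1 0); rewrite subr0 normr1 mulr1; apply: le_trans. Qed.

Lemma lip_continuous C f : lip C f -> continuous f.
Proof.
move=> lf x; have C0 := lip_ge0 lf.
apply/cvgrPdist_le => eps e0; near=> y.
apply: (le_trans (lf _ _)).
apply: (@le_trans _ _ ((C + 1) * `|x - y|)).
  by rewrite ler_wpM2r// lerDl.
rewrite mulrC -ler_pdivlMr ?ltr_wpDl//.
near: y; apply: cvgr_dist_le; first exact: cvg_id.
by rewrite divr_gt0// ltr_wpDl.
Unshelve. all: by end_near. Qed.

Lemma lip_measurable C f : lip C f -> measurable_fun [set: R] f.
Proof. by move=> /lip_continuous; exact: continuous_measurable_fun. Qed.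

(** The inverse, with value 0 at 0, is the pointwise limit of the continuous kernels [kQ] as their
    height tends to 0. *)
Lemma measurable_inv : measurable_fun [set: R] (fun x : R => x^-1).
Proof.
apply: (@measurable_fun_cvg _ _ _ _ (fun n => kQ (n.+1%:R^-1))).
  by move=> n; apply: measurable_kQ; rewrite invr_gt0.
move=> x _; rewrite /kQ /den.
have [->|x0] := eqVneq x 0.
  by under eq_fun do rewrite mul0r; rewrite invr0; exact: cvg_cst.
have h : (x ^+ 2 + n.+1%:R^-1 ^+ 2 : R) @[n --> \oo] --> x ^+ 2 + 0 * 0.
  apply: cvgD; first exact: cvg_cst.
  by under eq_fun do rewrite expr2; apply: cvgM; exact: (@cvg_harmonic R).
have xx : x ^+ 2 + 0 * 0 != 0 by rewrite mulr0 addr0 sqrf_eq0.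
have -> : x^-1 = x * (x ^+ 2 + 0 * 0)^-1 by rewrite mulr0 addr0; field.
by apply: cvgM; [exact: cvg_cst|exact: cvgV].
Qed.

Definition sdiff f x t := f (x - t) - f (x + t).

(** This is pi times the Hilbert transform: symmetrizing f(x - t)/t under t -> -t replaces the
    principal value by an integral that converges absolutely for Lipschitz square-integrable f. *)
Definition hil f x := 2^-1 * \int[mu]_t (sdiff f x t / t).

Lemma sqint_sdiff f x : sqint setT f -> sqint setT (sdiff f x).
Proof.
move=> fi; apply: sqintB => //; first exact: sqint_reflect.
have := sqint_shift (- x) fi.
by apply: eq_sqint => // t _; rewrite opprK addrC.
Qed.

Lemma sdiff_le C f x t : lip C f -> `|sdiff f x t| <= 2 * C * `|t|.
Proof.
move=> lf; apply: (le_trans (lf _ _)).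
have -> : x - t - (x + t) = (- 2) * t by ring.
rewrite normrM normrN (ger0_norm (ler0n _ 2)) mulrA [C * 2]mulrC; exact: lexx.
Qed.

(** The quotient is at most 2 C for |t| <= 1 and at most [sdiff f x t ^+ 2] + t^-2 for |t| > 1. As 1
    and t^-2 are at most 2/(t^2 + 1) on these ranges, the constant 4 C + 2 serves both. *)
Lemma integ_sdiff C f x : lip C f -> sqint setT f ->
  integ setT (fun t => sdiff f x t / t).
Proof.
move=> lf fi; have sD := sqint_sdiff x fi; have C0 := lip_ge0 lf.
apply: (@integ_le _ _ _ (fun t => (4 * C + 2) * kP 1 t + sdiff f x t ^+ 2)) => //.
- by apply: measurable_funM; [exact: sD.1|exact: measurable_inv].
- by apply: integD => //; [apply: integZ => //; exact: integ_kP|exact: sD.2].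
move=> t _; rewrite /kP /den expr1n.
have tp : 0 < t ^+ 2 + 1 by rewrite ltr_wpDl ?sqr_ge0.
have [t1|t1] := leP `|t| 1.
  apply: (@le_trans _ _ (2 * C)).
    have [->|t0] := eqVneq t 0; first by rewrite invr0 mulr0 normr0 mulr_ge0.
    by rewrite normrM normfV ler_pdivrMr ?normr_gt0//; exact: sdiff_le.
  apply: (@le_trans _ _ ((4 * C + 2) * (1 / (t ^+ 2 + 1)))); last first.
    by rewrite lerDl sqr_ge0.
  rewrite mul1r ler_pdivlMr//.
  have : `|t| ^+ 2 <= 1 by rewrite expr_le1.
  rewrite real_normK ?num_real// => t2.
  have := mulr_ge0 C0 (_ : 0 <= 1 - t ^+ 2); rewrite subr_ge0 => /(_ t2).
  nra.
have t0 : t != 0 by apply: contraTneq t1 => ->; rewrite normr0 ltr10.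
have t2 : 1 < t ^+ 2.
  by rewrite -(real_normK (num_real t)); rewrite exprn_egt1.
have h1 : `|sdiff f x t / t| <= sdiff f x t ^+ 2 + t^-1 ^+ 2.
  rewrite normrM -[sdiff f x t ^+ 2]real_normK ?num_real// -[t^-1 ^+ 2]real_normK ?num_real//.
  have := sqr_ge0 (`|sdiff f x t| - `|t^-1|).
  by have := normr_ge0 (sdiff f x t); have := normr_ge0 t^-1; nra.
apply: (le_trans h1); rewrite addrC lerD2r mul1r.
apply: (@le_trans _ _ (2 / (t ^+ 2 + 1))); last first.
  by rewrite ler_pM2r ?invr_gt0// lerDr mulr_ge0.
rewrite exprVn ler_pdivlMr// mulrC ler_pdivrMr ?(lt_trans _ t2)//.
lra.
Qed.

Lemma convol_odd_sdiff (k : R -> R) f x : sqint setT k ->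
  (forall t, k (- t) = - k t) -> sqint setT f ->
  convol f k x = 2^-1 * \int[mu]_t (k t * sdiff f x t).
Proof.
move=> ki kN fi.
rewrite convolC//; set I := convol _ _ _.
have i1 : integ setT (fun t => k t * f (x - t)).
  by apply: sqintM => //; exact: sqint_reflect.
have si2 : sqint setT (fun t => f (x + t)).
  have := sqint_shift (- x) fi.
  by apply: eq_sqint => // t _; rewrite opprK addrC.
have i2 : integ setT (fun t => k t * f (x + t)) by exact: sqintM.
have /eqP E : \int[mu]_t (k t * f (x + t)) = - I.
  rewrite -(intr_preserving preserving_opp i2) -mulN1r /I /convol -RintZ//.
  by apply: eq_intr => t _; rewrite kN; ring.
have /eqP E2 : \int[mu]_t (k t * sdiff f x t) = I - - I.
  rewrite -(eqP E) /I /convol -RintB//.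
  by apply: eq_intr => t _; rewrite /sdiff; ring.
by rewrite (eqP E2); field.
Qed.

(** The quotient [sdiff f x t / t] is at most 2 C everywhere, so a kernel differing from 1/t by a
    relative error c e kP changes the integral by at most 2 c C e pi, pi being the mass of [kP]. The
    bound is uniform in x. *)
Lemma convol_odd_approx (k : R -> R) c e C f x : 0 < e -> sqint setT k ->
  (forall t, k (- t) = - k t) ->
  (forall t, t != 0 -> `|k t * t - 1| <= c * (e * kP e t)) ->
  lip C f -> sqint setT f ->
  `|convol f k x - hil f x| <= c * C * pi * e.
Proof.
move=> e0 ki kN kc lf fi; have sD := sqint_sdiff x fi.
rewrite convol_odd_sdiff// /hil -mulrBr -RintB//; last 2 first.
- exact: sqintM.
- exact: integ_sdiff lf fi.
have C0 := lip_ge0 lf.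
rewrite normrM gtr0_norm ?invr_gt0//.
have i := integB measurableT (sqintM measurableT ki sD) (integ_sdiff x lf fi).
have c0 : 0 <= c.
  have := le_trans (normr_ge0 _) (kc 1 (oner_neq0 _)).
  by rewrite pmulr_lge0// mulr_gt0// divr_gt0// den_gt0.
apply: (@le_trans _ _ (2^-1 * \int[mu]_t (2 * c * C * e * kP e t))).
  rewrite ler_pM2l ?invr_gt0//; apply: (le_trans (le_norm_intr _ i)) => //.
  apply: le_intr => //; [exact: integ_norm|apply: integZ => //; exact: integ_kP|].
  move=> t _.
  have [->|t0] := eqVneq t 0.
    rewrite /sdiff subr0 addr0 subrr mulr0 mul0r subrr normr0.
    by rewrite mulr_ge0 ?kP_ge0// mulr_ge0 ?(ltW e0)// mulr_ge0// mulr_ge0.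
  have -> : k t * sdiff f x t - sdiff f x t / t = (k t * t - 1) * (sdiff f x t / t).
    by field.
  rewrite normrM.
  have -> : 2 * c * C * e * kP e t = (c * (e * kP e t)) * (2 * C) by ring.
  apply: ler_pM => //; first exact: kc.
  by rewrite normrM normfV ler_pdivrMr ?normr_gt0//; exact: sdiff_le.
rewrite RintZ ?int_kP//; last exact: integ_kP.
by rewrite le_eqVlt; apply/orP; left; apply/eqP; field.
Qed.

Lemma convol_kQ_approx e C f x : 0 < e -> lip C f -> sqint setT f ->
  `|convol f (kQ e) x - hil f x| <= C * pi * e.
Proof.
move=> e0 lf fi; rewrite -[C]mul1r.
apply: convol_odd_approx => //; [exact: sqint_kQ|exact: kQN|] => t t0.
have d0 := den_neq0 e0 t.
have -> : kQ e t * t - 1 = - (e * kP e t).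
  by rewrite /kQ /kP; move: d0; rewrite /den => d0; field; rewrite d0.
by rewrite normrN mul1r ger0_norm// mulr_ge0 ?kP_ge0// ltW.
Qed.

(** Truncated kernel of the principal value, with the strict inequality of [pv_integral]. *)
Definition inv_cut e t := if e < `|t| then t^-1 else 0.

Lemma inv_cutN e t : inv_cut e (- t) = - inv_cut e t.
Proof. by rewrite /inv_cut normrN invrN; case: ifP => //; rewrite oppr0. Qed.

Lemma sqint_inv_cut e : 0 < e -> sqint setT (inv_cut e).
Proof.
move=> e0; have sQ := sqintZ 2 measurableT (sqint_kQ e0).
apply: (sqint_le _ _ sQ) => //.
  apply: measurable_fun_ifT => //; last exact: measurable_inv.
  by apply: measurable_fun_ltr => //; exact: measurableT_comp.
move=> t _; rewrite /inv_cut; case: ifPn => [et|_]; last by rewrite normr0.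
have t0 : 0 < `|t| by apply: lt_trans et.
rewrite normfV normrM /kQ normrM normfV (gtr0_norm (den_gt0 e0 t)) gtr0_norm//.
rewrite mulrA ler_pdivlMr ?den_gt0// mulrC ler_pdivrMr// /den -(real_normK (num_real t)).
have := ltW et; have := ltW e0; nra.
Qed.

Lemma convol_inv_cut_approx e C f x : 0 < e -> lip C f -> sqint setT f ->
  `|convol f (inv_cut e) x - hil f x| <= 2 * C * pi * e.
Proof.
move=> e0 lf fi.
apply: convol_odd_approx => //; [exact: sqint_inv_cut|exact: inv_cutN|] => t t0.
have ekP : 0 <= 2 * (e * kP e t) by rewrite mulr_ge0// mulr_ge0 ?kP_ge0// ltW.
rewrite /inv_cut; case: ifPn => [et|]; first by rewrite mulVf// subrr normr0.
(* For |t| <= e one has e kP >= 1/2, whence c = 2. *)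
rewrite -leNgt => te; rewrite mul0r sub0r normrN normr1.
rewrite /kP mulrA mulrA ler_pdivlMr ?den_gt0// mul1r /den -(real_normK (num_real t)).
have := normr_ge0 t; nra.
Qed.

(** Height d^2 and splitting radius d make both errors linear in d: for |t| <= d the Lipschitz bound
    costs C d, and beyond it the kernel of height d^2 is at most 2 d times the kernel of height d,
    whose mass is again pi. *)
Lemma convol_kP_approx d C B f x : 0 < d -> lip C f -> sqint setT f ->
  (forall y, `|f y| <= B) ->
  `|convol f (kP (d * d)) x - pi * f x| <= (C + 4 * B) * pi * d.
Proof.
move=> d0 lf fi fB; have C0 := lip_ge0 lf.
have B0 : 0 <= B by apply: le_trans (fB 0).
have e0 : 0 < d * d by rewrite mulr_gt0.
have sP := sqint_kP e0; have iP := integ_kP e0; have iPd := integ_kP d0.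
have sf := sqint_reflect x fi.
have -> : pi * f x = \int[mu]_t (f x * kP (d * d) t) by rewrite RintZ// int_kP// mulrC.
rewrite convolC// /convol -RintB//; last 2 first.
- exact: sqintM.
- exact: integZ.
have i : integ setT (fun t => kP (d * d) t * f (x - t) - f x * kP (d * d) t).
  by apply: integB => //; [exact: sqintM|exact: integZ].
have j : integ setT (fun t => C * d * kP (d * d) t + 4 * B * d * kP d t).
  by apply: integD => //; exact: integZ.
apply: (le_trans (le_norm_intr _ i)) => //.
apply: (@le_trans _ _ (\int[mu]_t (C * d * kP (d * d) t + 4 * B * d * kP d t))); last first.
  rewrite RintD; [|exact: measurableT|exact: (integZ _ measurableT iP)|exact: (integZ _ measurableT iPd)].
  rewrite (RintZ _ measurableT iP) (RintZ _ measurableT iPd).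
  rewrite !int_kP//.
  by rewrite le_eqVlt; apply/orP; left; apply/eqP; ring.
apply: le_intr => //; first exact: integ_norm.
move=> t _.
have -> : kP (d * d) t * f (x - t) - f x * kP (d * d) t = kP (d * d) t * (f (x - t) - f x).
  by ring.
rewrite normrM ger0_norm ?kP_ge0//.
have p1 := kP_ge0 d0 t; have p2 := kP_ge0 e0 t; have d0' := ltW d0.
have [td|td] := leP `|t| d.
  apply: (@le_trans _ _ (C * d * kP (d * d) t)); last first.
    by rewrite lerDl; do 3 apply: mulr_ge0 => //.
  rewrite mulrC ler_wpM2r ?kP_ge0//; apply: (le_trans (lf _ _)).
  by rewrite addrAC subrr sub0r normrN ler_wpM2l.
apply: (@le_trans _ _ (4 * B * d * kP d t)); last first.
  by rewrite lerDr; do 2 apply: mulr_ge0 => //.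
apply: (@le_trans _ _ (kP (d * d) t * (2 * B))).
  rewrite ler_wpM2l ?kP_ge0//; apply: (le_trans (ler_normB _ _)).
  by rewrite mulr_natl mulr2n lerD.
have t2 : d ^+ 2 < t ^+ 2.
  by rewrite -(real_normK (num_real t)) ltrXn2r ?nnegrE ?ltW.
have t20 : 0 < t ^+ 2 by apply: lt_trans t2; rewrite exprn_gt0.
have -> : 4 * B * d * kP d t = (2 * (d * kP d t)) * (2 * B) by ring.
rewrite ler_wpM2r ?mulr_ge0//.
have -> : 2 * (d * kP d t) = 2 * (d * d) / den d t by rewrite /kP; ring.
rewrite /kP ler_pdivlMr ?den_gt0// mulrAC ler_pdivrMr ?den_gt0//.
have : 0 <= d * d * (t ^+ 2 - d ^+ 2) by rewrite mulr_ge0 ?ltW// subr_gt0.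
rewrite /den; have := mulr_ge0 (ltW e0) (sqr_ge0 (d * d)).
nra.
Qed.

(** The bounds for [kQ] at heights [n.+1%:R^-1] pass to the pointwise limit by Fatou's lemma. *)
Lemma hil_bound C f : lip C f -> sqint setT f ->
  sqint setT (hil f) /\ nrm setT (hil f) <= pi * nrm setT f.
Proof.
move=> lf fi; have C0 := lip_ge0 lf.
have e0 n : (0 : R) < n.+1%:R^-1 by rewrite invr_gt0.
apply: (@sqint_fatou _ _ (fun n => convol f (kQ n.+1%:R^-1))) => //.
- by move=> n; exact: (convol_kQ_bound (e0 n) fi).1.
- by move=> n; exact: (convol_kQ_bound (e0 n) fi).2.
have K0 : 0 < C * pi + 1 by rewrite ltr_wpDl// mulr_ge0// pi_ge0.
move=> x _; apply/cvgrPdist_le => eps eps0; near=> n.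
rewrite distrC; apply: (le_trans (convol_kQ_approx x (e0 n) lf fi)).
apply: (@le_trans _ _ ((C * pi + 1) * n.+1%:R^-1)).
  by rewrite ler_wpM2r ?invr_ge0// lerDl.
rewrite mulrC -ler_pdivlMr//.
near: n; have := @cvg_harmonic R => /cvgrPdist_le /(_ (eps / (C * pi + 1)) (divr_gt0 eps0 K0)).
by apply: filterS => n /=; rewrite sub0r normrN ger0_norm// invr_ge0.
Unshelve. all: by end_near. Qed.

End LipschitzL2.

(** * One-sided Cotlar inequality on the line *)

Section CotlarInequality.
Context {R : realType}.
Implicit Types (f g h : R -> R) (s t x C B e : R).

Lemma nrm_sqrM (D : set R) f : nrm D f ^+ 2 = \int[mu]_(x in D) (f x * f x).
Proof. by rewrite nrm_sqr; apply: eq_intr => x _; rewrite expr2. Qed.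

Lemma le_sqr (a b : R) : 0 <= a -> a <= b -> a ^+ 2 <= b ^+ 2.
Proof. by move=> a0 ab; rewrite lerXn2r// nnegrE// (le_trans a0). Qed.

Lemma le_norm_mul (a b c d eta : R) : `|a| <= eta -> b * a <= eta * `|b|.
Proof.
move=> h; apply: (le_trans (ler_norm _)); rewrite normrM mulrC.
by rewrite ler_wpM2r.
Qed.

(** One threshold serves both kernels: the error of [kQ] is linear in d^2, hence in d once d <=
    1. *)
Lemma hil_approx f C B eta : lip C f -> sqint setT f -> (forall x, `|f x| <= B) ->
  0 < eta -> exists2 d0, 0 < d0 & forall d, 0 < d -> d <= d0 -> forall x,
    `|convol f (kP (d * d)) x - pi * f x| <= eta /\
    `|convol f (kQ (d * d)) x - hil f x| <= eta.
Proof.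
move=> lf fi fB eta0; have C0 := lip_ge0 lf.
have B0 : 0 <= B by apply: le_trans (fB 0).
have K0 : 0 < (C + 4 * B) * pi + 1.
  by rewrite ltr_wpDl// mulr_ge0 ?pi_ge0// addr_ge0// mulr_ge0.
exists (Num.min 1 (eta / ((C + 4 * B) * pi + 1))).
  by rewrite lt_min ltr01 divr_gt0.
move=> d d0; rewrite le_min => /andP[d1 dK] x.
have dd0 : 0 < d * d by rewrite mulr_gt0.
have dK' : ((C + 4 * B) * pi + 1) * d <= eta by rewrite mulrC -ler_pdivlMr.
split.
  apply: (le_trans (convol_kP_approx x d0 lf fi fB)); apply: le_trans dK'.
  by rewrite ler_wpM2r ?(ltW d0)// lerDl.
apply: (le_trans (convol_kQ_approx x dd0 lf fi)); apply: le_trans dK'.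
apply: (@le_trans _ _ (C * pi * d)).
  by rewrite ler_wpM2l ?mulr_ge0 ?pi_ge0// ger_pMr.
rewrite ler_wpM2r ?(ltW d0)//; apply: (@le_trans _ _ ((C + 4 * B) * pi)).
  by rewrite ler_wpM2r ?pi_ge0// lerDl mulr_ge0.
by rewrite lerDl.
Qed.

(** Let u, v be the transforms of f by [kP] and [kQ] at height e, and A, b those of g. Then
    [triple_transform] reads int u v A + int b u^2 = (1/2) int b (u^2 + v^2). Since u, A, b tend to
    pi f, pi g and [hil g], the left side tends to pi^2 times the wanted one. On the right b <= M +
    eta, and M >= 0 allows the norms of u and v to be replaced by their bound pi |f|. *)
Lemma cotlar_upper f g C B C' B' M : lip C f -> sqint setT f ->
  (forall x, `|f x| <= B) -> lip C' g -> sqint setT g ->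
  (forall x, `|g x| <= B') -> 0 <= M -> (forall x, hil g x <= M) ->
  \int[mu]_x (f x * hil f x * g x) + \int[mu]_x (hil g x * f x ^+ 2)
    <= M * nrm setT f ^+ 2.
Proof.
move=> lf fi fB lg gi gB M0 gM.
have [sw wle] := hil_bound lf fi; have [swg wgle] := hil_bound lg gi.
set nf := nrm setT f; set ng := nrm setT g.
have nf0 : 0 <= nf by exact: nrm_ge0.
have ng0 : 0 <= ng by exact: nrm_ge0.
have pi0 : (0 : R) <= pi by exact: pi_ge0.
have mT : measurable [set: R] by exact: measurableT.
have j1 : integ setT (fun x => f x * hil f x * g x).
  by apply: sqintM => //; apply: (sqint_bdM _ fi.1 (fun x _ => fB x) sw).
have j2 : integ setT (fun x => hil g x * f x ^+ 2).
  apply: (@eq_integ _ _ (fun x => f x * hil g x * f x)) => //.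
    by move=> x _; ring.
  by apply: sqintM => //; apply: (sqint_bdM _ fi.1 (fun x _ => fB x) swg).
suff H : forall eta, 0 < eta -> pi ^+ 2 * (\int[mu]_x (f x * hil f x * g x) +
    \int[mu]_x (hil g x * f x ^+ 2)) <= pi ^+ 2 * (M * nf ^+ 2) +
    eta * (pi ^+ 2 * (3 * nf ^+ 2 + 4 * ng * nf)).
  have p2 : (0 : R) < pi ^+ 2 by rewrite exprn_gt0// pi_gt0.
  rewrite -(ler_pM2l p2); apply/ler_addgt0Pr => eps eps0.
  have K0 : 0 < pi ^+ 2 * (3 * nf ^+ 2 + 4 * ng * nf) + 1.
    rewrite ltr_wpDl// mulr_ge0 ?sqr_ge0// addr_ge0//; last by do 2 apply: mulr_ge0 => //.
    by rewrite mulr_ge0 ?sqr_ge0.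
  have := H _ (divr_gt0 eps0 K0) => {H}/le_trans; apply.
  rewrite lerD2l mulrAC ler_pdivrMr// ler_wpM2l ?(ltW eps0)//.
  by rewrite lerDl.
move=> eta eta0.
have [d1 d10 Hf] := hil_approx lf fi fB eta0.
have [d2 d20 Hg] := hil_approx lg gi gB eta0.
pose d := Num.min d1 d2.
have d0 : 0 < d by rewrite lt_min d10.
have dd1 : d <= d1 by rewrite /d ge_min lexx.
have dd2 : d <= d2 by rewrite /d ge_min lexx orbT.
have {}Hf := Hf d d0 dd1; have {}Hg := Hg d d0 dd2.
have e0 : 0 < d * d by rewrite mulr_gt0.
move: e0 Hf Hg; move: (d * d) => e e0 Hf Hg {d1 d2 d10 d20 d d0 dd1 dd2}.
have [su ule] := convol_kP_bound e0 fi.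
have [sv vle] := convol_kQ_bound e0 fi.
have [sA Ale] := convol_kP_bound e0 gi.
have [sB Ble] := convol_kQ_bound e0 gi.
have [t1 t2 /eqP T] := triple_transform e0 fi gi.
have bB x := convol_bd x gi (sqint_kQ e0).
set u := convol f (kP e) in su ule t1 t2 T Hf *.
set v := convol f (kQ e) in sv vle t1 t2 T Hf *.
set A := convol g (kP e) in sA Ale t2 T Hg *.
set b := convol g (kQ e) in sB Ble t1 T Hg bB *.
rewrite -/nf in wle ule vle; rewrite -/ng in wgle Ale Ble.
have k1 : integ setT (fun x => b x * u x * u x).
  by apply: sqintM => //; apply: (sqint_bdM _ sB.1 (fun x _ => bB x) su).
have k2 : integ setT (fun x => b x * v x * v x).
  by apply: sqintM => //; apply: (sqint_bdM _ sB.1 (fun x _ => bB x) sv).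
have abs_int f1 f2 : sqint setT f1 -> sqint setT f2 -> integ setT (fun x => `|f1 x * f2 x|).
  by move=> s1 s2; apply: integ_norm => //; exact: sqintM.
(* Weights of the errors when A, u, v are replaced in turn by their limits in u v A, and likewise b,
   u, u in b u^2; their integral is bounded independently of e. *)
pose E x := `|u x * v x| + pi * `|g x * v x| + pi ^+ 2 * `|g x * f x| +
  `|u x * u x| + `|hil g x * u x| + pi * `|hil g x * f x|.
have e1 := abs_int _ _ su sv. have e2 := abs_int _ _ gi sv.
have e3 := abs_int _ _ gi fi. have e4 := abs_int _ _ su su.
have e5 := abs_int _ _ swg su. have e6 := abs_int _ _ swg fi.
have iE : integ setT E.
  by do ?[apply: integD => //|apply: integZ => //].
have bd (a a' c c' : R) : 0 <= a -> 0 <= c -> a <= a' -> c <= c' -> a * c <= a' * c'.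
  by move=> *; apply: ler_pM.
have E_le : \int[mu]_x E x <= pi ^+ 2 * (2 * nf ^+ 2 + 4 * ng * nf).
  rewrite /E !RintD ?RintZ//; do ?[apply: integD => //|apply: integZ => //].
  have q1 := le_trans (cauchy_schwarz_abs mT su sv) (bd _ _ _ _ (nrm_ge0 _ _) (nrm_ge0 _ _) ule vle).
  have q2 := le_trans (cauchy_schwarz_abs mT gi sv) (bd _ _ _ _ (nrm_ge0 _ _) (nrm_ge0 _ _) (lexx _) vle).
  have q3 := cauchy_schwarz_abs mT gi fi.
  have q4 := le_trans (cauchy_schwarz_abs mT su su) (bd _ _ _ _ (nrm_ge0 _ _) (nrm_ge0 _ _) ule ule).
  have q5 := le_trans (cauchy_schwarz_abs mT swg su) (bd _ _ _ _ (nrm_ge0 _ _) (nrm_ge0 _ _) wgle ule).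
  have q6 := le_trans (cauchy_schwarz_abs mT swg fi) (bd _ _ _ _ (nrm_ge0 _ _) (nrm_ge0 _ _) wgle (lexx _)).
  have q2' := ler_wpM2l pi0 q2. have q3' := ler_wpM2l (sqr_ge0 pi) q3.
  have q6' := ler_wpM2l pi0 q6.
  rewrite -/nf -/ng in q2' q3' q6'.
  apply: (le_trans (lerD (lerD (lerD (lerD (lerD q1 q2') q3') q4) q5) q6')).
  by rewrite le_eqVlt; apply/orP; left; apply/eqP; ring.
have i2 : integ setT (fun x => u x * v x * A x + b x * u x * u x) by exact: integD.
have L1 : pi ^+ 2 * (\int[mu]_x (f x * hil f x * g x) + \int[mu]_x (hil g x * f x ^+ 2)) <=
    \int[mu]_x (u x * v x * A x + b x * u x * u x) + eta * \int[mu]_x E x.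
  rewrite -RintD// -RintZ//; last exact: integD.
  rewrite -RintZ// -RintD//; last exact: integZ.
  apply: le_intr => //; [by apply: integZ => //; exact: integD|by apply: integD => //; exact: integZ|].
  move=> x _; have [h1 h2] := Hf x; have [h3 h4] := Hg x.
  have r1 : (- (u x * v x)) * (A x - pi * g x) <= eta * `|u x * v x|.
    by rewrite -[`|u x * v x|]normrN; exact: le_norm_mul.
  have r2 : (- (pi * (g x * v x))) * (u x - pi * f x) <= eta * (pi * `|g x * v x|).
    rewrite -[pi * `|_|]ger0_norm ?mulr_ge0// normrM normr_id -normrM -[X in _ <= _ * X]normrN.
    exact: le_norm_mul.
  have r3 : (- (pi ^+ 2 * (g x * f x))) * (v x - hil f x) <= eta * (pi ^+ 2 * `|g x * f x|).
    rewrite -[pi ^+ 2 * `|_|]ger0_norm ?mulr_ge0 ?sqr_ge0// normrM normr_id -normrM -[X in _ <= _ * X]normrN.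
    exact: le_norm_mul.
  have r4 : (- (u x * u x)) * (b x - hil g x) <= eta * `|u x * u x|.
    by rewrite -[`|u x * u x|]normrN; exact: le_norm_mul.
  have r5 : (- (hil g x * u x)) * (u x - pi * f x) <= eta * `|hil g x * u x|.
    by rewrite -[`|hil g x * u x|]normrN; exact: le_norm_mul.
  have r6 : (- (pi * (hil g x * f x))) * (u x - pi * f x) <= eta * (pi * `|hil g x * f x|).
    rewrite -[pi * `|_|]ger0_norm ?mulr_ge0// normrM normr_id -normrM -[X in _ <= _ * X]normrN.
    exact: le_norm_mul.
  have := lerD (lerD (lerD (lerD (lerD r1 r2) r3) r4) r5) r6.
  rewrite -!mulrDr -/(E x) => r; rewrite -lerBlDl.
  apply: le_trans r; rewrite le_eqVlt; apply/orP; left; apply/eqP; ring.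
apply: (le_trans L1).
have u2 : nrm setT u ^+ 2 <= (pi * nf) ^+ 2.
  exact: (le_sqr (nrm_ge0 _ _) ule).
have v2 : nrm setT v ^+ 2 <= (pi * nf) ^+ 2.
  exact: (le_sqr (nrm_ge0 _ _) vle).
have L2 : \int[mu]_x (u x * v x * A x + b x * u x * u x) <= (M + eta) * (pi ^+ 2 * nf ^+ 2).
  rewrite RintD//.
  have /eqP T2 : \int[mu]_x (b x * u x * u x + b x * v x * v x) =
     2 * (\int[mu]_x (u x * v x * A x) + \int[mu]_x (b x * u x * u x)).
    rewrite mulrDr -(eqP T) -RintZ// -RintD//; last exact: integZ.
    by apply: eq_intr => x _; ring.
  have : \int[mu]_x (b x * u x * u x + b x * v x * v x) <=
      (M + eta) * (nrm setT u ^+ 2 + nrm setT v ^+ 2).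
    have iu := sqintM mT su su; have iv := sqintM mT sv sv.
    have iuv := integD mT iu iv.
    have -> : nrm setT u ^+ 2 + nrm setT v ^+ 2 = \int[mu]_x (u x * u x + v x * v x).
      by rewrite (RintD mT iu iv) -(nrm_sqrM setT u) -(nrm_sqrM setT v).
    rewrite -(RintZ _ mT iuv).
    apply: (le_intr mT (integD mT k1 k2) (integZ _ mT iuv)).
    move=> x _; have [_ h4] := Hg x.
    have bM : b x <= M + eta.
      rewrite -(subrK (hil g x) (b x)) addrC; apply: lerD (gM x) _.
      exact: le_trans (ler_norm _) h4.
    rewrite -!mulrA -mulrDr ler_wpM2r// addr_ge0// -expr2 sqr_ge0//.
  rewrite (eqP T2) => h.
  have : (M + eta) * (nrm setT u ^+ 2 + nrm setT v ^+ 2) <= (M + eta) * (2 * (pi ^+ 2 * nf ^+ 2)).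
    apply: (ler_wpM2l (addr_ge0 M0 (ltW eta0))).
    have -> : 2 * (pi ^+ 2 * nf ^+ 2) = (pi * nf) ^+ 2 + (pi * nf) ^+ 2 by ring.
    exact: (lerD u2 v2).
  by move=> /(le_trans h); rewrite mulrCA ler_pM2l.
apply: (le_trans (lerD L2 (ler_wpM2l (ltW eta0) E_le))).
by rewrite le_eqVlt; apply/orP; left; apply/eqP; ring.
Qed.

End CotlarInequality.

(** * Principal values *)

Section PrincipalValues.
Context {R : realType}.
Implicit Types (f g h phi : R -> R) (s t x y C B e : R).

Lemma lim_linear_error (J : R -> R) (l K r : R) : 0 < r ->
  (forall e, 0 < e -> e < r -> `|J e - l| <= K * e) ->
  J e @[e --> 0^'+] --> l.
Proof.
move=> r0 H; apply/cvgrPdist_le => eps eps0.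
have K0 : 0 < `|K| + 1 by rewrite ltr_wpDl.
near=> e.
have e0 : 0 < e by [].
have er : e < r by near: e; exact: nbhs_right_lt.
rewrite distrC; apply: (le_trans (H e e0 er)).
apply: (@le_trans _ _ ((`|K| + 1) * e)).
  by rewrite ler_wpM2r ?(ltW e0)// (le_trans (ler_norm _))// lerDl.
rewrite mulrC -ler_pdivlMr//; near: e; apply: nbhs_right_le.
by rewrite divr_gt0.
Unshelve. all: by end_near. Qed.

Lemma restrict_intr (D : set R) (F G : R -> R) :
  (forall t, (F \_ D) t = G t) -> \int[mu]_(t in D) F t = \int[mu]_t G t.
Proof. by move=> FG; rewrite Rintegral_mkcond; apply: eq_intr => t _; exact: FG. Qed.

(** The truncated integral is the convolution with [inv_cut e], at linear distance from [hil f];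
    this convergence is what gives [lim] its intended value. *)
Lemma hilbertE f C x : lip C f -> sqint setT f ->
  hilbert f x = pi^-1 * hil f x.
Proof.
move=> lf fi; rewrite /hilbert; congr (_ * _).
apply: cvg_lim => //; apply: (@lim_linear_error _ _ (2 * C * pi) 1) => // e e0 _.
rewrite (@restrict_intr _ _ (fun t => f t * inv_cut e (x - t))); last first.
  move=> t; rewrite patchE /inv_cut.
  have -> : (t \in ([set: R] `&` [set t | (e < `|x - t|)%R])%classic) = (e < `|x - t|).
    by apply/idP/idP => [/set_mem[]|h]//; exact/mem_set.
  by case: ifP => //; rewrite mulr0.
exact: convol_inv_cut_approx.
Qed.

(** Folding by oddness turns the integral over t < 0 into the term 1/(y + t). The cut |y - t| > e
    acts on both terms of the half-line kernel, so the folded integral lacks the window |y + t| <= e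
    of the line, where the integrand is at most B/y. *)
Lemma hilbert_oddE phi f C B y : lip C f -> sqint setT f -> (forall x, `|f x| <= B) ->
  (forall x, f (- x) = - f x) -> (forall x, 0 < x -> f x = phi x) -> 0 < y ->
  hilbert_odd phi y = pi^-1 * hil f y.
Proof.
move=> lf fi fB fN fphi y0; rewrite /hilbert_odd; congr (_ * _).
have B0 : 0 <= B by apply: le_trans (fB 0).
have mT : measurable [set: R] by exact: measurableT.
apply: cvg_lim => //.
apply: (@lim_linear_error _ _ (2 * C * pi + 2 * (B / y) * pi) y) => // e e0 ey.
pose pos t : R := (0 < t)%R%:R.
pose far t : R := (e < `|y - t|)%R%:R.
have mpos : measurable_fun [set: R] pos.
  have -> : pos = (fun t => if 0 < t then 1 else 0).
    by apply/funext => t; rewrite /pos; case: (0 < t).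
  by apply: measurable_fun_ifT => //; exact: measurable_fun_ltr.
have mfar : measurable_fun [set: R] far.
  have -> : far = (fun t => if e < `|y - t| then 1 else 0).
    by apply/funext => t; rewrite /far; case: (e < _).
  apply: measurable_fun_ifT => //; apply: measurable_fun_ltr => //.
  by apply: measurableT_comp => //; exact: measurable_funB.
pose a t := pos t * (f t * inv_cut e (y - t)).
(* For t > 0 the cut at y is inactive; it makes the kernel 1/(y + t) square-integrable on the
   line. *)
pose b t := (pos t * far t) * (f t * inv_cut y (y + t)).
have ce := sqint_inv_cut e0; have cy := sqint_inv_cut y0.
have fc : integ setT (fun t => f t * inv_cut e (y - t)).
  by apply: sqintM => //; exact: sqint_reflect.
have cy' : sqint setT (fun t => inv_cut y (y + t)).
  have := sqint_shift (- y) cy.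
  by apply: eq_sqint => // t _; rewrite opprK addrC.
have ia : integ setT a.
  by apply: (@integ_bdM _ _ _ _ 1) => // t _; rewrite /pos normr_nat; case: (0 < t).
have ib : integ setT b.
  apply: (@integ_bdM _ _ _ _ 1) => //; first exact: measurable_funM.
    by move=> t _; rewrite /pos /far normrM !normr_nat -natrM lern1; case: (0 < t); case: (_ < _).
  exact: sqintM.
rewrite (@restrict_intr _ _ (fun t => a t - b t)); last first.
  move=> t; rewrite patchE.
  have -> : (t \in ((`]0, +oo[%classic : set R) `&` [set t | (e < `|y - t|)%R])%classic) =
    (0 < t) && (e < `|y - t|).
    apply/idP/idP => [/set_mem[/=]|/andP[t0 h]].
      by rewrite in_itv/= andbT => -> ->.
    by apply/mem_set; split => //=; rewrite in_itv/= andbT.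
  rewrite /a /b /pos /far /inv_cut; have [t0|t0] := ltP 0 t; last by rewrite !mul0r subrr.
  rewrite /= !mul1r; case: ifPn => h; last by rewrite mulr0 mul0r subrr.
  by rewrite mul1r (gtr0_norm (addr_gt0 y0 t0)) ltrDl t0 fphi// mulrBr.
rewrite RintB// -(intr_preserving preserving_opp ib).
have ib' := integ_preserving preserving_opp ib.
rewrite -RintB//; set I := \int[mu]_t _.
have I1 : `|convol f (inv_cut e) y - I| <= 2 * (B / y) * pi * e.
  rewrite /convol /I -RintB//; last exact: integB.
  (* On the window |y + t| <= e one has 1 <= 2 e kP, so a Poisson kernel centred at -y dominates its
     indicator. *)
  have ie : integ setT (fun t => 2 * (B / y) * e * kP e (y + t)).
    apply: integZ => //.
    have := integ_preserving (preserving_shift y) (integ_kP e0).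
    by apply: eq_integ => // t _; rewrite addrC.
  have /eqP Ee : \int[mu]_t (2 * (B / y) * e * kP e (y + t)) = 2 * (B / y) * pi * e.
    have ik : integ setT (fun t => kP e (y + t)).
      have := integ_preserving (preserving_shift y) (integ_kP e0).
      by apply: eq_integ => // t _; rewrite addrC.
    rewrite RintZ//.
    have -> : \int[mu]_t kP e (y + t) = pi.
      rewrite -(int_kP e0) -(intr_preserving (preserving_shift y) (integ_kP e0)).
      by apply: eq_intr => t _; rewrite addrC.
    by ring.
  rewrite -(eqP Ee).
  have idf := integB mT fc (integB mT ia ib').
  apply: (le_trans (le_norm_intr mT idf)).
  apply: le_intr => //; first exact: integ_norm.
  move=> t _; rewrite /a /b /pos /far.
  have rhs0 : 0 <= 2 * (B / y) * e * kP e (y + t).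
    by rewrite mulr_ge0 ?kP_ge0// mulr_ge0 ?(ltW e0)// mulr_ge0// divr_ge0// ltW.
  rewrite oppr_gt0 opprK.
  move: rhs0; have [t0|t0|<-] := ltgtP 0 t => rhs0.
  - by rewrite mul1r !mul0r subr0 subrr normr0.
  - rewrite mul0r mul1r sub0r opprK fN.
    have yt : y < y - t by rewrite ltrDl oppr_gt0.
    have yt0 : 0 < y - t by apply: lt_trans yt.
    have -> : inv_cut e (y - t) = (y - t)^-1.
      by rewrite /inv_cut gtr0_norm// (lt_trans ey yt).
    have -> : inv_cut y (y - t) = (y - t)^-1 by rewrite /inv_cut gtr0_norm// yt.
    have [h|h] := ltP e `|y + t|.
      by rewrite mul1r mulNr subrr normr0.
    rewrite mul0r addr0 normrM.
    have -> : 2 * (B / y) * e * kP e (y + t) = B * (y^-1 * (2 * e * kP e (y + t))) by ring.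
    apply: ler_pM => //.
    rewrite -[leLHS]mulr1; apply: ler_pM => //.
      by rewrite normfV gtr0_norm// lef_pV2 ?posrE// ltW.
    rewrite /kP mulrA ler_pdivlMr ?den_gt0// mul1r /den -(real_normK (num_real (y + t))).
    have := normr_ge0 (y + t); nra.
  - have f0 : f 0 = 0.
      by have := fN 0; rewrite oppr0 => /eqP; rewrite -subr_eq0 opprK -mulr2n mulrn_eq0/= => /eqP.
    by rewrite oppr0 f0 !mul0r !subr0 normr0.
have I2 := convol_inv_cut_approx y e0 lf fi.
have -> : I - hil f y = (convol f (inv_cut e) y - hil f y) - (convol f (inv_cut e) y - I) by ring.
apply: (le_trans (ler_normB _ _)); rewrite mulrDl; exact: lerD.
Qed.

Lemma hil_odd_even f x : (forall x, f (- x) = - f x) -> hil f (- x) = hil f x.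
Proof.
move=> fN; rewrite /hil; congr (_ * _); apply: eq_intr => t _; rewrite /sdiff.
have -> : - x - t = - (x + t) by ring.
have -> : - x + t = - (x - t) by ring.
by rewrite !fN opprK addrC.
Qed.

End PrincipalValues.

(** * Odd extensions from the half-line *)

Section HalfLine.
Context {R : realType}.
Implicit Types (f g h u : R -> R) (s t x y d C B e : R).

Let D : set R := halfline R.

Lemma halflineE x : D x <-> 0 < x.
Proof. by rewrite /D /= in_itv/= andbT. Qed.

Lemma measurable_halfline : measurable (halfline R).
Proof. exact: measurable_itv. Qed.

Let mD : measurable D := measurable_halfline.

(** Used with c depending on the value of a function at x, to bound that value by an integral. *)
Lemma average_le h x d c : 0 < d -> integ setT h -> (forall t, 0 <= h t) ->
  (forall t, x <= t <= x + d -> c <= h t) -> d * c <= \int[mu]_t h t.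
Proof.
move=> d0 hi h0 ch.
have mI : measurable (`[x, x + d]%classic : set R) by exact: measurable_itv.
have iI : integ `[x, x + d] h by exact: integrableS hi.
have -> : d * c = \int[mu]_(t in `[x, x + d]) c.
  rewrite Rintegral_cst//= lebesgue_measure_itv/= lte_fin ltrDl d0 -EFinD/=.
  by rewrite mulrC; congr (_ * _); ring.
apply: (@le_trans _ _ (\int[mu]_(t in `[x, x + d]) h t)).
  apply: le_intr => //; first exact: integ_cst_itv.
rewrite [leLHS]Rintegral_mkcond; apply: le_intr => //; first exact: ((integ_restrict _ mI).1 iI).
by move=> t _; rewrite patchE; case: ifP.
Qed.

(** For t in [x, x + 1] one has f(x)^2 <= 2 f(t)^2 + 2 C^2; averaging over t bounds f(x). *)
Lemma lip_sqint_bounded f C : lip C f -> sqint setT f -> exists B, forall x, `|f x| <= B.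
Proof.
move=> lf fi; exists (Num.sqrt (\int[mu]_t (2 * f t ^+ 2) + 2 * C ^+ 2)) => x.
have i2 := integZ 2 measurableT fi.2.
rewrite -sqrtr_sqr ler_sqrt; last first.
  apply: addr_ge0; last by rewrite mulr_ge0// sqr_ge0.
  by apply: Rintegral_ge0 => t _; rewrite mulr_ge0// sqr_ge0.
rewrite -lerBlDr -[leLHS]mul1r; apply: (average_le (x := x)) => //.
  by move=> t; rewrite mulr_ge0// sqr_ge0.
move=> t /andP[xt tx]; rewrite lerBlDr.
have h1 : `|f x - f t| <= C.
  apply: (le_trans (lf x t)); rewrite -[leRHS]mulr1 ler_wpM2l ?(lip_ge0 lf)//.
  by rewrite distrC ger0_norm ?subr_ge0// lerBlDl.
have : `|f x - f t| ^+ 2 <= C ^+ 2 by apply: le_sqr.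
rewrite real_normK ?num_real//.
have := sqr_ge0 (f x - 2 * f t); nra.
Qed.

Definition zero_ext u x : R := (u \_ (halfline R)) x.

Definition odd_ext u x := zero_ext u x - zero_ext u (- x).

Lemma zero_extE u x : zero_ext u x = if 0 < x then u x else 0.
Proof.
rewrite /zero_ext patchE; congr (if _ then _ else _).
by apply/idP/idP => [/set_mem/halflineE|/halflineE/mem_set].
Qed.

Lemma odd_ext_pos u x : 0 < x -> odd_ext u x = u x.
Proof.
by move=> x0; rewrite /odd_ext !zero_extE x0 oppr_gt0 ltNge ltW// subr0.
Qed.

Lemma odd_extN u x : odd_ext u (- x) = - odd_ext u x.
Proof. by rewrite /odd_ext opprK opprB. Qed.

Lemma odd_ext0 u : odd_ext u 0 = 0.
Proof. by rewrite /odd_ext oppr0 subrr. Qed.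

Lemma sqint_zero_ext u : sqint D u -> sqint setT (zero_ext u).
Proof.
move=> [mu_ ui]; split; first exact: (measurable_restrictT _ mD).1.
have := (integ_restrict _ mD).1 ui; apply: eq_integ => // x _.
by rewrite /zero_ext !patchE; case: ifP => // _; rewrite expr0n.
Qed.

Lemma sqint_odd_ext u : sqint D u -> sqint setT (odd_ext u).
Proof.
move=> /sqint_zero_ext ui; apply: sqintB => //.
exact: (sqint_preserving preserving_opp ui).
Qed.

Lemma even_half h : integ setT h -> (forall x, h (- x) = h x) -> h 0 = 0 ->
  \int[mu]_x h x = 2 * \int[mu]_(x in D) h x.
Proof.
move=> hi hN h0.
have iD : integ D h by exact: integrableS hi.
have iz : integ setT (zero_ext h) := (integ_restrict _ mD).1 iD.
have iz' := integ_preserving preserving_opp iz.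
have -> : \int[mu]_(x in D) h x = \int[mu]_x zero_ext h x by rewrite Rintegral_mkcond.
rewrite mulr_natl mulr2n -{2}(intr_preserving preserving_opp iz) -RintD//.
apply: eq_intr => x _; rewrite !zero_extE oppr_gt0 hN.
by case: ltgtP => [||<-]; rewrite ?addr0 ?add0r.
Qed.

Lemma even_half_le h : integ setT h -> (forall x, h (- x) = h x) ->
  (forall x, 0 <= h x) -> 2 * \int[mu]_(x in D) h x <= \int[mu]_x h x.
Proof.
move=> hi hN h0.
have iD : integ D h by exact: integrableS hi.
have iz : integ setT (zero_ext h) := (integ_restrict _ mD).1 iD.
have iz' := integ_preserving preserving_opp iz.
have -> : \int[mu]_(x in D) h x = \int[mu]_x zero_ext h x by rewrite Rintegral_mkcond.
rewrite mulr_natl mulr2n -{2}(intr_preserving preserving_opp iz) -RintD//.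
apply: le_intr => //; first exact: integD.
move=> x _; rewrite !zero_extE oppr_gt0 hN.
by case: ltgtP => _; rewrite ?addr0 ?add0r.
Qed.

Lemma nrm_odd_ext u : sqint D u -> nrm setT (odd_ext u) ^+ 2 = 2 * nrm D u ^+ 2.
Proof.
move=> ui; rewrite !nrm_sqr even_half//.
- congr (_ * _); apply: eq_intr => x /halflineE x0; by rewrite odd_ext_pos.
- exact: (sqint_odd_ext ui).2.
- by move=> x; rewrite odd_extN sqrrN.
- by rewrite odd_ext0 expr0n.
Qed.

(** The limit 0 at the origin gives |u x| <= C x, and |x| + |y| = |x - y| for points on opposite
    sides of 0. *)
Lemma lip_odd_ext u C : (forall x y, 0 < x -> 0 < y -> `|u x - u y| <= C * `|x - y|) ->
  (`|u y| @[y --> 0^'+] --> (0 : R)) -> lip C (odd_ext u).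
Proof.
move=> lu u0.
have C0 : 0 <= C.
  have := le_trans (normr_ge0 _) (lu 2 1 (ltr0Sn _ _) ltr01).
  by rewrite (_ : 2 - 1 = 1 :> R) ?normr1 ?mulr1//; lra.
have ux x : 0 < x -> `|u x| <= C * x.
  move=> x0; apply/ler_addgt0Pr => eps eps0.
  have [y [y0 yx uy]] : exists y, [/\ 0 < y, y < x & `|u y| <= eps].
    move/cvgrPdist_le : u0 => /(_ eps eps0) H.
    near (0 : R)^'+ => y; exists y; split.
    - by near: y; exact: nbhs_right_gt.
    - by near: y; exact: nbhs_right_lt.
    suff : `|0 - `|u y| | <= eps by rewrite sub0r normrN normr_id.
    by near: y.
  have := lu x y x0 y0; rewrite (@ger0_norm _ (x - y)) => [h|]; last by rewrite subr_ge0 ltW.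
  have := ler_normD (u x - u y) (u y); rewrite subrK => /le_trans; apply.
  rewrite lerD// (le_trans h)// ler_wpM2l// lerBlDr lerDl ltW//.
have odd_le x : `|odd_ext u x| <= C * `|x|.
  have [x0|x0|<-] := ltgtP 0 x.
  - by rewrite odd_ext_pos// [`|x|]gtr0_norm// ux.
  - have nx0 : 0 < - x by rewrite oppr_gt0.
    by rewrite -normrN -odd_extN odd_ext_pos// [`|x|]ltr0_norm// ux.
  - by rewrite odd_ext0 normr0 mulr0.
have pp x y : 0 < x -> `|odd_ext u x - odd_ext u y| <= C * `|x - y|.
  move=> x0; have [y0|y0] := ltP 0 y; first by rewrite !odd_ext_pos// lu.
  apply: (le_trans (ler_normB _ _)).
  apply: (le_trans (lerD (odd_le x) (odd_le y))); rewrite -mulrDr ler_wpM2l//.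
  by rewrite gtr0_norm// ler0_norm// ger0_norm// subr_ge0 (le_trans y0)// ltW.
move=> x y; have [x0|x0|<-] := ltgtP 0 x; first exact: pp.
  have nx0 : 0 < - x by rewrite oppr_gt0.
  have := pp (- x) (- y) nx0; rewrite !odd_extN -!opprD !normrN.
  by [].
by rewrite odd_ext0 !sub0r !normrN.
Unshelve. all: by end_near. Qed.

Lemma nrm_subset (E F : set R) h : measurable E -> measurable F -> E `<=` F ->
  sqint F h -> nrm E h <= nrm F h.
Proof.
move=> mE mF EF hi.
rewrite /nrm ler_sqrt; last by apply: Rintegral_ge0 => z _; exact: sqr_ge0.
rewrite Rintegral_mkcond [leRHS]Rintegral_mkcond.
apply: le_intr => //.
- exact: ((integ_restrict _ mE).1 (sqintS mF mE EF hi).2).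
- exact: ((integ_restrict _ mF).1 hi.2).
move=> z _; rewrite !patchE; case: ifPn => [/set_mem/EF/mem_set -> //|_].
by case: ifP => // _; exact: sqr_ge0.
Qed.

(** Cauchy-Schwarz against 1 on the half-open interval, which lies in the open half-line even for x
    = 0. *)
Lemma primitive_holder g x y : sqint D g -> 0 <= x <= y ->
  `|\int[mu]_(t in `[x, y]) g t| <= nrm D g * Num.sqrt (y - x).
Proof.
move=> gi /andP[x0 xy].
have mI : measurable (`]x, y]%classic : set R) by exact: measurable_itv.
have ID : `]x, y]%classic `<=` D.
  by move=> z; rewrite /= in_itv/= => /andP[xz _]; apply/halflineE; exact: le_lt_trans xz.
have si := sqintS mD mI ID gi.
have s1 : sqint `]x, y] (fun=> 1 : R).
  apply: (sqintS _ _ _ (sqint_cst_itv x y 1)) => //.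
  exact: subset_itv_oc_cc.
have gi1 : integ `]x, y] g.
  by apply: eq_integ (sqintM mI si s1) => // t _; rewrite mulr1.
rewrite -Rintegral_itv_obnd_cbnd//.
have := cauchy_schwarz mI si s1.
have -> : \int[mu]_(z in `]x, y]) (g z * 1) = \int[mu]_(z in `]x, y]) g z.
  by apply: eq_intr => z _; rewrite mulr1.
move=> /le_trans; apply; apply: ler_pM; [exact: nrm_ge0|exact: nrm_ge0| |].
  exact: nrm_subset.
rewrite /nrm.
have -> // : \int[mu]_(z in `]x, y]) (1 ^+ 2 : R) = y - x.
under eq_Rintegral do rewrite expr1n.
rewrite Rintegral_cst//= lebesgue_measure_itv/= lte_fin.
case: ltP => [_|h]; first by rewrite mul1r.
by rewrite mulr0; apply/eqP; rewrite eq_sym subr_eq0 eq_le h xy.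
Qed.

Lemma holder_continuous h G : (forall x y, 0 < x -> x <= y ->
  `|h y - h x| <= G * Num.sqrt (y - x)) -> forall y, 0 < y -> {for y, continuous h}.
Proof.
move=> hh y y0; apply/cvgrPdist_le => eps eps0.
pose r := (eps / (`|G| + 1)) ^+ 2.
have G1 : 0 < `|G| + 1 by rewrite ltr_wpDl.
have r0 : 0 < r by rewrite exprn_gt0// divr_gt0.
have bound d : 0 <= d -> d <= r -> G * Num.sqrt d <= eps.
  move=> d0 dr.
  apply: (@le_trans _ _ ((`|G| + 1) * Num.sqrt d)).
    by rewrite ler_wpM2r ?sqrtr_ge0// (le_trans (ler_norm _))// lerDl.
  rewrite mulrC -ler_pdivlMr//.
  apply: (@le_trans _ _ (Num.sqrt r)); first by rewrite ler_sqrt// ltW.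
  by rewrite /r sqrtr_sqr ger0_norm// ltW// divr_gt0.
near=> z.
have z0 : 0 < z by near: z; exact: lt_nbhsr.
have zr : `|y - z| <= r by near: z; apply: cvgr_dist_le; first exact: cvg_id.
have [zy|yz] := leP z y.
  apply: (le_trans (hh z y z0 zy)); apply: bound; first by rewrite subr_ge0.
  by rewrite -(ger0_norm (_ : 0 <= y - z))// subr_ge0.
rewrite distrC; apply: (le_trans (hh y z y0 (ltW yz))); apply: bound.
  by rewrite subr_ge0 ltW.
by rewrite -(ger0_norm (_ : 0 <= z - y)) 1?distrC// subr_ge0 ltW.
Unshelve. all: by end_near. Qed.

Lemma second_derivative_holder u g x y : sqint D g -> second_derivative u g ->
  0 < x -> x <= y ->
  `|derive1 u y - derive1 u x| <= nrm D g * Num.sqrt (y - x).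
Proof.
by move=> gi [_ d2] x0 xy; rewrite d2//; apply: primitive_holder => //; rewrite ltW.
Qed.

(** An interpolation inequality: for t in [x, x + 1] the mean value theorem gives xi in ]t, t + 1[
    with u'(xi) = u(t + 1) - u(t), and u' varies by at most 2 G between x and xi, whose distance is
    at most 2. Squaring and averaging over t bounds u'(x) by L^2 norms. *)
Lemma second_derivative_bounded u g : sqint D u -> sqint D g ->
  second_derivative u g -> exists C, forall x, 0 < x -> `|derive1 u x| <= C.
Proof.
move=> ui gi ug; have du := ug.1.
have key (p q r : R) : (2 * r + q + p) ^+ 2 <= 3 * p ^+ 2 + 3 * q ^+ 2 + 12 * r ^+ 2.
  have := sqr_ge0 (p - q); have := sqr_ge0 (p - 2 * r); have := sqr_ge0 (q - 2 * r).
  nra.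
set G := nrm D g.
have zi := sqint_zero_ext ui.
have iz := integZ 3 measurableT zi.2.
have iz' := integ_preserving (preserving_shift 1) iz.
exists (Num.sqrt (\int[mu]_t (3 * zero_ext u t ^+ 2 + 3 * zero_ext u (t + 1) ^+ 2) +
    12 * G ^+ 2)) => x x0.
rewrite -sqrtr_sqr ler_sqrt; last first.
  apply: addr_ge0; last by rewrite mulr_ge0// sqr_ge0.
  by apply: Rintegral_ge0 => t _; rewrite addr_ge0// mulr_ge0// sqr_ge0.
rewrite -lerBlDr -[leLHS]mul1r; apply: (average_le (x := x)) => //.
- exact: integD.
- by move=> t; rewrite addr_ge0// mulr_ge0// sqr_ge0.
move=> t /andP[xt tx]; rewrite lerBlDr.
have t0 : 0 < t by apply: lt_le_trans xt.
have t1 : 0 < t + 1 by rewrite addr_gt0.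
rewrite !zero_extE t0 t1.
have [xi xiI E] : exists2 xi, xi \in `]t, (t + 1)[%R & u (t + 1) - u t = derive1 u xi * ((t + 1) - t).
  apply: (@MVT _ u (fun x => derive1 u x)); first by rewrite ltrDl.
    move=> z; rewrite in_itv/= => /andP[tz _].
    by rewrite derive1E; apply: derivableP; apply: du; exact: lt_trans tz.
  apply: derivable_within_continuous => z; rewrite in_itv/= => /andP[tz _].
  by apply: du; exact: lt_le_trans tz.
move: xiI; rewrite in_itv/= => /andP[txi xit].
have xxi : x <= xi by rewrite (le_trans xt)// ltW.
have h1 : `|derive1 u xi - derive1 u x| <= 2 * G.
  apply: (le_trans (second_derivative_holder gi ug x0 xxi)).
  rewrite mulrC ler_wpM2r ?nrm_ge0//.
  apply: (@le_trans _ _ (Num.sqrt (2 ^+ 2))); last by rewrite sqrtr_sqr ger0_norm.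
  by rewrite ler_sqrt ?sqr_ge0// expr2; clear -xit xt tx; lra.
have E2 : derive1 u xi = u (t + 1) - u t by rewrite E addrAC subrr add0r mulr1.
have h2 : `|derive1 u x| <= 2 * G + `|u (t + 1)| + `|u t|.
  have := ler_normB (derive1 u xi) (derive1 u xi - derive1 u x).
  rewrite opprB addrCA subrr addr0 E2 => /le_trans; apply.
  have := ler_normB (u (t + 1)) (u t); rewrite -E2; lra.
have := le_sqr (normr_ge0 _) h2.
rewrite real_normK ?num_real// => /le_trans; apply.
rewrite -[u t ^+ 2]real_normK ?num_real// -[u (t + 1) ^+ 2]real_normK ?num_real//.
Qed.

Lemma second_derivative_lip u g : sqint D u -> sqint D g ->
  second_derivative u g ->
  exists C, forall x y, 0 < x -> 0 < y -> `|u x - u y| <= C * `|x - y|.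
Proof.
move=> ui gi ug; have [C uC] := second_derivative_bounded ui gi ug.
exists C.
suff H x y : 0 < x -> x < y -> `|u y - u x| <= C * `|y - x|.
  move=> x y x0 y0; have [xy|xy|->] := ltgtP x y.
  - by rewrite distrC [`|x - y|]distrC H.
  - by rewrite H.
  - by rewrite !subrr normr0 mulr0.
move=> x0 xy.
have [xi] : exists2 xi, xi \in `]x, y[%R & u y - u x = derive1 u xi * (y - x).
  apply: (@MVT _ u (fun x => derive1 u x)) => //.
    move=> z; rewrite in_itv/= => /andP[tz _].
    by rewrite derive1E; apply: derivableP; apply: ug.1; exact: lt_trans tz.
  apply: derivable_within_continuous => z; rewrite in_itv/= => /andP[tz _].
  by apply: ug.1; exact: lt_le_trans tz.
rewrite in_itv/= => /andP[xxi _] ->.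
by rewrite normrM ler_wpM2r// uC// (lt_trans x0).
Qed.

End HalfLine.

(** * Contractivity and the Cotlar inequality on the half-line *)

Section HalfLineIdentities.
Context {R : realType}.
Implicit Types (f g h u : R -> R) (s t x y C B e : R).

Let D : set R := halfline R.
Let mD : measurable D := measurable_halfline.

Definition admissible u := [/\ sqint D u,
  (exists C, forall x y, 0 < x -> 0 < y -> `|u x - u y| <= C * `|x - y|) &
  (`|u y| @[y --> 0^'+] --> (0 : R))].

Lemma admissible_odd_ext u : admissible u ->
  exists C B, [/\ lip C (odd_ext u), sqint setT (odd_ext u) &
    forall x, `|odd_ext u x| <= B].
Proof.
move=> [ui [C lu] u0]; have lf := lip_odd_ext lu u0; have sf := sqint_odd_ext ui.
by have [B fB] := lip_sqint_bounded lf sf; exists C, B.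
Qed.

Lemma hilbert_odd_ext u y : admissible u -> 0 < y ->
  hilbert_odd u y = pi^-1 * hil (odd_ext u) y.
Proof.
move=> au y0; have [C [B [lf sf fB]]] := admissible_odd_ext au.
apply: (hilbert_oddE lf sf fB) => //; first exact: odd_extN.
by move=> x; exact: odd_ext_pos.
Qed.

Let pi0 : (0 : R) < pi. Proof. exact: pi_gt0. Qed.

(** [hil] of an odd function is even, so the bound on the line descends to the half-line with the
    same constant. *)
Lemma hilbert_odd_bound u : admissible u ->
  sqint D (hilbert_odd u) /\ nrm D (hilbert_odd u) <= nrm D u.
Proof.
move=> au; have [C [B [lf sf fB]]] := admissible_odd_ext au.
have [sw wle] := hil_bound lf sf.
have ui : sqint D u by case: au.
have E y : D y -> pi^-1 * hil (odd_ext u) y = hilbert_odd u y.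
  by move=> /halflineE y0; rewrite hilbert_odd_ext.
have s1 : sqint D (fun y => pi^-1 * hil (odd_ext u) y).
  by apply: sqintZ => //; exact: sqintS sw.
split; first exact: eq_sqint s1.
have /eqP e1 : nrm D (hilbert_odd u) ^+ 2 = pi^-1 ^+ 2 * \int[mu]_(y in D) hil (odd_ext u) y ^+ 2.
  rewrite nrm_sqr -RintZ//; last exact: (sqintS measurableT mD (@subsetT _ _) sw).2.
  by apply: eq_intr => y Dy; rewrite -E// exprMn.
have h1 : 2 * \int[mu]_(y in D) hil (odd_ext u) y ^+ 2 <= pi ^+ 2 * (2 * nrm D u ^+ 2).
  rewrite -nrm_odd_ext// -exprMn.
  apply: (@le_trans _ _ (nrm setT (hil (odd_ext u)) ^+ 2)).
    rewrite nrm_sqr; apply: even_half_le; first exact: sw.2.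
      by move=> x; rewrite hil_odd_even//; exact: odd_extN.
    by move=> x; exact: sqr_ge0.
  exact: (le_sqr (nrm_ge0 _ _) wle).
have h2 : nrm D (hilbert_odd u) ^+ 2 <= nrm D u ^+ 2.
  rewrite (eqP e1) exprVn mulrC ler_pdivrMr ?exprn_gt0//.
  rewrite -(ler_pM2l (_ : 0 < 2))//; apply: (le_trans h1).
  by rewrite le_eqVlt; apply/orP; left; apply/eqP; ring.
by rewrite -(ler_pXn2r (_ : (0 < 2)%N)) ?nnegrE ?nrm_ge0.
Qed.

Lemma hilN g x C : lip C g -> sqint setT g -> hil (fun x => - g x) x = - hil g x.
Proof.
move=> lg gi; rewrite /hil -mulrN; congr (_ * _).
rewrite -mulN1r -RintZ//; last exact: integ_sdiff lg gi.
by apply: eq_intr => t _; rewrite /sdiff; ring.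
Qed.

(** For odd f and g every integrand in [cotlar_upper] is even, so both of its sides are twice their
    half-line counterparts. *)
Lemma cotlar_half_upper u g C B M : admissible u -> lip C g -> sqint setT g ->
  (forall x, `|g x| <= B) -> (forall x, g (- x) = - g x) ->
  0 <= M -> (forall x, hilbert g x <= M) ->
  [/\ integ D (fun y => u y * hilbert_odd u y * g y),
      integ D (fun y => hilbert g y * u y ^+ 2) &
  \int[mu]_(y in D) (u y * hilbert_odd u y * g y) +
  \int[mu]_(y in D) (hilbert g y * u y ^+ 2) <= M * nrm D u ^+ 2].
Proof.
move=> au lg gi gB gN M0 gM; have [C1 [B1 [lf sf fB]]] := admissible_odd_ext au.
have ui : sqint D u by case: au.
have [sw wle] := hil_bound lf sf; have [swg wgle] := hil_bound lg gi.
have mT : measurable [set: R] by exact: measurableT.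
set f := odd_ext u in lf sf fB sw wle.
have j1 : integ setT (fun x => f x * hil f x * g x).
  by apply: sqintM => //; apply: (sqint_bdM _ sf.1 (fun x _ => fB x) sw).
have j2 : integ setT (fun x => hil g x * f x ^+ 2).
  apply: (@eq_integ _ _ (fun x => f x * hil g x * f x)) => //.
    by move=> x _; ring.
  by apply: sqintM => //; apply: (sqint_bdM _ sf.1 (fun x _ => fB x) swg).
have j1D : integ D (fun x => f x * hil f x * g x) by exact: integrableS j1.
have j2D : integ D (fun x => hil g x * f x ^+ 2) by exact: integrableS j2.
have E1 y : D y -> pi^-1 * (f y * hil f y * g y) = u y * hilbert_odd u y * g y.
  move=> /halflineE y0; rewrite hilbert_odd_ext// -/f -(odd_ext_pos u y0) -/f; ring.
have E2 y : D y -> pi^-1 * (hil g y * f y ^+ 2) = hilbert g y * u y ^+ 2.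
  by move=> /halflineE y0; rewrite (hilbertE y lg gi) -(odd_ext_pos u y0) -/f mulrA.
split.
- by apply: eq_integ (integZ pi^-1 mD j1D).
- by apply: eq_integ (integZ pi^-1 mD j2D).
rewrite -(eq_intr E1) -(eq_intr E2) !RintZ// -mulrDr mulrC ler_pdivrMr//.
have hM x : hil g x <= pi * M.
  by have := gM x; rewrite (hilbertE x lg gi) mulrC ler_pdivrMr// mulrC.
have := cotlar_upper lf sf fB lg gi gB (mulr_ge0 (ltW pi0) M0) hM.
rewrite (even_half j1); last 2 first.
- by move=> x; rewrite gN /f odd_extN hil_odd_even; [ring|exact: odd_extN].
- by rewrite /f odd_ext0 !mul0r.
rewrite (even_half j2); last 2 first.
- by move=> x; rewrite hil_odd_even// /f odd_extN sqrrN.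
- by rewrite /f odd_ext0 expr0n mulr0.
rewrite -mulrDr nrm_odd_ext// => h.
rewrite -(ler_pM2l (_ : 0 < 2))//; apply: (le_trans h).
by rewrite le_eqVlt; apply/orP; left; apply/eqP; ring.
Qed.

(** The lower bound is the upper bound for [- g], whose Hilbert transform is at most [- m]. *)
Lemma cotlar_half u g C B m M : admissible u -> lip C g -> sqint setT g ->
  (forall x, `|g x| <= B) -> (forall x, g (- x) = - g x) ->
  m <= 0 -> 0 <= M -> (forall x, m <= hilbert g x <= M) ->
  [/\ integ D (fun y => u y * hilbert_odd u y * g y),
      integ D (fun y => hilbert g y * u y ^+ 2) &
  m * nrm D u ^+ 2 <= \int[mu]_(y in D) (u y * hilbert_odd u y * g y) +
  \int[mu]_(y in D) (hilbert g y * u y ^+ 2) <= M * nrm D u ^+ 2].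
Proof.
move=> au lg gi gB gN m0 M0 gmM.
have [i1 i2 up] := cotlar_half_upper au lg gi gB gN M0 (fun x => (andP (gmM x)).2).
split=> //; rewrite up andbT.
have lg' : lip C (fun x => - g x) by move=> x y; rewrite -opprD normrN.
have gi' : sqint setT (fun x => - g x).
  by apply: eq_sqint (sqintZ (-1) measurableT gi) => // x _; rewrite mulN1r.
have gB' x : `|- g x| <= B by rewrite normrN.
have gN' x : - g (- x) = - - g x by rewrite gN.
have E x : hilbert (fun x => - g x) x = - hilbert g x.
  by rewrite (hilbertE x lg' gi') (hilbertE x lg gi) (hilN x lg gi) mulrN.
have gm x : hilbert (fun x => - g x) x <= - m.
  by rewrite E lerN2; case/andP: (gmM x).
have nm0 : 0 <= - m by rewrite oppr_ge0.
have [_ _] := cotlar_half_upper au lg' gi' gB' gN' nm0 gm.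
have -> : \int[mu]_(y in D) (u y * hilbert_odd u y * - g y) =
    - \int[mu]_(y in D) (u y * hilbert_odd u y * g y).
  by rewrite -mulN1r -RintZ//; apply: eq_intr => y _; ring.
have -> : \int[mu]_(y in D) (hilbert (fun x => - g x) y * u y ^+ 2) =
    - \int[mu]_(y in D) (hilbert g y * u y ^+ 2).
  by rewrite -mulN1r -RintZ//; apply: eq_intr => y _; rewrite E; ring.
by rewrite -opprD mulNr lerN2.
Qed.

Lemma tail_small h eps : integ D h -> (forall y, D y -> 0 <= h y) -> 0 < eps ->
  \forall n \near \oo, \int[mu]_(y in `]n.+1%:R, +oo[) h y <= eps.
Proof.
move=> hi h0 eps0; have mh := integ_meas hi.
have mI (n : nat) : measurable (`]n.+1%:R, +oo[%classic : set R) by exact: measurable_itv.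
have [] := @dominated_cvgR R D (fun n => h \_ `]n.+1%:R, +oo[%classic) (fun=> 0) h mD.
- move=> n.
  have ID : `]n.+1%:R, +oo[%classic `<=` D.
    by move=> y; rewrite /= in_itv/= andbT => ny; apply/halflineE; exact: lt_trans ny.
  have mhI := measurable_funS mD ID mh.
  exact: (measurable_funTS ((measurable_restrictT _ (mI n)).1 mhI)).
- move=> x _; apply: cvg_near_cst; near=> n; rewrite patchE ifF//.
  apply/negP => /set_mem /=; rewrite in_itv/= andbT ltNge => /negP; apply.
  rewrite (@le_trans _ _ n%:R)//; last by rewrite ler_nat.
  by near: n; exact: nbhs_infty_ger.
- exact: hi.
- move=> n x Dx; rewrite patchE; case: ifP => _; last by rewrite normr0 h0.
  by rewrite ger0_norm// h0.
move=> _; rewrite (@Rint_eq0 _ _ (fun=> 0))// => /cvgrPdist_le /(_ eps eps0).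
apply: filterS => n; rewrite sub0r normrN => /(le_trans (ler_norm _)).
rewrite -Rintegral_mkcondr (_ : (D `&` `]n.+1%:R, +oo[ = `]n.+1%:R, +oo[)%classic)//.
apply: setIidr => y; rewrite /= in_itv/= andbT => ny.
by apply/halflineE; exact: lt_trans ny.
Unshelve. all: by end_near. Qed.

End HalfLineIdentities.

(** * The transport term *)

Section Transport.
Context {R : realType}.
Implicit Types (f g h u b db F : R -> R) (s t x y C B e : R).

Let D : set R := halfline R.
Let mD : measurable D := measurable_halfline.

Lemma integS (E F : set R) h : measurable E -> measurable F -> F `<=` E ->
  integ E h -> integ F h.
Proof. by move=> mE mF FE hi; exact: integrableS hi. Qed.

Lemma int_halfline_split h y : integ D h -> 0 < y ->
  \int[mu]_(x in D) h x = \int[mu]_(x in `]0, y]) h x + \int[mu]_(x in `]y, +oo[) h x.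
Proof.
move=> hi y0; rewrite -(@Rintegral_itvB R h (BRight 0) (BInfty _ false) y)//.
  by rewrite addrC subrK.
by rewrite bnd_simp ltW.
Qed.

(** F is controlled at 0 through its limit only, so the fundamental theorem is used on [a n, y] and
    dominated convergence lets a n tend to 0. *)
Lemma int_from0 k F y : 0 < y -> integ `]0, y] k ->
  (forall x, 0 < x <= y -> is_derive x 1 F (k x)) ->
  (forall x, 0 < x -> {for x, continuous k}) ->
  F x @[x --> 0^'+] --> (0 : R) ->
  \int[mu]_(x in `]0, y]) k x = F y.
Proof.
move=> y0 ki dF ck F0.
have mI : measurable (`]0, y]%classic : set R) by exact: measurable_itv.
pose a n := y * n.+2%:R^-1.
have a0 n : 0 < a n by rewrite mulr_gt0 // invr_gt0.
have ay n : a n <= y by rewrite /a ger_pMr// invf_le1// ler1n.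
have mJ n : measurable (`[a n, y]%classic : set R) by exact: measurable_itv.
have JI n : `[a n, y]%classic `<=` `]0, y]%classic.
  by move=> z; rewrite /= !in_itv/= => /andP[az ->]; rewrite (lt_le_trans (a0 n)).
have acvg : a n @[n --> \oo] --> (0 : R).
  rewrite -(mulr0 y); apply: cvgM; first exact: cvg_cst.
  by have := @cvg_harmonic R; rewrite -cvg_shiftS.
have [] := @dominated_cvgR R `]0, y] (fun n => k \_ `[a n, y]%classic) k (fun x => `|k x|) mI.
- move=> n; have mk := measurable_funS mI (JI n) (integ_meas ki).
  exact: (measurable_funTS ((measurable_restrictT _ (mJ n)).1 mk)).
- move=> x /=; rewrite in_itv/= => /andP[x0 xy]; apply: cvg_near_cst; near=> n.
  rewrite patchE ifT//; apply/mem_set; rewrite /= in_itv/= xy andbT.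
  by near: n; move/cvgrPdist_le : acvg => /(_ x x0); apply: filterS => n;
    rewrite sub0r normrN ger0_norm// ltW.
- exact: integ_norm.
- by move=> n x _; exact: norm_restrict_le.
move=> _ h1.
have e n : \int[mu]_(x in `]0, y]) (k \_ `[a n, y]%classic) x = F y - F (a n).
  rewrite -Rintegral_mkcondr setIidr; last exact: JI.
  apply: (@FTC2R R F k (a n) y _ _ _).2 => // x /andP[ax xy].
    by apply: dF; rewrite xy (lt_le_trans (a0 n)).
  by apply: ck; exact: lt_le_trans ax.
have h2 : F y - F (a n) @[n --> \oo] --> F y - 0.
  apply: cvgB; first exact: cvg_cst.
  move/cvg_at_rightP : F0; apply; split => // n; exact: a0.
rewrite subr0 in h2.
rewrite (_ : (fun n => F y - F (a n)) =
  (fun n => \int[mu]_(x in `]0, y]) (k \_ `[a n, y]%classic) x)) in h2; last first.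
  by apply/funext => n; rewrite e.
exact: (cvg_unique (@Rhausdorff R) h1 h2).
Unshelve. all: by end_near. Qed.

(** The integrand k is the derivative of F = b u^2 / 2, so its integral L is the limit of F at
    infinity minus that at 0. Near 0, F is O(y). At infinity F >= 0 gives L >= 0, while F <= bp y
    u^2 with u^2 integrable excludes L > 0: F would stay above a positive constant, and u^2 above a
    multiple of 1/y. *)
Lemma transport_identity u g b db bp K : sqint D u -> second_derivative u g ->
  sqint D g -> (forall y, 0 < y -> `|u y| <= K) ->
  (forall y, 0 < y -> is_derive y 1 b (db y)) ->
  (forall y, 0 < y -> {for y, continuous db}) ->
  (forall y, 0 < y -> 0 <= b y <= bp * y) ->
  integ D (fun y => b y * derive1 u y * u y) ->
  integ D (fun y => db y * u y ^+ 2) ->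
  \int[mu]_(y in D) (b y * derive1 u y * u y) =
    - (2^-1 * \int[mu]_(y in D) (db y * u y ^+ 2)).
Proof.
move=> ui ug gi uK dB cdb bb i1 i2.
pose k y := b y * derive1 u y * u y + 2^-1 * (db y * u y ^+ 2).
pose F y := 2^-1 * (b y * (u y * u y)).
have ki : integ D k by apply: integD => //; exact: integZ.
suff /eqP : \int[mu]_(y in D) k y = 0.
  rewrite /k RintD//; last exact: integZ.
  by rewrite RintZ// addr_eq0 => /eqP.
have du y : 0 < y -> is_derive y 1 u (derive1 u y).
  by move=> y0; rewrite derive1E; apply: derivableP; exact: ug.1.
have cu y : 0 < y -> {for y, continuous u} by move=> /du; exact: is_derive_cont.
have cb y : 0 < y -> {for y, continuous b} by move=> /dB; exact: is_derive_cont.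
have cu' : forall y, 0 < y -> {for y, continuous (derive1 u)}.
  apply: (@holder_continuous R (derive1 u) (nrm D g)) => x y x0 xy.
  exact: second_derivative_holder.
have dF y : 0 < y -> is_derive y 1 F (k y).
  move=> y0; have d1 := du y y0; have d2 := dB y y0.
  by apply: is_derive_eq; rewrite /k /GRing.scale/=; field.
have ck y : 0 < y -> {for y, continuous k}.
  move=> y0; apply: cvgD.
    exact: (cvgM (cvgM (cb y y0) (cu' y y0)) (cu y y0)).
  have h := cvgM (cvg_cst (2^-1 : R)) (cvgM (cdb y y0) (cvgM (cu y y0) (cu y y0))).
  by under eq_fun do rewrite expr2; rewrite expr2; exact: h.
have bp0 : 0 <= bp by have /andP[h1 h2] := bb 1 ltr01; rewrite -[bp]mulr1 (le_trans h1).
have F_ge0 y : 0 < y -> 0 <= F y.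
  move=> y0; have /andP[h1 _] := bb y y0.
  by rewrite /F mulr_ge0// mulr_ge0// -expr2 sqr_ge0.
have F_le y : 0 < y -> F y <= bp * y * u y ^+ 2.
  move=> y0; have /andP[h1 h2] := bb y y0.
  rewrite /F -expr2; apply: (@le_trans _ _ (b y * u y ^+ 2)).
    apply: ler_piMl; first by rewrite mulr_ge0 ?sqr_ge0.
    by rewrite invf_le1 ?ler1n.
  by rewrite ler_wpM2r ?sqr_ge0.
have K0 : 0 <= K by rewrite (le_trans _ (uK 1 ltr01)).
have F0 : F x @[x --> 0^'+] --> (0 : R).
  apply: (@lim_linear_error R F 0 (bp * K ^+ 2) 1) => // y y0 _.
  rewrite subr0 ger0_norm ?F_ge0//; apply: (le_trans (F_le y y0)).
  rewrite mulrAC ler_wpM2r ?(ltW y0)// ler_wpM2l//.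
  by rewrite -(real_normK (num_real (u y))); apply: le_sqr => //; exact: uK.
have mO y : measurable (`]0, y]%classic : set R) by exact: measurable_itv.
have OD y : `]0, y]%classic `<=` D.
  by move=> z; rewrite /= in_itv/= => /andP[z0 _]; exact/halflineE.
have mT y : measurable (`]y, +oo[%classic : set R) by exact: measurable_itv.
have TD y : 0 < y -> `]y, +oo[%classic `<=` D.
  by move=> y0 z; rewrite /= in_itv/= andbT => yz; apply/halflineE; exact: lt_trans yz.
have Lk y : 0 < y -> \int[mu]_(x in D) k x = F y + \int[mu]_(x in `]y, +oo[) k x.
  move=> y0; rewrite (int_halfline_split ki y0); congr (_ + _).
  apply: int_from0 => //.
  - exact: (integS mD (mO y) (OD y) ki).
  - by move=> x /andP[x0 _]; exact: dF.
have iak := integ_norm mD ki.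
have tail_le y z (h : R -> R) : 0 < y -> y <= z -> integ D h -> (forall x, D x -> 0 <= h x) ->
    \int[mu]_(x in `]z, +oo[) h x <= \int[mu]_(x in `]y, +oo[) h x.
  move=> y0 yz hi h0; have z0 := lt_le_trans y0 yz.
  have hiy : integ `]y, +oo[ h by exact: (integS mD (mT y) (TD y y0) hi).
  have hiz : integ `]z, +oo[ h by exact: (integS mD (mT z) (TD z z0) hi).
  rewrite Rintegral_mkcond [leRHS]Rintegral_mkcond; apply: le_intr => //.
  - exact: ((integ_restrict _ (mT z)).1 hiz).
  - exact: ((integ_restrict _ (mT y)).1 hiy).
  move=> x _; rewrite !patchE; case: ifPn => [/set_mem /= zx|_].
    rewrite ifT//; apply/mem_set; move: zx; rewrite /= !in_itv/= !andbT.
    exact: le_lt_trans.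
  by case: ifPn => // /set_mem/(TD y y0)/h0.
set L := \int[mu]_(x in D) k x.
suff HL eps : 0 < eps -> `|L| <= (1 + 2 * bp) * eps.
  apply/eqP; rewrite -normr_le0; apply/ler_addgt0Pr => eps eps0; rewrite add0r.
  have c0 : 0 < 1 + 2 * bp by rewrite ltr_wpDr// mulr_ge0.
  have := HL _ (divr_gt0 eps0 c0); rewrite mulrCA divff ?mulr1//.
  by rewrite gt_eqF.
move=> eps0.
have u2i : integ D (fun x => u x ^+ 2) by exact: ui.2.
have [n] : exists n, \int[mu]_(x in `]n.+1%:R, +oo[) `|k x| <= eps /\
    \int[mu]_(x in `]n.+1%:R, +oo[) u x ^+ 2 <= eps.
  near \oo => n; exists n; split; near: n; apply: tail_small => //.
  by move=> y _; exact: sqr_ge0.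
set N : R := n.+1%:R => -[Tk Tu].
have N0 : 0 < N by rewrite ltr0n.
have Ltail y : N <= y -> `|L - F y| <= eps.
  move=> Ny; have y0 := lt_le_trans N0 Ny.
  have iky : integ `]y, +oo[ k by exact: (integS mD (mT y) (TD y y0) ki).
  rewrite /L (Lk y y0) addrAC subrr add0r.
  apply: (le_trans (le_norm_intr (mT y) iky)); apply: le_trans Tk.
  exact: tail_le.
have L1 : - eps <= L.
  have := Ltail N (lexx _); rewrite ler_norml => /andP[h _].
  by have := F_ge0 N N0; lra.
(* Quantitative form: on ]N, 2N] one has L - eps <= F <= 2 bp N u^2, and integrating gives N (L -
   eps) <= 2 bp N eps. *)
have L2 : L <= eps + 2 * bp * eps.
  rewrite -lerBlDl -(ler_pM2l N0).
  have mJ : measurable (`]N, (2 * N)]%classic : set R) by exact: measurable_itv.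
  have JT : `]N, (2 * N)]%classic `<=` `]N, +oo[%classic.
    by move=> z; rewrite /= !in_itv/= andbT => /andP[].
  have JD := subset_trans JT (TD N N0).
  have uJ : integ `]N, (2 * N)] (fun x => u x ^+ 2) by exact: (integS mD mJ JD u2i).
  have uT : integ `]N, +oo[ (fun x => u x ^+ 2) by exact: (integS mD (mT N) (TD N N0) u2i).
  have cJ : integ `]N, (2 * N)] (fun=> L - eps).
    by apply: (integS _ mJ _ (integ_cst_itv N (2 * N) (L - eps))) => //;
      exact: subset_itv_oc_cc.
  have -> : N * (L - eps) = \int[mu]_(x in `]N, (2 * N)]) (L - eps).
    rewrite Rintegral_cst//= lebesgue_measure_itv/= lte_fin ifT; last by rewrite ltr_pMl// ltr1n.
    by rewrite -EFinD/=; ring.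
  apply: (@le_trans _ _ (\int[mu]_(x in `]N, (2 * N)]) ((2 * bp * N) * u x ^+ 2))).
    apply: le_intr => //; first exact: integZ.
    move=> x; rewrite /= in_itv/= => /andP[/ltW Nx xN].
    have := Ltail x Nx; rewrite ler_norml => /andP[_ h].
    have x0 := lt_le_trans N0 Nx.
    have h2 := F_le x x0.
    have h3 : bp * x * u x ^+ 2 <= 2 * bp * N * u x ^+ 2.
      rewrite ler_wpM2r ?sqr_ge0// [2 * bp]mulrC -mulrA ler_wpM2l//.
    clear -h h2 h3; lra.
  rewrite RintZ//.
  have -> : N * (2 * bp * eps) = 2 * bp * N * eps by ring.
  apply: ler_wpM2l; first by rewrite mulr_ge0 ?(ltW N0)// mulr_ge0.
  apply: le_trans Tu.
  rewrite Rintegral_mkcond [leRHS]Rintegral_mkcond; apply: le_intr => //.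
  - exact: ((integ_restrict _ mJ).1 uJ).
  - exact: ((integ_restrict _ (mT N)).1 uT).
  move=> x _; rewrite !patchE; case: ifPn => [/set_mem/JT/mem_set -> //|_].
  by case: ifP => // _; exact: sqr_ge0.
rewrite ler_norml mulrDl mul1r L2 andbT.
apply: le_trans L1; rewrite lerN2 lerDl mulr_ge0 ?(ltW eps0)// mulr_ge0.
Unshelve. all: by end_near. Qed.

End Transport.

(** * Consequences of the profile hypotheses *)

Section ExtendedNorms.
Context {R : realType}.

Lemma integ_sqrte (D : set R) (h : R -> R) : measurable D -> measurable_fun D h ->
  (forall x, D x -> 0 <= h x) ->
  ((\int[mu]_(x in D) (h x)%:E) `^ 2^-1 < +oo)%E -> integ D h.
Proof.
move=> mD mh h0 H; apply/integrableP; split; first exact/measurable_EFinP.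
have -> : (\int[mu]_(x in D) `|(EFin \o h) x| = \int[mu]_(x in D) (h x)%:E)%E.
  by apply: eq_integral => x /set_mem Dx; rewrite /= ger0_norm// h0.
move: H; case: (\int[mu]_(x in D) (h x)%:E)%E => [r _||_] //.
  by rewrite ltry.
by rewrite poweRyr// gt_eqF.
Qed.

Lemma sqrteE (D : set R) (h : R -> R) : measurable D -> integ D h ->
  (forall x, D x -> 0 <= h x) ->
  ((\int[mu]_(x in D) (h x)%:E) `^ 2^-1 = (Num.sqrt (\int[mu]_(x in D) h x))%:E)%E.
Proof.
move=> mD hi h0; rewrite EFin_intr// poweR_EFin powR12_sqrt//.
exact: Rintegral_ge0.
Qed.

Lemma finite_norm_sqint (f : R -> R) : measurable_fun [set: R] f ->
  finite_norm mu 2%:E f -> sqint setT f.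
Proof.
move=> mf; rewrite /finite_norm => H; split=> //.
apply/integrableP; split; first by apply/measurable_EFinP; exact: measurable_funX.
have := poweR_lty 2 H; rewrite powR_Lnorm//; apply: le_lt_trans.
rewrite le_eqVlt; apply/orP; left; apply/eqP; apply: eq_integral => x _.
by rewrite /= powR_mulrn// ger0_norm ?sqr_ge0// real_normK ?num_real.
Qed.

End ExtendedNorms.

(** * Regularity, symmetry and bounds of the profile *)

Section Profile.
Context {R : realType} (a c_l : R) (Omega : R -> R).
Context (Omega_smooth : smooth Omega).
Context (Omega_odd : forall y, Omega (- y) = - Omega y).
Context (hprof : H_prof a c_l Omega).
Context (hK4 : K4_plus Omega).
Context (hD : D_infty a c_l Omega).

Let D : set R := halfline R.
Let mD : measurable D := measurable_halfline.
Let q := prof_q Omega.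
Let b := prof_b a c_l Omega.
Let Omega' := derive1 Omega.
Let qm := prof_qm Omega.
Let qp := prof_qp Omega.

Lemma derivable_lip (f : R -> R) C : (forall x, derivable f x 1) ->
  (forall x, `|derive1 f x| <= C) -> lip C f.
Proof.
move=> df fC.
suff H x y : x < y -> `|f y - f x| <= C * `|y - x|.
  move=> x y; have [xy|xy|->] := ltgtP x y.
  - by rewrite distrC [`|x - y|]distrC H.
  - by rewrite H.
  - by rewrite !subrr normr0 mulr0.
move=> xy.
have [xi _ ->] : exists2 xi, xi \in `]x, y[%R & f y - f x = derive1 f xi * (y - x).
  apply: (@MVT _ f (fun x => derive1 f x)) => //.
    by move=> z _; rewrite derive1E; apply: derivableP.
  by apply: derivable_within_continuous.
by rewrite normrM ler_wpM2r.
Qed.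

Lemma finite_sup_bound (A : set R) (f : R -> R) : finite_sup A f ->
  exists C, forall x, A x -> `|f x| <= C.
Proof. by move=> [C HC]; exists C => x Ax; apply: HC; exists x. Qed.

Lemma Omega_lip : exists C, lip C Omega.
Proof.
have [C HC] := finite_sup_bound (K4_W hK4 (j := 1) isT).
exists C; apply: derivable_lip => [x|x]; first exact: (@Omega_smooth 0%N x).
exact: HC.
Qed.

Lemma Omega_bounded : exists B, forall x, `|Omega x| <= B.
Proof.
have [C HC] := finite_sup_bound (K4_W hK4 (j := 0) isT).
by exists C => x; exact: HC.
Qed.

Lemma Omega_sqint : sqint setT Omega.
Proof.
have [C lO] := Omega_lip.
by apply: finite_norm_sqint; [exact: lip_measurable lO|exact: prof_L2 hprof].
Qed.

Lemma derivable_cont (f : R -> R) x : derivable f x 1 -> {for x, continuous f}.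
Proof. by move=> df; apply: differentiable_continuous; exact/derivable1_diffP. Qed.

Lemma dOmega_continuous : continuous Omega'.
Proof. by move=> x; apply: derivable_cont; exact: (@Omega_smooth 1%N x). Qed.

Lemma q_continuous : continuous q.
Proof. by move=> x; apply: derivable_cont; exact: K4_dq hK4 x. Qed.

Lemma q_even (x : R) : q (- x) = q x.
Proof.
have [C lO] := Omega_lip.
by rewrite /q /prof_q !(hilbertE _ lO Omega_sqint) hil_odd_even.
Qed.

(** The bounds are taken over y > 0; they extend to the line since q is even, and to 0 by
    continuity. Boundedness of q makes the real [inf] and [sup] genuine. *)
Lemma q_bounds (x : R) : qm <= q x <= qp.
Proof.
have [C HC] := finite_sup_bound (K4_Q0 hK4).
have ub : has_ubound [set q y | y in D].
  by exists C => _ [y _ <-]; exact: (le_trans (ler_norm _) (HC y I)).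
have lb : has_lbound [set q y | y in D].
  by exists (- C) => _ [y _ <-]; rewrite lerNl (le_trans _ (HC y I))// ler_normr lexx orbT.
have pos y : 0 < y -> qm <= q y <= qp.
  move=> y0; have Dy : D y by exact/halflineE.
  apply/andP; split; first by apply: ge_inf => //; exists y.
  by apply: ub_le_sup => //; exists y.
have [x0|x0|<-] := ltgtP 0 x; first exact: pos.
  by rewrite -q_even; apply: pos; rewrite oppr_gt0.
have c0 : q y @[y --> 0^'+] --> q 0 by apply: cvg_at_right_filter; exact: q_continuous.
rewrite -(cvg_lim (@Rhausdorff R) c0); apply/andP; split.
  apply: limr_ge; first exact: cvgP c0.
  by near=> y; have /andP[] : qm <= q y <= qp by exact: pos.
apply: limr_le; first exact: cvgP c0.
by near=> y; have /andP[] : qm <= q y <= qp by exact: pos.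
Unshelve. all: by end_near. Qed.

(** The decay of q puts 0 in the closure of its range. *)
Lemma q_bounds0 : qm <= 0 /\ 0 <= qp.
Proof.
have small eps : 0 < eps -> exists y, `|q y| <= eps.
  move=> eps0; have [Cq [CO [al [U [C [[Cq0 _ al1] [qd _ _ _]]]]]]] := hD.
  (* The decay exponent is at least 1, so |q| is at most Cq / (1 + y), which this y makes at most
     eps. *)
  pose y := Num.max 1 (Cq / eps).
  have y1 : 1 <= y by rewrite le_max lexx.
  have y0 : 0 < y by apply: lt_le_trans y1.
  exists y; apply: (le_trans (qd y y0)).
  have h1 : (1 + y) `^ (- Num.min al 2) <= (1 + y) `^ (- 1).
    apply: ler_powR; first by rewrite lerDl ltW.
    by rewrite lerN2 le_min (ltW al1)/= ler1n.
  apply: (le_trans (ler_wpM2l (ltW Cq0) h1)).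
  have y10 : 0 < 1 + y by rewrite addr_gt0.
  rewrite powR_inv1 ?(ltW y10)// ler_pdivrMr//.
  have : Cq / eps <= y by rewrite le_max lexx orbT.
  rewrite ler_pdivrMr// => h; apply: (le_trans h).
  by rewrite mulrC ler_pM2l// lerDr.
split; apply/ler_addgt0Pr => eps eps0; have [y qy] := small eps eps0;
  have /andP[h1 h2] := q_bounds y; move: qy; rewrite ler_norml => /andP[h3 h4].
  by rewrite add0r; exact: le_trans h1 h4.
by rewrite -lerBlDr sub0r; exact: le_trans h3 h2.
Qed.

Lemma b_derive (y : R) : 0 < y -> is_derive y 1 b (c_l + a * q y).
Proof.
move=> y0.
have yy1 : y < y + 1 by rewrite ltrDl.
have qi : integ `[0, (y + 1)] q by apply: continuous_integ => x _; exact: q_continuous.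
have [dU U'] := continuous_FTC1_closed yy1 qi y0 (q_continuous (x := y)).
have dU1 : is_derive y 1 (fun x => \int[mu]_(t in `[0, x]) q t) (q y).
  by rewrite -U' derive1E; exact: derivableP.
have dU2 : is_derive y 1 (prof_U Omega) (q y).
  apply: near_eq_is_derive dU1; near=> z.
  by rewrite /prof_U /primitive0 ifT// ltW//; near: z; exact: lt_nbhsr.
rewrite /b /prof_b; apply: is_derive_eq; rewrite /GRing.scale/=; ring.
Unshelve. all: by end_near. Qed.

Lemma b_bound : exists bp, forall y, 0 < y -> 0 <= b y <= bp * y.
Proof.
have [bm [bp [bm0 H]]] := prof_beta hprof; exists bp => y y0.
have /andP[h1 h2] := H y y0; rewrite -ler_pdivrMr// h2 andbT.
have : 0 <= b y / y by apply: le_trans h1; exact: ltW.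
by rewrite pmulr_lge0// invr_gt0.
Qed.

(** The weight sqrt y is the growth of V(u) in [Vop_bound]; finiteness of the extended J_1 makes
    [fine] faithful. *)
Lemma sqint_J1 : sqint D (fun y => Num.sqrt y * Omega' y) /\
  nrm D (fun y => Num.sqrt y * Omega' y) = fine (prof_J Omega 1).
Proof.
have mO : measurable_fun [set: R] Omega' by exact: continuous_measurable_fun dOmega_continuous.
have ms : measurable_fun [set: R] (fun y : R => Num.sqrt y).
  exact: continuous_measurable_fun (@sqrt_continuous R).
have h0 y : D y -> 0 <= y * `|Omega' y| ^+ 2.
  by move=> /halflineE y0; rewrite mulr_ge0 ?sqr_ge0// ltW.
have mh : measurable_fun D (fun y => y * `|Omega' y| ^+ 2).
  apply: measurable_funTS; apply: measurable_funM => //.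
  by apply: measurable_funX; exact: measurableT_comp.
have E y : D y -> y * `|Omega' y| ^+ 2 = (Num.sqrt y * Omega' y) ^+ 2.
  by move=> /halflineE y0; rewrite exprMn sqr_sqrtr ?(ltW y0)// real_normK ?num_real.
have hi := integ_sqrte mD mh h0 (K4_J hK4 (k := 1) isT).
split.
  split; last exact: eq_integ hi.
  by apply: measurable_funTS; exact: measurable_funM.
by rewrite /prof_J sqrteE//= /nrm -(eq_intr E).
Qed.

End Profile.

(** * The real quadratic form *)

Section RealForm.
Context {R : realType} (a c_l : R) (Omega : R -> R).
Context (ha : 0 < a < 1).
Context (Omega_smooth : smooth Omega).
Context (Omega_odd : forall y, Omega (- y) = - Omega y).
Context (hprof : H_prof a c_l Omega).
Context (hK4 : K4_plus Omega).
Context (hD : D_infty a c_l Omega).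

Let D : set R := halfline R.
Let mD : measurable D := measurable_halfline.
Let q := prof_q Omega.
Let b := prof_b a c_l Omega.
Let Omega' := derive1 Omega.
Let qm := prof_qm Omega.
Let qp := prof_qp Omega.
Let J1 := fine (prof_J Omega 1).

(* One real component of an element of X. *)
Definition in_Xr (u : R -> R) := [/\ sqint D u,
  (exists2 g, sqint D g & second_derivative u g) &
  (`|u y| @[y --> 0^'+] --> (0 : R))].

Lemma in_Xr_admissible u : in_Xr u -> admissible u.
Proof.
by move=> [ui [g gi ug] u0]; split=> //; exact: second_derivative_lip ui gi ug.
Qed.

Lemma integ_oc g (x y : R) : sqint D g -> 0 <= x -> integ `]x, y] g.
Proof.
move=> gi x0.
have mI : measurable (`]x, y]%classic : set R) by exact: measurable_itv.
have ID : `]x, y]%classic `<=` D.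
  by move=> z; rewrite /= in_itv/= => /andP[xz _]; apply/halflineE; exact: le_lt_trans xz.
have s1 : sqint `]x, y] (fun=> 1 : R).
  apply: (sqintS _ _ _ (sqint_cst_itv x y 1)) => //.
  exact: subset_itv_oc_cc.
by apply: eq_integ (sqintM mI (sqintS mD mI ID gi) s1) => // t _; rewrite mulr1.
Qed.

Lemma VopE u (y : R) : in_Xr u -> 0 < y ->
  Vop u y = \int[mu]_(s in `]0, y]) hilbert_odd u s.
Proof.
move=> /in_Xr_admissible/hilbert_odd_bound[sH _] y0.
by rewrite /Vop /primitive0 (ltW y0) -Rintegral_itv_obnd_cbnd//; exact: integ_oc.
Qed.

Lemma Vop_bound u (y : R) : in_Xr u -> 0 < y ->
  `|Vop u y| <= nrm D u * Num.sqrt y.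
Proof.
move=> /in_Xr_admissible/hilbert_odd_bound[sH nH] y0.
have h0 : 0 <= (0 : R) <= y by rewrite lexx ltW.
rewrite /Vop /primitive0 (ltW y0); apply: (le_trans (primitive_holder sH h0)).
by rewrite subr0 ler_wpM2r// sqrtr_ge0.
Qed.

(** V(u) is continuous on the open half-line, being a primitive of a square-integrable function. *)
Lemma Vop_measurable u : in_Xr u -> measurable_fun D (Vop u).
Proof.
move=> uX; have [sH nH] := hilbert_odd_bound (in_Xr_admissible uX).
apply: open_continuous_measurable_fun; first exact: interval_open.
move=> y /set_mem/halflineE y0; move: y y0.
apply: (@holder_continuous R _ (nrm D (hilbert_odd u))) => x y x0 xy.
have y0 := lt_le_trans x0 xy.
rewrite !VopE// Rintegral_itvB ?bnd_simp//; [|exact: integ_oc|exact: ltW].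
rewrite Rintegral_itv_obnd_cbnd; last by apply: integ_oc => //; exact: ltW.
by apply: primitive_holder => //; rewrite ltW.
Qed.

Definition rL u (y : R) := - u y - b y * derive1 u y + q y * u y
  + Omega y * hilbert_odd u y - a * Vop u y * Omega' y.

(** Here N = |u|^2, Q = int q u^2, S = int Omega u H_odd u and T = int V(u) Omega' u. The
    coefficient 1 + a/2 joins the bound on S + Q to the share a/2 of Q left by the transport
    term. *)
Lemma form_arith (m M J N Q S T : R) : - (J * N) <= T -> T <= J * N ->
  m * N <= Q -> Q <= M * N -> m * N <= S + Q -> S + Q <= M * N ->
  (- 1 + c_l / 2 + (1 + a / 2) * m - a * J) * N <=
    - N + 2^-1 * (c_l * N + a * Q) + Q + S - a * T <=
    (- 1 + c_l / 2 + (1 + a / 2) * M + a * J) * N.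
Proof.
have [a0 _] := andP ha => t1 t2 q1 q2 s1 s2.
have h1 : a * (m * N) <= a * Q by rewrite ler_pM2l.
have h2 : a * Q <= a * (M * N) by rewrite ler_pM2l.
have h3 : a * - (J * N) <= a * T by rewrite ler_pM2l.
have h4 : a * T <= a * (J * N) by rewrite ler_pM2l.
by apply/andP; split; lra.
Qed.

Lemma rL_form u : in_Xr u -> sqint D (rL u) ->
  Eminus a c_l Omega * nrm D u ^+ 2 <= \int[mu]_(y in D) (rL u y * u y)
    <= Eplus a c_l Omega * nrm D u ^+ 2.
Proof.
move=> uX Li; have [ui [g gi ug] u0] := uX.
have au := in_Xr_admissible uX.
have [a0 a1] := andP ha.
have [C lO] := Omega_lip Omega_smooth hK4.
have [B OB] := Omega_bounded hK4.
have sO := Omega_sqint Omega_smooth hprof hK4.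
have qb := q_bounds Omega_smooth Omega_odd hprof hK4.
have [qm0 qp0] := q_bounds0 Omega_smooth Omega_odd hprof hK4 hD.
have [iS iQ form] := cotlar_half au lO sO OB Omega_odd qm0 qp0 qb.
rewrite -/(prof_q Omega) -/q -/qm -/qp in iS iQ form.
set N := nrm D u ^+ 2 in form *.
have N0 : 0 <= N by exact: sqr_ge0.
set S := \int[mu]_(y in D) _ in form; set Q := \int[mu]_(y in D) (q y * _) in form.
have [bp bb] := b_bound hprof.
have [sJ /eqP nJ] := sqint_J1 Omega_smooth hK4.
have uu : integ D (fun y => u y ^+ 2) by exact: ui.2.
have iLu : integ D (fun y => rL u y * u y) by exact: sqintM.
have ij := sqintM mD sJ ui.
have Tb y : D y -> `|Vop u y * Omega' y * u y| <= nrm D u * `|Num.sqrt y * Omega' y * u y|.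
  move=> /halflineE y0; rewrite -!mulrA normrM [`|Num.sqrt y * _|]normrM.
  by rewrite (ger0_norm (sqrtr_ge0 y)) mulrA ler_wpM2r// Vop_bound.
have iT : integ D (fun y => Vop u y * Omega' y * u y).
  apply: (integ_le mD _ (integZ (nrm D u) mD (integ_norm mD ij)) Tb).
  apply: measurable_funM; last exact: ui.1.
  apply: measurable_funM; first exact: Vop_measurable.
  apply: measurable_funTS; exact: continuous_measurable_fun (dOmega_continuous Omega_smooth).
set T := \int[mu]_(y in D) (Vop u y * Omega' y * u y).
have T_le : `|T| <= J1 * N.
  apply: (le_trans (le_norm_intr mD iT)).
  apply: (@le_trans _ _ (\int[mu]_(y in D) (nrm D u * `|Num.sqrt y * Omega' y * u y|))).
    apply: (le_intr mD (integ_norm mD iT) (integZ _ mD (integ_norm mD ij))); exact: Tb.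
  rewrite (RintZ _ mD (integ_norm mD ij)).
  have := cauchy_schwarz_abs mD sJ ui; rewrite (eqP nJ) -/J1 => h.
  apply: (le_trans (ler_wpM2l (nrm_ge0 _ _) h)).
  by rewrite /N expr2 mulrCA.
(* Solved from the definition of [rL]: every other term, and [rL u] itself, is integrable against
   u. *)
have iB : integ D (fun y => b y * derive1 u y * u y).
  have i1 := integB mD (integD mD (integB mD iQ uu) iS) (integD mD (integZ a mD iT) iLu).
  by apply: eq_integ i1 => // y _; rewrite /rL; ring.
have idb : integ D (fun y => (c_l + a * q y) * u y ^+ 2).
  have i1 := integD mD (integZ c_l mD uu) (integZ a mD iQ).
  by apply: eq_integ i1 => // y _; ring.
have [C1 [B1 [lf sf fB]]] := admissible_odd_ext au.
have uB y : 0 < y -> `|u y| <= B1 by move=> y0; rewrite -(odd_ext_pos u y0).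
have dbc y : 0 < y -> {for y, continuous (fun y => c_l + a * q y)}.
  move=> _; apply: cvgD; first exact: cvg_cst.
  by apply: cvgM; [exact: cvg_cst|exact: (q_continuous hK4)].
have /eqP tr := transport_identity ui ug gi uB (b_derive a c_l hK4) dbc bb iB idb.
have /eqP db : \int[mu]_(y in D) ((c_l + a * q y) * u y ^+ 2) = c_l * N + a * Q.
  rewrite /N nrm_sqr /Q -(RintZ c_l mD uu) -(RintZ a mD iQ).
  rewrite -(RintD mD (integZ c_l mD uu) (integZ a mD iQ)).
  by apply: eq_intr => y _; ring.
have /eqP E : \int[mu]_(y in D) (rL u y * u y) =
    - N + 2^-1 * (c_l * N + a * Q) + Q + S - a * T.
  have k1 := integD mD (integB mD iQ uu) iS.
  have k2 := integD mD (integZ a mD iT) iB.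
  have -> : \int[mu]_(y in D) (rL u y * u y) =
      \int[mu]_(y in D) ((q y * u y ^+ 2 - u y ^+ 2 + u y * hilbert_odd u y * Omega y) -
       (a * (Vop u y * Omega' y * u y) + b y * derive1 u y * u y)).
    by apply: eq_intr => y _; rewrite /rL; ring.
  rewrite (RintB mD k1 k2) (RintD mD (integB mD iQ uu) iS) (RintB mD iQ uu).
  rewrite (RintD mD (integZ a mD iT) iB) (RintZ a mD iT) (eqP tr) (eqP db).
  by rewrite -(nrm_sqr D u) -/N -/S -/T -/Q; ring.
have Qm : qm * N <= Q.
  rewrite /N nrm_sqr /Q -(RintZ qm mD uu).
  apply: (le_intr mD (integZ qm mD uu) iQ) => y _.
  by rewrite ler_wpM2r ?sqr_ge0//; case/andP: (qb y).
have Qp : Q <= qp * N.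
  rewrite /N nrm_sqr /Q -(RintZ qp mD uu).
  apply: (le_intr mD iQ (integZ qp mD uu)) => y _.
  by rewrite ler_wpM2r ?sqr_ge0//; case/andP: (qb y).
rewrite (eqP E) /Eminus /Eplus -/J1 -/qm -/qp.
move: T_le; rewrite ler_norml => /andP[t1 t2]; move/andP: form => [s1 s2].
exact: form_arith.
Qed.

End RealForm.

(** * Complex-valued functions *)

Section Linearity.
Context {R : realType}.
Let D : set R := halfline R.
Let mD : measurable D := measurable_halfline.
Implicit Types (u v : R -> R).

Lemma in_Xr_cont_derivable u (y : R) : in_Xr u -> 0 < y -> derivable u y 1.
Proof. by move=> [_ [g _ [du _]] _]; exact: du. Qed.

Lemma derive1_sub u v (y : R) : derivable u y 1 -> derivable v y 1 ->
  derive1 (fun y => u y - v y) y = derive1 u y - derive1 v y.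
Proof. move=> du dv; rewrite !derive1E; exact: (deriveB du dv). Qed.

Lemma in_Xr_sub u v : in_Xr u -> in_Xr v -> in_Xr (fun y => u y - v y).
Proof.
move=> [ui [g gi ug] u0] [vi [h hi vh] v0]; split; first exact: sqintB.
  exists (fun y => g y - h y); first exact: sqintB.
  split; first by move=> y y0; apply: derivableB; [exact: ug.1|exact: vh.1].
  move=> x y x0 xy; have y0 := lt_le_trans x0 xy.
  rewrite (derive1_sub (ug.1 y y0) (vh.1 y y0)) (derive1_sub (ug.1 x x0) (vh.1 x x0)).
  have mI : measurable (`[x, y]%classic : set R) by exact: measurable_itv.
  have ID : `[x, y]%classic `<=` D.
    by move=> z; rewrite /= in_itv/= => /andP[xz _]; apply/halflineE; exact: lt_le_trans xz.
  have ig := sqint_itv_integ (sqintS mD mI ID gi).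
  have ih := sqint_itv_integ (sqintS mD mI ID hi).
  by rewrite RintB// -(ug.2 x y x0 xy) -(vh.2 x y x0 xy); ring.
have s0 : `|u y| + `|v y| @[y --> 0^'+] --> (0 : R).
  by rewrite -[X in _ --> X]addr0; exact: (cvgD u0 v0).
apply: (squeeze_cvgr _ (cvg_cst 0) s0); apply: nearW => y.
by rewrite normr_ge0; exact: ler_normB.
Qed.

(** Additivity of a [lim] presupposes convergence; it is obtained through [hil], an absolutely
    convergent integral for elements of X. *)
Lemma hilbert_odd_sub u v (y : R) : in_Xr u -> in_Xr v -> 0 < y ->
  hilbert_odd (fun y => u y - v y) y = hilbert_odd u y - hilbert_odd v y.
Proof.
move=> uX vX y0; have wX := in_Xr_sub uX vX.
have au := in_Xr_admissible uX; have av := in_Xr_admissible vX.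
rewrite !hilbert_odd_ext//; last exact: in_Xr_admissible.
have [C [B [lu su _]]] := admissible_odd_ext au.
have [C' [B' [lv sv _]]] := admissible_odd_ext av.
rewrite -mulrBr /hil -mulrBr -RintB//; [|exact: integ_sdiff lu su|exact: integ_sdiff lv sv].
have oe x : odd_ext (fun y => u y - v y) x = odd_ext u x - odd_ext v x.
  by rewrite /odd_ext !zero_extE; do 2 case: ifP => _; ring.
by do 2 congr (_ * _); apply: eq_intr => t _; rewrite /sdiff !oe; ring.
Qed.

Lemma Vop_sub u v (y : R) : in_Xr u -> in_Xr v -> 0 < y ->
  Vop (fun y => u y - v y) y = Vop u y - Vop v y.
Proof.
move=> uX vX y0; have wX := in_Xr_sub uX vX.
have [su _] := hilbert_odd_bound (in_Xr_admissible uX).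
have [sv _] := hilbert_odd_bound (in_Xr_admissible vX).
rewrite !VopE// -RintB//; [|exact: integ_oc|exact: integ_oc].
by apply: eq_intr => s; rewrite /= in_itv/= => /andP[s0 _]; rewrite hilbert_odd_sub.
Qed.

Lemma rL_sub a c_l Omega u v (y : R) : in_Xr u -> in_Xr v -> 0 < y ->
  rL a c_l Omega (fun y => u y - v y) y = rL a c_l Omega u y - rL a c_l Omega v y.
Proof.
move=> uX vX y0; rewrite /rL Vop_sub// hilbert_odd_sub// derive1_sub.
- move: (prof_b a c_l Omega y) (prof_q Omega y) (Omega y) (derive1 Omega y) => b q w w'.
  move: (derive1 u y) (derive1 v y) (Vop u y) (Vop v y) => u' v' Vu Vv.
  by move: (hilbert_odd u y) (hilbert_odd v y) => Hu Hv; clear; ring.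
- exact: in_Xr_cont_derivable.
- exact: in_Xr_cont_derivable.
Qed.

(** Equality in X is pointwise, so a zero norm must force zero at every point: for t in [y, y + d]
    with d <= 1, u(y)^2 <= 2 u(t)^2 + 2 C^2 d, and averaging leaves 2 C^2 d with d arbitrarily
    small. *)
Lemma nrm_eq0 u : in_Xr u -> nrm D u = 0 -> forall y, 0 < y -> u y = 0.
Proof.
move=> uX n0 y y0; have [ui [C lu] _] := in_Xr_admissible uX.
have zi := sqint_zero_ext ui.
have /eqP z0 : \int[mu]_t (2 * zero_ext u t ^+ 2) = 0.
  rewrite RintZ//; last exact: zi.2.
  have -> : \int[mu]_t zero_ext u t ^+ 2 = nrm D u ^+ 2.
    rewrite nrm_sqr [RHS]Rintegral_mkcond; apply: eq_intr => t _.
    by rewrite /zero_ext !patchE; case: ifP => // _; rewrite expr0n.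
  by rewrite n0 expr0n mulr0.
have H d : 0 < d -> d <= 1 -> u y ^+ 2 <= 2 * C ^+ 2 * d.
  move=> d0 d1.
  have := @average_le R (fun t => 2 * zero_ext u t ^+ 2) y d (u y ^+ 2 - 2 * C ^+ 2 * d) d0.
  rewrite (eqP z0) pmulr_rle0// subr_le0; apply.
  - by apply: integZ => //; exact: zi.2.
  - by move=> t; rewrite mulr_ge0// sqr_ge0.
  move=> t /andP[yt td]; have t0 := lt_le_trans y0 yt.
  rewrite zero_extE t0 lerBlDr.
  have h1 : `|u y - u t| <= C * (t - y).
    by have := lu y t y0 t0; rewrite distrC [`|y - t|]distrC [`|t - y|]ger0_norm ?subr_ge0.
  have ty0 : 0 <= t - y by rewrite subr_ge0.
  have tyd : t - y <= d by rewrite lerBlDl.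
  have h2 : `|u y - u t| ^+ 2 <= C ^+ 2 * d.
    apply: (le_trans (le_sqr (normr_ge0 _) h1)); rewrite exprMn ler_wpM2l ?sqr_ge0//.
    rewrite expr2; apply: (@le_trans _ _ (d * 1)); last by rewrite mulr1.
    by apply: ler_pM => //; exact: le_trans d1.
  move: h2; rewrite real_normK ?num_real// => h2.
  have := sqr_ge0 (u y - 2 * u t); move: h2.
  by clear; move: (C ^+ 2) => K; nra.
have K0 : 0 < 2 * C ^+ 2 + 1 by rewrite ltr_wpDl// mulr_ge0 ?sqr_ge0.
apply/eqP; rewrite -sqrf_eq0 eq_le sqr_ge0 andbT.
apply/ler_addgt0Pr => eps eps0; rewrite add0r.
pose d := Num.min 1 (eps / (2 * C ^+ 2 + 1)).
have d0 : 0 < d by rewrite lt_min ltr01 divr_gt0.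
have d1 : d <= 1 by rewrite ge_min lexx.
apply: (le_trans (H d d0 d1)).
apply: (@le_trans _ _ ((2 * C ^+ 2 + 1) * d)); first by rewrite ler_wpM2r ?lerDl// ltW.
by rewrite mulrC -ler_pdivlMr// ge_min lexx orbT.
Qed.

End Linearity.

Local Notation re f := (fun y => complex.Re (f y)).
Local Notation im f := (fun y => complex.Im (f y)).

(** * Real and imaginary parts *)

Section ComplexForm.
Context {R : realType}.
Let D : set R := halfline R.
Let mD : measurable D := measurable_halfline.
Implicit Types (f phi psi : R -> R[i]).

Lemma normc_sqr (z : R[i]) :
  ComplexField.Normc.normc z ^+ 2 = complex.Re z ^+ 2 + complex.Im z ^+ 2.
Proof. by case: z => x y /=; rewrite sqr_sqrtr// addr_ge0 ?sqr_ge0. Qed.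

Lemma L2normE f : sqint D (re f) -> sqint D (im f) ->
  L2norm f = (Num.sqrt (nrm D (re f) ^+ 2 + nrm D (im f) ^+ 2))%:E.
Proof.
move=> fr fi; have i1 := integD mD fr.2 fi.2.
rewrite /L2norm !nrm_sqr -(RintD mD fr.2 fi.2) -(sqrteE mD i1).
  by congr (_ `^ _)%E; apply: eq_integral => y _; rewrite normc_sqr.
by move=> y _; rewrite addr_ge0 ?sqr_ge0.
Qed.

Lemma in_L2_sqint f : in_L2 f -> sqint D (re f) /\ sqint D (im f).
Proof.
move=> [mr mi fin].
have mh : measurable_fun D (fun y => complex.Re (f y) ^+ 2 + complex.Im (f y) ^+ 2).
  by apply: measurable_funD; exact: measurable_funX.
have h0 y : D y -> 0 <= complex.Re (f y) ^+ 2 + complex.Im (f y) ^+ 2.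
  by move=> _; rewrite addr_ge0 ?sqr_ge0.
have i : integ D (fun y => complex.Re (f y) ^+ 2 + complex.Im (f y) ^+ 2).
  apply: integ_sqrte => //; move: fin; rewrite /L2norm.
  by under eq_integral do rewrite normc_sqr.
split; split=> //; apply: (integ_le mD _ i).
- exact: measurable_funX.
- by move=> y _; rewrite ger0_norm ?sqr_ge0// lerDl sqr_ge0.
- exact: measurable_funX.
- by move=> y _; rewrite ger0_norm ?sqr_ge0// lerDr sqr_ge0.
Qed.

Lemma in_X_Xr phi : in_X phi -> in_Xr (re phi) /\ in_Xr (im phi).
Proof.
move=> [/in_L2_sqint[sr si] lim0 [g /in_L2_sqint[gr gi] [dr di]]].
have nle (z : R[i]) : `|complex.Re z| <= ComplexField.Normc.normc z /\
    `|complex.Im z| <= ComplexField.Normc.normc z.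
  by split; rewrite -sqrtr_sqr; case: z => x y /=; rewrite ler_sqrt ?addr_ge0 ?sqr_ge0//;
    rewrite ?lerDl ?lerDr sqr_ge0.
have n0 (z : R[i]) : 0 <= ComplexField.Normc.normc z.
  by case: z => x y /=; exact: sqrtr_ge0.
split; split=> //.
- by exists (re g).
- apply: (squeeze_cvgr _ (cvg_cst 0) lim0); apply: nearW => y.
  by rewrite normr_ge0 (nle _).1.
- by exists (im g).
- apply: (squeeze_cvgr _ (cvg_cst 0) lim0); apply: nearW => y.
  by rewrite normr_ge0 (nle _).2.
Qed.

Lemma La_comp a c_l Omega phi y :
  La a c_l Omega phi y =
    (rL a c_l Omega (re phi) y +i* rL a c_l Omega (im phi) y)%C.
Proof.
rewrite /La /cext /rL.
move: (prof_b a c_l Omega y) (prof_q Omega y) (Omega y) (derive1 Omega y) => b q w w'.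
move: (Vop (re phi) y) (Vop (im phi) y) => V1 V2.
move: (derive1 (re phi) y) (derive1 (im phi) y) => u' v'.
move: (hilbert_odd (re phi) y) (hilbert_odd (im phi) y) => h1 h2.
by case: (phi y) => x z; apply/eqP; rewrite eq_complex /=; apply/andP; split; apply/eqP; ring.
Qed.

End ComplexForm.

(** * Resolvent estimate and injectivity *)

Section Resolvent.
Context {R : realType} (a c_l : R) (Omega : R -> R).
Context (ha : 0 < a < 1).
Context (Omega_smooth : smooth Omega).
Context (Omega_odd : forall y, Omega (- y) = - Omega y).
Context (hprof : H_prof a c_l Omega).
Context (hK4 : K4_plus Omega).
Context (hD : D_infty a c_l Omega).
Let D : set R := halfline R.
Let mD : measurable D := measurable_halfline.
Local Notation Em := (Eminus a c_l Omega).
Local Notation Ep := (Eplus a c_l Omega).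
Local Notation L := (rL a c_l Omega).
Implicit Types (u v : R -> R) (r s : R).

Lemma cauchy_schwarz2 (x y z w : R) : 0 <= x -> 0 <= y -> 0 <= z -> 0 <= w ->
  x * y + z * w <= Num.sqrt (x ^+ 2 + z ^+ 2) * Num.sqrt (y ^+ 2 + w ^+ 2).
Proof.
move=> x0 y0 z0 w0; rewrite -sqrtrM ?addr_ge0 ?sqr_ge0//.
rewrite -[leLHS]ger0_norm ?addr_ge0 ?mulr_ge0// -sqrtr_sqr ler_wsqrtr//.
rewrite -subr_ge0 (_ : _ - _ = (x * w - z * y) ^+ 2) ?sqr_ge0//.
by clear; ring.
Qed.

(** m1 and m2 are the real and imaginary parts of (L - lambda) phi for lambda = r + is, phi = u +
    iv. In int m1 u + int m2 v, the real part of the pairing with phi, the terms in s cancel and the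
    two real forms minus r N remain. *)
Lemma shifted_form u v r s : in_Xr u -> in_Xr v -> sqint D (L u) -> sqint D (L v) ->
  let m1 := fun y => L u y - (r * u y - s * v y) in
  let m2 := fun y => L v y - (r * v y + s * u y) in
  let N := nrm D u ^+ 2 + nrm D v ^+ 2 in
  let M := nrm D m1 ^+ 2 + nrm D m2 ^+ 2 in
  (Em - r) * N <= Num.sqrt M * Num.sqrt N /\
  (r - Ep) * N <= Num.sqrt M * Num.sqrt N.
Proof.
move=> uX vX Lu Lv m1 m2 N M.
have ui : sqint D u by case: uX.
have vi : sqint D v by case: vX.
have s1 : sqint D m1 by apply: sqintB => //; apply: sqintB => //; exact: sqintZ.
have s2 : sqint D m2 by apply: sqintB => //; apply: sqintD => //; exact: sqintZ.
have i1 := sqintM mD s1 ui; have i2 := sqintM mD s2 vi.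
have j1 := sqintM mD Lu ui; have j2 := sqintM mD Lv vi.
have /andP[l1 r1] := rL_form ha Omega_smooth Omega_odd hprof hK4 hD uX Lu.
have /andP[l2 r2] := rL_form ha Omega_smooth Omega_odd hprof hK4 hD vX Lv.
have /eqP E : \int[mu]_(y in D) (m1 y * u y) + \int[mu]_(y in D) (m2 y * v y) =
    \int[mu]_(y in D) (L u y * u y) + \int[mu]_(y in D) (L v y * v y) - r * N.
  have u2 : integ D (fun y => u y ^+ 2) by exact: ui.2.
  have v2 : integ D (fun y => v y ^+ 2) by exact: vi.2.
  have j3 := integD mD j1 j2.
  have j4 := integZ r mD (integD mD u2 v2).
  rewrite -(RintD mD i1 i2) -(RintD mD j1 j2) /N !nrm_sqr -(RintD mD u2 v2).
  rewrite -(RintZ r mD (integD mD u2 v2)) -(RintB mD j3 j4).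
  apply: eq_intr => y _; rewrite /m1 /m2.
  by move: (L u y) (L v y) (u y) (v y) => p q x z; clear; ring.
have b1 : `|\int[mu]_(y in D) (m1 y * u y)| <= nrm D m1 * nrm D u.
  exact: cauchy_schwarz.
have b2 : `|\int[mu]_(y in D) (m2 y * v y)| <= nrm D m2 * nrm D v.
  exact: cauchy_schwarz.
have := cauchy_schwarz2 (nrm_ge0 D m1) (nrm_ge0 D u) (nrm_ge0 D m2) (nrm_ge0 D v).
rewrite -/N -/M; move: (Num.sqrt M * Num.sqrt N) => K c.
have : `|\int[mu]_(y in D) (m1 y * u y) + \int[mu]_(y in D) (m2 y * v y)| <= K.
  by apply: le_trans c; apply: (le_trans (ler_normD _ _)); exact: lerD.
rewrite (eqP E) ler_norml /N mulrDr => /andP[k1 k2].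
move: l1 l2 r1 r2 k1 k2.
move: (nrm D u ^+ 2) (nrm D v ^+ 2) Em Ep => n1 n2 em ep.
move: (\int[mu]_(y in D) (L u y * u y)) (\int[mu]_(y in D) (L v y * v y)) => A B.
by clear; move=> *; split; lra.
Qed.

Lemma dist_itv_le (x y z : R) :
  dist_itv x y z <= `|x - y| /\ dist_itv x y z <= `|x - z|.
Proof.
(* For an empty interval [inf] takes its default value 0. *)
rewrite /dist_itv; have [yz|zy] := leP y z; last first.
  rewrite set_itv_ge; last by rewrite bnd_simp -ltNge.
  by rewrite image_set0 inf0; split; exact: normr_ge0.
by split; apply: ge_inf; [|exists y|..|exists z]; rewrite /= ?in_itv/= ?lexx ?yz//;
  exists 0 => _ [w _ <-].
Qed.

Lemma shifted_bound u v r s : in_Xr u -> in_Xr v -> sqint D (L u) -> sqint D (L v) ->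
  ~ (Em <= r <= Ep) ->
  dist_itv r Em Ep * Num.sqrt (nrm D u ^+ 2 + nrm D v ^+ 2) <=
  Num.sqrt (nrm D (fun y => L u y - (r * u y - s * v y)) ^+ 2 +
            nrm D (fun y => L v y - (r * v y + s * u y)) ^+ 2).
Proof.
move=> uX vX Lu Lv /negP; rewrite negb_and -!ltNge => rE.
have [] := shifted_form r s uX vX Lu Lv; cbv zeta.
have [] := dist_itv_le r Em Ep.
set N := nrm D u ^+ 2 + _; set M := nrm D _ ^+ 2 + _ => d1 d2 f1 f2.
have N0 : 0 <= N by rewrite addr_ge0 ?sqr_ge0.
have [->|n0] := eqVneq (Num.sqrt N) 0; first by rewrite mulr0 sqrtr_ge0.
have {n0}n0 : 0 < Num.sqrt N by rewrite lt_def n0 sqrtr_ge0.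
rewrite -(ler_pM2r n0) -mulrA -expr2 sqr_sqrtr//.
case/orP: rE => h.
- apply: le_trans f1; rewrite ler_wpM2r//; apply: (le_trans d1).
  by rewrite distrC ger0_norm// subr_ge0 ltW.
- apply: le_trans f2; rewrite ler_wpM2r//; apply: (le_trans d2).
  by rewrite ger0_norm// subr_ge0 ltW.
Qed.

(** Derived from [shifted_form] with M = 0, where a strictly positive factor of N appears directly.
    The equations themselves make L u and L v square-integrable. *)
Lemma shifted_inj u v r s : in_Xr u -> in_Xr v ->
  (forall y, 0 < y -> L u y = r * u y - s * v y) ->
  (forall y, 0 < y -> L v y = r * v y + s * u y) ->
  ~ (Em <= r <= Ep) -> forall y, 0 < y -> u y = 0 /\ v y = 0.
Proof.
move=> uX vX eu ev /negP; rewrite negb_and -!ltNge => rE.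
have ui : sqint D u by case: uX.
have vi : sqint D v by case: vX.
have Lu : sqint D (L u).
  apply: (@eq_sqint R D (fun y => r * u y - s * v y)) => //.
    by move=> y /halflineE y0; rewrite eu.
  by apply: sqintB => //; exact: sqintZ.
have Lv : sqint D (L v).
  apply: (@eq_sqint R D (fun y => r * v y + s * u y)) => //.
    by move=> y /halflineE y0; rewrite ev.
  by apply: sqintD => //; exact: sqintZ.
have [] := shifted_form r s uX vX Lu Lv; cbv zeta.
have nz w : (forall y, 0 < y -> w y = 0) -> nrm D w = 0.
  by move=> w0; rewrite /nrm Rint_eq0 ?sqrtr0// => y /halflineE y0; rewrite w0// expr0n.
have z1 : nrm D (fun y => L u y - (r * u y - s * v y)) = 0.
  by apply: nz => y y0; rewrite eu// subrr.
have z2 : nrm D (fun y => L v y - (r * v y + s * u y)) = 0.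
  by apply: nz => y y0; rewrite ev// subrr.
rewrite z1 z2 expr0n addr0 sqrtr0 mul0r => f1 f2.
have N0 : nrm D u ^+ 2 + nrm D v ^+ 2 <= 0.
  case/orP: rE => h; [move: f1|move: f2]; by rewrite pmulr_rle0// subr_gt0.
move: N0; rewrite le_eqVlt ltNge addr_ge0 ?sqr_ge0// orbF paddr_eq0 ?sqr_ge0//.
rewrite !sqrf_eq0 => /andP[/eqP nu /eqP nv] y y0.
by split; [exact: nrm_eq0 uX nu _ y0|exact: nrm_eq0 vX nv _ y0].
Qed.

End Resolvent.

Theorem lemma5p1 (R : realType) (a c_l : R) (Omega : R -> R)
    (ha : 0 < a < 1)
    (Omega_smooth : smooth Omega)
    (Omega_odd : forall y, Omega (- y) = - Omega y)
    (hprof : H_prof a c_l Omega)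
    (hK4 : K4_plus Omega)
    (hD : D_infty a c_l Omega) :
  let Em := Eminus a c_l Omega in
  let Ep := Eplus a c_l Omega in
  let L := La a c_l Omega in
  [/\ (forall (phi : R -> R[i]) (lambda : R[i]),
         in_Da a c_l Omega phi ->
         ~ (Em <= complex.Re lambda <= Ep) ->
         ((dist_itv (complex.Re lambda) Em Ep)%:E * L2norm phi
          <= L2norm (fun y => L phi y - lambda * phi y)%R)%E),
      (forall lambda : R[i],
         ~ (Em <= complex.Re lambda <= Ep) ->
         forall phi psi : R -> R[i],
         in_Da a c_l Omega phi -> in_Da a c_l Omega psi ->
         eqX (fun y => L phi y - lambda * phi y)
             (fun y => L psi y - lambda * psi y) ->
         eqX phi psi) &
      (forall lambda : R[i], eigenvalue_La a c_l Omega lambda ->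
         Em <= complex.Re lambda <= Ep)].
Proof.
move=> Em Ep L.
have mD : measurable (halfline R) := measurable_halfline.
have LE phi y : L phi y =
    (rL a c_l Omega (re phi) y +i* rL a c_l Omega (im phi) y)%C by exact: La_comp.
have bound := shifted_bound ha Omega_smooth Omega_odd hprof hK4 hD.
have inj := shifted_inj ha Omega_smooth Omega_odd hprof hK4 hD.
have fu phi r s y : complex.Re (L phi y - Complex r s * phi y) =
    rL a c_l Omega (re phi) y - (r * complex.Re (phi y) - s * complex.Im (phi y)).
  by rewrite LE; case: (phi y).
have fv phi r s y : complex.Im (L phi y - Complex r s * phi y) =
    rL a c_l Omega (im phi) y - (r * complex.Im (phi y) + s * complex.Re (phi y)).
  by rewrite LE; case: (phi y).
split.
- move=> phi [r s] [phiX LX] rE.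
  have [uX vX] := in_X_Xr phiX.
  (* The domain condition supplies the square-integrability of both components of L phi. *)
  have [[Lu _ _] [Lv _ _]] := in_X_Xr LX.
  have eu y : complex.Re (L phi y) = rL a c_l Omega (re phi) y by rewrite LE.
  have ev y : complex.Im (L phi y) = rL a c_l Omega (im phi) y by rewrite LE.
  have {}Lu : sqint (halfline R) (rL a c_l Omega (re phi)).
    by apply: eq_sqint Lu => // y _; exact: eu.
  have {}Lv : sqint (halfline R) (rL a c_l Omega (im phi)).
    by apply: eq_sqint Lv => // y _; exact: ev.
  have [ui _ _] := uX; have [vi _ _] := vX.
  rewrite (L2normE ui vi) L2normE.
  + rewrite -EFinM lee_fin (funext (fu phi r s)) (funext (fv phi r s)); exact: bound.
  + rewrite (funext (fu phi r s)); apply: sqintB => //.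
    by apply: sqintB => //; exact: sqintZ.
  + rewrite (funext (fv phi r s)); apply: sqintB => //.
    by apply: sqintD => //; exact: sqintZ.
- move=> [r s] rE phi psi [phiX _] [psiX _] e y y0.
  have [uX vX] := in_X_Xr phiX; have [u'X v'X] := in_X_Xr psiX.
  have c t : 0 < t ->
      rL a c_l Omega (re phi) t - (r * complex.Re (phi t) - s * complex.Im (phi t)) =
      rL a c_l Omega (re psi) t - (r * complex.Re (psi t) - s * complex.Im (psi t)) /\
      rL a c_l Omega (im phi) t - (r * complex.Im (phi t) + s * complex.Re (phi t)) =
      rL a c_l Omega (im psi) t - (r * complex.Im (psi t) + s * complex.Re (psi t)).
    move=> t0; have /= et := e t t0.
    have e1 := congr1 (@complex.Re R) et; have e2 := congr1 (@complex.Im R) et.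
    by rewrite (fu phi) (fu psi) in e1; rewrite (fv phi) (fv psi) in e2.
  (* The difference phi - psi solves the homogeneous equation, by additivity of [rL] on each
     component. *)
  have [|||h1 h2] := inj _ _ r s (in_Xr_sub uX u'X) (in_Xr_sub vX v'X) _ _ _ y y0.
  + by move=> t t0; have [/eqP] := c t t0; rewrite rL_sub// subr_eq => /eqP -> _; ring.
  + by move=> t t0; have [_ /eqP] := c t t0; rewrite rL_sub// subr_eq => /eqP ->; ring.
  + exact: rE.
  apply/eqP; rewrite eq_complex -subr_eq0 h1 eqxx/=.
  by rewrite -subr_eq0 h2 eqxx.
- move=> [r s] [phi [[phiX _] nz e]]; apply: contrapT => rE; apply: nz => y y0.
  have [uX vX] := in_X_Xr phiX.
  have c t : 0 < t ->
      rL a c_l Omega (re phi) t = r * complex.Re (phi t) - s * complex.Im (phi t) /\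
      rL a c_l Omega (im phi) t = r * complex.Im (phi t) + s * complex.Re (phi t).
    move=> t0; have e0 : L phi t - Complex r s * phi t = 0 by rewrite /L e// subrr.
    by split; apply/eqP; rewrite -subr_eq0; [rewrite -(fu phi r s t)|rewrite -(fv phi r s t)]; rewrite e0.
  have [|||h1 h2] := inj _ _ r s uX vX _ _ _ y y0.
  + by move=> t t0; rewrite (c t t0).1.
  + by move=> t t0; rewrite (c t t0).2.
  + exact: rE.
  by apply/eqP; rewrite eq_complex h1 h2 /= eqxx.
Qed.
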